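(* There exists a constant $C=C(d)<\infty$ such that the following holds. Let $T<\infty$ and let $\chi^0\colon\mathbb{R}^d\to\{0,1\}$ with $\int\chi^0\,dx=1$, $\{\chi^0=1\}\subset\subset\mathbb{R}^d$ and $E_0:=E(\chi^0)<\infty$. Let $\chi^h$ be the approximate solutions obtained by the volume-preserving thresholding scheme with time step $h$ and let $\lambda_h$ be the corresponding threshold values. Then for all $0<h<\frac1{CE_0^2}$, $$\int_0^T\big(\lambda_h-\tfrac12\big)^2\,dt\le C\,(1+T)(1+E_0^4)\,h.$$
   Context: Integrals without domain are over $\mathbb{R}^d$; $\{0,1\}$-valued functions are measurable. Heat kernel: $G_h(z)=(4\pi h)^{-d/2}\exp(-|z|^2/(4h))$. $E(\chi)=\frac1{\sqrt\pi}\int|\nabla\chi|$ (total variation). Volume-preserving thresholding scheme: $\Omega^0=\{\chi^0=1\}$. Given $\Omega^{n-1}$ with $|\Omega^{n-1}|=1$, let $\phi=G_h\ast\mathbf 1_{\Omega^{n-1}}$, pick $\lambda_n$ such that $|\{\phi>\lambda_n\}|=1$ (it is understood that such a $\lambda_n$ exists), and set $\Omega^n=\{\phi>\lambda_n\}$; $\chi^n=\mathbf 1_{\Omega^n}$, $\chi^h(t)=\chi^n$ for $t\in[nh,(n+1)h)$. $T=Nh$ and $\lambda_h$ denotes the piecewise constant in time interpolation of $\lambda_1,\dots,\lambda_N$, so that $\int_0^T(\lambda_h-\frac12)^2dt=h\sum_{n=1}^N(\lambda_n-\frac12)^2$. *)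

(* Defs.v *)
From HB Require Import structures.
From mathcomp Require Import all_boot all_order all_algebra.
From mathcomp Require Import all_classical all_reals all_analysis.

Set Implicit Arguments.
Unset Strict Implicit.
Unset Printing Implicit Defensive.
Import Order.TTheory GRing.Theory Num.Theory.
Import numFieldNormedType.Exports.

Local Open Scope classical_set_scope.
Local Open Scope ring_scope.

Definition rV_display : measure_display.
Proof. exact. Qed.

(* The sigma-algebra generated by the coordinates; since R is second countable
   it is the Borel sigma-algebra of 'rV[R]_n. *)
Section measurable_rV.
Context {R : realType} {n : nat}.

Let coord (i : 'I_n) (x : 'rV[R]_n) : measurableTypeR R := x ord0 i.

Let rV_set0 : g_sigma_preimage coord set0.
Proof. exact: sigma_algebra0. Qed.

Let rV_setC A : g_sigma_preimage coord A -> g_sigma_preimage coord (~` A).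
Proof. exact: sigma_algebraC. Qed.

Let rV_bigcup (F : (set _)^nat) : (forall i, g_sigma_preimage coord (F i)) ->
  g_sigma_preimage coord (\bigcup_i (F i)).
Proof. exact: sigma_algebra_bigcup. Qed.

HB.instance Definition _ := @isMeasurable.Build rV_display
  'rV[R]_n (g_sigma_preimage coord) rV_set0 rV_setC rV_bigcup.

Lemma measurable_coord_rV (i : 'I_n) :
  measurable_fun [set: 'rV[R]_n] (fun x : 'rV[R]_n => x ord0 i).
Proof.
move=> _ Y mY; rewrite setTI; apply: sub_sigma_algebra => /=.
rewrite -bigcup_seq/=; exists i => /=; first by rewrite mem_index_enum.
by exists Y => //; rewrite setTI.
Qed.

Lemma measurable_fun_rV d (T : measurableType d) (f : T -> 'rV[R]_n) :
  (forall i, measurable_fun [set: T] (fun x => f x ord0 i)) ->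
  measurable_fun [set: T] f.
Proof.
move=> mf.
have sub : preimage_set_system [set: T] f (g_sigma_preimage coord)
    `<=` measurable.
  rewrite -g_sigma_preimage_comp.
  apply: smallest_sub; first exact: sigma_algebra_measurable.
  rewrite -bigcup_seq => A [i _] [Y mY <-].
  exact: mf.
by move=> _ Y mY; apply: sub; exists Y.
Qed.

End measurable_rV.

Section rV_cons.
Context {R : realType} {n : nat}.

Definition rV_cons (z : measurableTypeR R * 'rV[R]_n) : 'rV[R]_n.+1 :=
  @row_mx R 1 1 n (const_mx z.1) z.2.

Definition rV_uncons (x : 'rV[R]_n.+1) : measurableTypeR R * 'rV[R]_n :=
  (x ord0 ord0, \row_i x ord0 (lift ord0 i)).

Lemma rV_cons0 z (j : 'I_1) : rV_cons z ord0 (lshift n j) = z.1.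
Proof. by rewrite [LHS]row_mxEl mxE. Qed.

Lemma rV_consS z i : rV_cons z ord0 (rshift 1 i) = z.2 ord0 i.
Proof. exact: row_mxEr. Qed.

Lemma rV_consK : cancel rV_cons rV_uncons.
Proof.
case=> a v; congr pair.
  rewrite (_ : @ord0 n = lshift n (@ord0 0)); last exact/val_inj.
  exact: rV_cons0.
apply/rowP => i; rewrite mxE.
rewrite (_ : lift ord0 i = rshift 1 i); last exact/val_inj.
exact: rV_consS.
Qed.

Lemma measurable_rV_cons : measurable_fun setT rV_cons.
Proof.
apply: measurable_fun_rV => i.
case: (@split_ordP 1 n i) => j ->.
  rewrite (_ : (fun _ => _) = fst); first exact: measurable_fst.
  by apply/funext => z; exact: rV_cons0.
rewrite (_ : (fun _ => _) = (fun x : 'rV[R]_n => x ord0 j) \o snd).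
  by apply: measurableT_comp; [exact: measurable_coord_rV|exact: measurable_snd].
by apply/funext => z; exact: rV_consS.
Qed.

Lemma measurable_rV_uncons : measurable_fun setT rV_uncons.
Proof.
apply: measurable_fun_pair; first exact: measurable_coord_rV.
apply: measurable_fun_rV => i.
rewrite (_ : (fun _ => _) = fun x : 'rV[R]_n.+1 => x ord0 (lift ord0 i)).
  exact: measurable_coord_rV.
by apply/funext => x; rewrite mxE.
Qed.

End rV_cons.

Section lebesgue_rV_succ.
Context {R : realType} {n : nat}.
Variable mu : {sigma_finite_measure set 'rV[R]_n -> \bar R}.

Definition lebesgue_rV_succ : set 'rV[R]_n.+1 -> \bar R :=
  pushforward (@lebesgue_measure R \x mu)%E rV_cons.

Let lebesgue_rV_succ0 : lebesgue_rV_succ set0 = 0%E.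
Proof. by rewrite /lebesgue_rV_succ /pushforward preimage_set0 measure0. Qed.

Let measurable_preimage_cons A :
  measurable A -> measurable (@rV_cons R n @^-1` A).
Proof.
by move=> mA; rewrite -[X in measurable X]setTI; exact: measurable_rV_cons.
Qed.

Let lebesgue_rV_succ_ge0 A : (0 <= lebesgue_rV_succ A)%E.
Proof. exact: (measure_ge0 (@lebesgue_measure R \x mu)%E). Qed.

Let lebesgue_rV_succ_sigma_additive : semi_sigma_additive lebesgue_rV_succ.
Proof.
move=> F mF tF mUF; rewrite /lebesgue_rV_succ /pushforward preimage_bigcup.
apply: (@measure_semi_sigma_additive _ _ _ (@lebesgue_measure R \x mu)%E).
- by move=> k; exact: measurable_preimage_cons.
- apply/trivIsetP => /= i j _ _ ij; rewrite -preimage_setI.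
  by move/trivIsetP : tF => /(_ i j) -> //; rewrite preimage_set0.
- by rewrite -preimage_bigcup; exact: measurable_preimage_cons.
Qed.

HB.instance Definition _ := isMeasure.Build _ _ _ lebesgue_rV_succ
  lebesgue_rV_succ0 lebesgue_rV_succ_ge0 lebesgue_rV_succ_sigma_additive.

(* The sigma-finiteness of \x is reproved here: its canonical instance is
   shadowed by the one for products of subprobabilities. *)
Let lebesgue_rV_succ_sigma_finite : sigma_finite setT lebesgue_rV_succ.
Proof.
have [F TF mF] : sigma_finite setT (@lebesgue_measure R \x mu)%E.
  have /sigma_finiteP[F [TF ndF Foo]] := sigma_finiteT (@lebesgue_measure R).
  have /sigma_finiteP[G [TG ndG Goo]] := sigma_finiteT mu.
  exists (fun k => F k `*` G k).
    rewrite -setXTT TF TG predeqE => -[x y]; split.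
      move=> [/= [k _ Fkx] [m _ Gmy]]; exists (maxn k m) => //; split.
      - by move: x Fkx; exact/subsetPset/ndF/leq_maxl.
      - by move: y Gmy; exact/subsetPset/ndG/leq_maxr.
    by move=> [k _ []/= ? ?]; split; exists k.
  move=> k; have [? ?] := Foo k; have [? ?] := Goo k.
  split; first exact: measurableX.
  by rewrite product_measure1E// lte_mul_pinfty// ge0_fin_numE.
exists (fun k => rV_uncons @^-1` F k).
  by rewrite -preimage_bigcup -TF preimage_setT.
move=> k; have [mFk Fkoo] := mF k; split.
  by rewrite -[X in measurable X]setTI; exact: measurable_rV_uncons.
rewrite /lebesgue_rV_succ /pushforward -comp_preimage.
rewrite (_ : rV_uncons \o rV_cons = id) ?preimage_id//.
by apply/funext => z; exact: rV_consK.
Qed.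

HB.instance Definition _ := Measure_isSigmaFinite.Build _ _ _ lebesgue_rV_succ
  lebesgue_rV_succ_sigma_finite.

End lebesgue_rV_succ.

Fixpoint borel_lebesgue_rV {R : realType} (n : nat) :
    {sigma_finite_measure set 'rV[R]_n -> \bar R} :=
  match n with
  | 0%N => \d_(0 : 'rV[R]_0)
  | m.+1 => lebesgue_rV_succ (borel_lebesgue_rV m)
  end.

(* 'rV[R]_n with the sigma-algebra of Lebesgue measurable sets. *)
Definition lebesgue_space (R : realType) (n : nat) : measurableType _ :=
  caratheodory_type (mu_ext (@borel_lebesgue_rV R n)).

(* The completion of the Borel product measure, i.e. the Lebesgue measure. *)
Definition lebesgue_rV (R : realType) (n : nat) :
    {measure set (lebesgue_space R n) -> \bar R} :=
  @completed_measure_extension _ _ _ (@borel_lebesgue_rV R n).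

Section thresholding.
Context {R : realType} {d : nat}.
Implicit Types (chi f g : 'rV[R]_d -> R) (xi : 'rV[R]_d -> 'rV[R]_d).
Implicit Types (Omega : nat -> set 'rV[R]_d) (lambda : nat -> R).

(* The library norm `|x| of a row vector is the sup norm. *)
Definition enorm (x : 'rV[R]_d) : R := Num.sqrt (\sum_i x ord0 i ^+ 2).

Definition basis_vec (i : 'I_d) : 'rV[R]_d := delta_mx ord0 i.

Definition C1 xi : Prop :=
  (forall i x, derivable xi x (basis_vec i)) /\
  (forall i, continuous ('D_(basis_vec i) xi)).

Definition compact_support xi : Prop :=
  compact (closure [set x | xi x != 0]).

Definition divergence xi (x : 'rV[R]_d) : R :=
  \sum_i ('D_(basis_vec i) xi x) ord0 i.

Definition total_variation_rV chi : \bar R :=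
  ereal_sup [set (\int[lebesgue_rV R d]_x (chi x * divergence xi x)%:E)%E | xi in
    [set xi | [/\ C1 xi, compact_support xi & forall x, enorm (xi x) <= 1]]].

Definition energy chi : \bar R :=
  ((Num.sqrt pi)^-1%:E * total_variation_rV chi)%E.

Definition heat_kernel (h : R) (z : 'rV[R]_d) : R :=
  (4 * pi * h) `^ (- (d%:R / 2)) * expR (- (enorm z ^+ 2 / (4 * h))).

Definition convolution f g (x : 'rV[R]_d) : R :=
  (\int[lebesgue_rV R d]_y (f (x - y) * g y))%R.

(* The step n.+1 uses the threshold lambda n.+1; lambda 0 is never used. *)
Definition vp_thresholding (chi0 : 'rV[R]_d -> R) (h : R) (N : nat)
    Omega lambda : Prop :=
  Omega 0%N = [set x | chi0 x = 1] /\
  forall n, (n < N)%N ->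
    let phi := convolution (heat_kernel h) (\1_(Omega n)) in
    lebesgue_rV R d [set x | lambda n.+1 < phi x] = 1%E /\
    Omega n.+1 = [set x | lambda n.+1 < phi x].

(* Equal to lambda n on [(n - 1) h, n h) for n >= 1. *)
Definition lambda_interp (h : R) lambda (t : R) : R :=
  lambda (Num.truncn (t / h)).+1.

End thresholding.

(* Main.v *)
Require Import Defs.
From HB Require Import structures.
From mathcomp Require Import all_boot all_order all_algebra.
From mathcomp Require Import all_classical all_reals all_analysis measurable_realfun.
From mathcomp Require Import ring lra.

Set Implicit Arguments.
Unset Strict Implicit.
Unset Printing Implicit Defensive.
Import Order.TTheory GRing.Theory Num.Theory.
Import numFieldNormedType.Exports.

Local Open Scope classical_set_scope.
Local Open Scope ring_scope.

(** Let [a], [a'] be the indicators before and after one step, [s = sqrt h], [G_r]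
the heat kernel at time [r ^+ 2], [u = a - a'] and [H(r) = \int a' (G_r * (1 - a'))].
Since [a'] is the superlevel set of [phi = G_s * a], shifting [(phi - lambda)_+]
gives, for every smooth [eta], the Euler-Lagrange identity
  [(lambda - 1/2) \int a' d_i eta = \int a' (phi - 1/2) d_i eta + \int a' eta d_i phi].
It is tested with [eta = K_r * a'], [K_r(z) = z_i G_r(z) / (2 r)]. As [sum_i d_i K_r]
equals [- (1/2) d/dr G_r], the integrals [\int a' d_i eta] sum up to [(1/2) H'(r)].
If [H(s) <= E s], then [H(m s) <= m H(s) <= 1/4] for [m] of order [1 / (s E)], while
[H(4) >= 3/4], so by the mean value theorem some [i] and some [r >= m s] make the left
integral at least a constant. With [G_s * a'] in place of [phi] the right-hand side is
of order [H(s) / r = O(s E ^+ 2)]; by Cauchy-Schwarz, the square of the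
error made in replacing [phi] is at most a multiple of [(E / s) \int u (G_s * u)].
Minimality of [a'] bounds [\int u (G_s * u)] by the drop of [H(s)] during the step, so
these terms telescope to [(E / s) H(s)] at time 0, which is at most [E ^+ 2]. Finally
[H(s) <= C E0 s] initially: the same formula for [H'] is tested against the total
variation of the initial set by cutting [eta] off outside that set. *)

(** * Change of variables *)

(** No regularity of the boundary of a superlevel set is available, so every variational identity is
    obtained by translating functions and comparing first-order terms, with remainders quadratic in
    the step. The test function is a mollification of [a'] itself because the left integrals then
    add up to a scale derivative of [H], and [H] has to climb from 1/4 to 3/4 over a bounded
    interval. The mean value theorem does not say which [r] occurs; only a lower bound on [r] is
    kept, since no upper bound deteriorates as [r] grows. With [G_s * a'] in place of [phi], oddness
    of [d_i G_s] allows a symmetrisation after which [d_i G_s] only meets differences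
    [eta x - eta y]; its first moment is bounded uniformly in [s], so no power of [1 / s] is lost.
    For the error, the semigroup property turns [\int u (G_s * u)] into the square of an [L^2] norm,
    the factor that Cauchy-Schwarz needs. Smallness of [h] guarantees that [m] is at least 1. The
    datum is only Lebesgue measurable while Fubini's theorem is applied to Borel functions; as only
    integrals of the datum matter, the indicator of a Borel set of the same measure replaces it. *)

Section pushforward.
Context d d' (T1 : measurableType d) (T2 : measurableType d') (R : realType).
Variables (m : {measure set T1 -> \bar R}) (f : T1 -> T2).
Hypothesis mf : measurable_fun setT f.

Definition pushm : {measure set T2 -> \bar R} :=
  measure_function_pushforward__canonical__measure_function_Measure m mf.

Lemma ge0_integral_pushm (g : T2 -> \bar R) :
  measurable_fun setT g -> (forall x, 0 <= g x)%E ->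
  (\int[pushm]_x g x = \int[m]_x g (f x))%E.
Proof. by move=> mg g0; rewrite ge0_integral_pushforward. Qed.

End pushforward.

Section affine1.
Context {R : realType}.
Notation leb := (@lebesgue_measure R).

(** By uniqueness of Lebesgue measure it is enough to compare both sides on half-open intervals; for
    negative [c] the preimage of such an interval is closed on the other side. *)
Lemma lebesgue_measure_affine (c b : R) : c != 0 ->
  forall A : set (measurableTypeR R), measurable A ->
  leb A = (`|c|%:E * leb ((fun x : R => c * x + b)%R @^-1` A))%E.
Proof.
move=> c0.
pose f (x : measurableTypeR R) : measurableTypeR R := c * x + b.
have mf : measurable_fun setT f.
  by apply: measurable_funD => //; exact: measurable_funM.
pose nu : {measure set (measurableTypeR R) -> \bar R} :=
  mscale (NngNum (normr_ge0 c)) (pushm leb mf).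
move=> A mA; rewrite -[RHS]/(nu A); apply: (@lebesgue_measure_unique _ nu) => // X [[x y]] /= xy <-.
rewrite /nu /mscale /= /pushforward /=.
have [cp|cn|] := ltgtP 0 c; last by move=> e; rewrite -e eqxx in c0.
- have -> : f @^-1` `]x, y] = `](x - b) / c, (y - b) / c]%classic.
    apply/seteqP; split=> t /=; rewrite !in_itv/= /f ltr_pdivrMr// ler_pdivlMr//;
      by rewrite ltrBlDr lerBrDr (mulrC t).
  rewrite !lebesgue_measure_itv/= !lte_fin.
  rewrite ltr_pM2r ?invr_gt0// ltrD2r; case: ifP => _; last by rewrite mule0.
  by rewrite -!EFinB -EFinM gtr0_norm//; congr EFin; field.
- have -> : f @^-1` `]x, y] = `[(y - b) / c, (x - b) / c[%classic.
    apply/seteqP; split=> t /=; rewrite !in_itv/= /f ltr_ndivlMr// ler_ndivrMr//;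
      rewrite ltrBlDr lerBrDr (mulrC t) => /andP[? ?]; exact/andP.
  rewrite !lebesgue_measure_itv/= !lte_fin.
  rewrite ltr_nM2r ?invr_lt0// ltrD2r; case: ifP => _; last by rewrite mule0.
  by rewrite -!EFinB -EFinM ltr0_norm//; congr EFin; field.
Qed.

Lemma ge0_integral_affine1 (c b : R) (f : R -> \bar R) : c != 0 ->
  measurable_fun setT (f : measurableTypeR R -> _) -> (forall x, 0 <= f x)%E ->
  (\int[leb]_x f x = `|c|%:E * \int[leb]_x f (c * x + b)%R)%E.
Proof.
move=> c0 mf f0.
pose g (x : measurableTypeR R) : measurableTypeR R := c * x + b.
have mg : measurable_fun setT g.
  by apply: measurable_funD => //; exact: measurable_funM.
pose nu := pushm leb mg.
transitivity (\int[mscale (NngNum (normr_ge0 c)) nu]_x f x)%E.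
  by apply: eq_measure_integral => A mA _; exact: lebesgue_measure_affine.
rewrite ge0_integral_mscale//=; congr (_ * _)%E.
by rewrite ge0_integral_pushm.
Qed.

End affine1.

(** * Integration over row vectors and affine substitutions *)

Section integral_rV.
Context {R : realType}.
Notation mu := (@borel_lebesgue_rV R).
Notation leb := (@lebesgue_measure R).

(** Tonelli's theorem for the recursive construction of the measure; it is what makes induction on
    the dimension possible. *)
Lemma ge0_integral_rV_succ n (f : 'rV[R]_n.+1 -> \bar R) :
  measurable_fun setT f -> (forall x, 0 <= f x)%E ->
  (\int[mu n.+1]_x f x = \int[leb]_a \int[mu n]_w f (rV_cons (a, w)))%E.
Proof.
move=> mf f0.
have mc := @measurable_rV_cons R n.
transitivity (\int[pushm (leb \x mu n)%E mc]_x f x)%E.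
  by apply: eq_measure_integral.
rewrite ge0_integral_pushm//= fubini_tonelli1//.
exact: measurableT_comp.
Qed.

Lemma measurable_rV_comp n (f : 'rV[R]_n.+1 -> \bar R) :
  measurable_fun setT f ->
  measurable_fun setT (fun z : measurableTypeR R * 'rV[R]_n => f (rV_cons z)).
Proof. by move=> mf; apply: measurableT_comp => //; exact: measurable_rV_cons. Qed.

Lemma measurable_affine_rV n (c : R) (v : 'rV[R]_n) :
  measurable_fun setT (fun x : 'rV[R]_n => c *: x + v : 'rV[R]_n).
Proof.
apply: measurable_fun_rV => i.
rewrite (_ : (fun _ => _) = (fun x : 'rV[R]_n => c * x ord0 i + v ord0 i)); last first.
  by apply/funext => x; rewrite !mxE.
apply: measurable_funD => //; apply: measurable_funM => //.
exact: measurable_coord_rV.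
Qed.

Lemma ge0_integral_affine n (c : R) (v : 'rV[R]_n) (f : 'rV[R]_n -> \bar R) :
  c != 0 -> measurable_fun setT f -> (forall x, 0 <= f x)%E ->
  (\int[mu n]_x f x = (`|c| ^+ n)%:E * \int[mu n]_x f (c *: x + v)%R)%E.
Proof.
move=> c0; elim: n v f => [|n IH] v f mf f0.
  rewrite expr0 mul1e; apply: eq_integral => x _; congr f.
  by apply/rowP => -[].
rewrite ge0_integral_rV_succ// [in RHS]ge0_integral_rV_succ//; last first.
  by apply: measurableT_comp => //; exact: measurable_affine_rV.
pose w : 'rV[R]_n := \row_i v ord0 (lift ord0 i).
pose b : R := v ord0 ord0.
have mfc := measurable_rV_comp mf.
have mF : measurable_fun setT (fun a : measurableTypeR R => \int[mu n]_w f (rV_cons (a, w)))%E.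
  exact: (measurable_fun_fubini_tonelli_F (fun z => f (rV_cons z))).
rewrite (@ge0_integral_affine1 _ c b _ c0 mF); last by move=> x; exact: integral_ge0.
rewrite exprS EFinM -muleA; congr (_ * _)%E.
pose g z := f (c *: (@rV_cons R n z) + v).
have mg : measurable_fun setT g.
  exact: (measurableT_comp mf (measurableT_comp (measurable_affine_rV c v)
    (@measurable_rV_cons R n))).
rewrite -ge0_integralZl//; last 2 first.
- by apply: (measurable_fun_fubini_tonelli_F g) => // z; exact: f0.
- by move=> x _; exact: integral_ge0.
apply: eq_integral => a _.
rewrite (IH w)//; last first.
  apply: (measurableT_comp mfc); exact: pair1_measurable.
congr (_ * _)%E; apply: eq_integral => x _; congr f.
apply/rowP => i; case: (@split_ordP 1 n i) => j ->.
- rewrite [LHS]rV_cons0 [RHS]mxE [X in _ = X + _]mxE.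
  rewrite (_ : rV_cons (a, x) 0 _ = a); last exact: rV_cons0.
  by congr (_ + v _ _); apply/val_inj; rewrite /= ord1.
- rewrite [LHS]rV_consS [RHS]mxE [X in _ = X + _]mxE.
  rewrite (_ : rV_cons (a, x) 0 _ = x ord0 j); last exact: rV_consS.
  by rewrite !mxE; congr (_ + v _ _); apply/val_inj.
Qed.

End integral_rV.

(** * Gaussian kernels *)

Section expR_estimates.
Context {R : realType}.
Implicit Types u : R.

Lemma expR_norm_ge1 u : 1 <= expR `|u|.
Proof. by rewrite -expR0 ler_expR. Qed.

Lemma sqr_normr u : `|u| ^+ 2 = u ^+ 2.
Proof. by rewrite -normrX ger0_norm// sqr_ge0. Qed.

Lemma norm_expRB1 u : `|expR u - 1| <= `|u| * expR `|u|.
Proof.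
have e1 : 1 - u <= expR (- u) by have := expR_ge1Dx (- u).
have e2 : expR u - 1 <= u * expR u.
  have : (1 - u) * expR u <= expR (- u) * expR u by rewrite ler_wpM2r// expR_ge0.
  by rewrite expRN mulVf ?gt_eqF ?expR_gt0//; lra.
have e3 := expR_ge1Dx u.
have e4 := expR_norm_ge1 u.
have [u0|u0] := leP 0 u.
  rewrite ger0_norm; last by lra.
  by rewrite ger0_norm.
have e5 : expR u <= 1 by rewrite expR_le1 ltW.
rewrite ler0_norm; last by lra.
rewrite ltr0_norm// in e4 *; nra.
Qed.

(** The remainder lies between 0 and [u * (expR u - 1)], by the tangent inequality at [u] and at
    [- u]. The bound holds for every [u], which matters because the exponents below are unbounded in
    space. *)
Lemma norm_expRB1B u : `|expR u - 1 - u| <= u ^+ 2 * expR `|u|.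
Proof.
have e3 := expR_ge1Dx u.
have e1 : 1 - u <= expR (- u) by have := expR_ge1Dx (- u).
have e2 : expR u - 1 <= u * expR u.
  have : (1 - u) * expR u <= expR (- u) * expR u by rewrite ler_wpM2r// expR_ge0.
  by rewrite expRN mulVf ?gt_eqF ?expR_gt0//; lra.
rewrite ger0_norm; last by lra.
apply: (@le_trans _ _ (u * (expR u - 1))); first by lra.
rewrite (le_trans (ler_norm _))// normrM expr2.
rewrite -[X in X * expR _](ger0_norm (sqr_ge0 u)) normrX expr2 -mulrA.
by rewrite ler_wpM2l// norm_expRB1.
Qed.

End expR_estimates.

Section kernels.
Context {R : realType} {n : nat}.
Implicit Types (z v x y : 'rV[R]_n) (s t b c : R) (i j : 'I_n).
Implicit Types (q : 'rV[R]_n -> R).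

Definition sqnorm z : R := \sum_i z ord0 i ^+ 2.
Definition norm1 z : R := \sum_i `|z ord0 i|.

(* The heat kernel at time [s ^+ 2]. *)
Definition gauss s z : R :=
  (Num.sqrt (4 * pi * s ^+ 2))^-1 ^+ n * expR (- (sqnorm z / (4 * s ^+ 2))).

Lemma sqnorm_ge0 z : 0 <= sqnorm z.
Proof. by apply: sumr_ge0 => i _; exact: sqr_ge0. Qed.

Lemma norm1_ge0 z : 0 <= norm1 z.
Proof. exact: sumr_ge0. Qed.

Lemma ler_norm1 z i : `|z ord0 i| <= norm1 z.
Proof. by rewrite /norm1 (bigD1 i)//= lerDl sumr_ge0. Qed.

Lemma sqnormN z : sqnorm (- z) = sqnorm z.
Proof. by apply: eq_bigr => i _; rewrite mxE sqrrN. Qed.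

Lemma sqnormZ s z : sqnorm (s *: z) = s ^+ 2 * sqnorm z.
Proof. by rewrite /sqnorm mulr_sumr; apply: eq_bigr => i _; rewrite mxE exprMn. Qed.

Lemma enorm_sqr z : enorm z ^+ 2 = sqnorm z.
Proof. by rewrite /enorm sqr_sqrtr// sqnorm_ge0. Qed.

Lemma sqrt_peak s : 0 < s -> Num.sqrt (4 * pi * s ^+ 2) = s * Num.sqrt (4 * pi).
Proof.
by move=> s0; rewrite mulrC sqrtrM ?sqr_ge0// sqrtr_sqr gtr0_norm.
Qed.

Lemma gauss_peak_gt0 s : 0 < s -> 0 < (Num.sqrt (4 * pi * s ^+ 2))^-1 :> R.
Proof.
by move=> s0; rewrite invr_gt0 sqrtr_gt0 !mulr_gt0 ?pi_gt0// exprn_gt0.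
Qed.

Lemma gauss_ge0 s z : 0 <= gauss s z.
Proof. by rewrite mulr_ge0 ?expR_ge0// exprn_ge0// invr_ge0. Qed.

Lemma gaussN s z : gauss s (- z) = gauss s z.
Proof. by rewrite /gauss sqnormN. Qed.

Lemma gauss_sym s x y : gauss s (x - y) = gauss s (y - x).
Proof. by rewrite -gaussN opprB. Qed.

Lemma heat_kernelE h z : 0 < h -> heat_kernel h z = gauss (Num.sqrt h) z.
Proof.
move=> h0; rewrite /heat_kernel /gauss enorm_sqr sqr_sqrtr ?ltW//; congr (_ * _).
have p0 : 0 < 4 * pi * h :> R by rewrite !mulr_gt0 ?pi_gt0.
rewrite -powR12_sqrt ?ltW// -powRN -powR_mulrn ?powR_ge0// -powRrM; congr (_ `^ _).
by rewrite mulNr mulrC.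
Qed.

Lemma gauss_le_peak s z : gauss s z <= (Num.sqrt (4 * pi * s ^+ 2))^-1 ^+ n.
Proof.
rewrite ler_piMr ?exprn_ge0 ?invr_ge0//.
by rewrite expR_le1 oppr_le0 divr_ge0 ?sqnorm_ge0// mulr_ge0// sqr_ge0.
Qed.

Lemma gauss_scale c s z : 0 < c -> 0 < s ->
  gauss (c * s) (c *: z) = c^-1 ^+ n * gauss s z.
Proof.
move=> c0 s0; rewrite /gauss sqnormZ [RHS]mulrA; congr (_ * expR (- _)); last first.
  by field; rewrite !gt_eqF.
rewrite -exprMn; congr (_ ^+ n).
by rewrite !sqrt_peak ?mulr_gt0// -mulrA invfM.
Qed.

Lemma gauss_widen s t z : 0 < s -> s <= t -> gauss s z <= (t / s) ^+ n * gauss t z.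
Proof.
move=> s0 st; have t0 : 0 < t by exact: lt_le_trans st.
rewrite /gauss [leRHS]mulrA -exprMn ler_pM ?exprn_ge0 ?invr_ge0 ?expR_ge0//.
- rewrite le_eqVlt; apply/orP; left; apply/eqP; congr (_ ^+ n).
  rewrite !sqrt_peak//.
  have : 0 < Num.sqrt (4 * pi) :> R by rewrite sqrtr_gt0 mulr_gt0 ?pi_gt0.
  by move=> p0; field; rewrite !gt_eqF.
- rewrite ler_expR lerN2; apply: ler_wpM2l; first exact: sqnorm_ge0.
  rewrite lef_pV2 ?posrE ?mulr_gt0 ?exprn_gt0// ler_pM2l//.
  by rewrite ler_sqr// nnegrE ltW.
Qed.

(** Completing the square in [y]: the product of two Gaussians of scale [s / sqrt 2] is a Gaussian
    in [y] centred at [x / 2], times one in [x]. Integrating in [y] gives the semigroup property of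
    the heat kernel. *)
Lemma gauss_mul s x y : 0 < s ->
  gauss (s / Num.sqrt 2) (x - y) * gauss (s / Num.sqrt 2) y =
  gauss s x * gauss (s / 2) (y - 2^-1 *: x).
Proof.
move=> s0; rewrite /gauss mulrACA [RHS]mulrACA -!exprMn -!expRD.
have s2 : Num.sqrt 2 ^+ 2 = 2 :> R by rewrite sqr_sqrtr.
congr (_ ^+ n * expR _).
- have r0 : 0 < Num.sqrt 2 :> R by rewrite sqrtr_gt0.
  have p0 : 0 < Num.sqrt (4 * pi) :> R by rewrite sqrtr_gt0 mulr_gt0 ?pi_gt0.
  rewrite !sqrt_peak ?divr_gt0//.
  transitivity (Num.sqrt 2 ^+ 2 / (s * Num.sqrt (4 * pi)) ^+ 2 : R).
    by field; rewrite !gt_eqF.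
  by rewrite s2; field; rewrite !gt_eqF.
- have e : sqnorm (x - y) = 2^-1 * sqnorm x + 2 * sqnorm (y - 2^-1 *: x) - sqnorm y.
    rewrite /sqnorm !mulr_sumr -big_split -sumrB; apply: eq_bigr => i _.
    by rewrite !mxE /=; field.
  by rewrite e !expr_div_n s2; field; rewrite gt_eqF.
Qed.

End kernels.

(** * Kernels of Gaussian decay: domination, Lipschitz bounds, derivatives *)

Section kernel_classes.
Context {R : realType} {n : nat}.
Implicit Types (z v x y : 'rV[R]_n) (s t b c : R) (i j : 'I_n).
Implicit Types (q : 'rV[R]_n -> R).

(* The exponential absorbs polynomial factors and shifts by bounded vectors. *)
Definition gdom c z : R := gauss 1 z * expR (c * (1 + norm1 z)).

Definition kernel_dom q := exists2 c : R, 0 <= c & forall z, `|q z| <= gdom c z.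

(** Here and in [kernel_diff] the constant is replaced by an integrable weight at the base point
    [z], so that the bound survives convolution. Steps are limited to size one because the weight at
    [z + v] is then controlled by a weight at [z]. *)
Definition kernel_lip q := exists2 c : R, 0 <= c &
  forall z v b, 0 <= b <= 1 -> (forall i, `|v ord0 i| <= b) ->
    `|q (z + v) - q z| <= b * gdom c z.

Definition kernel_diff i q q' := exists2 c : R, 0 <= c &
  forall z t, `|t| <= 1 ->
    `|q (z + t *: basis_vec i) - q z - t * q' z| <= t ^+ 2 * gdom c z.

Lemma gdom_ge0 c z : 0 <= gdom c z.
Proof. by rewrite mulr_ge0 ?gauss_ge0 ?expR_ge0. Qed.

Lemma le_gdom c c' z : c <= c' -> gdom c z <= gdom c' z.
Proof.
move=> cc; rewrite ler_wpM2l ?gauss_ge0// ler_expR ler_wpM2r//.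
by rewrite addr_ge0// norm1_ge0.
Qed.

Lemma norm1_1_ge1 z : 1 <= 1 + norm1 z.
Proof. by rewrite lerDl norm1_ge0. Qed.

Lemma le_expR_norm1 c z : 0 <= c -> c <= expR (c * (1 + norm1 z)).
Proof.
move=> c0; rewrite (le_trans _ (expR_ge1Dx _))// ler_wpDl//.
by rewrite ler_peMr// norm1_1_ge1.
Qed.

Lemma gdomM b c z : gdom (b + c) z = expR (b * (1 + norm1 z)) * gdom c z.
Proof. by rewrite /gdom mulrCA -expRD -mulrDl. Qed.

Lemma le_scale_gdom b c z : 0 <= b -> b * gdom c z <= gdom (b + c) z.
Proof. by move=> b0; rewrite gdomM ler_wpM2r ?gdom_ge0// le_expR_norm1. Qed.

Lemma gdomD b c z : 0 <= b -> 0 <= c -> gdom b z + gdom c z <= gdom (b + c + 1) z.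
Proof.
move=> b0 c0; have e1 : gdom b z + gdom c z <= gdom (b + c) z + gdom (b + c) z.
  by apply: lerD; apply: le_gdom; rewrite ?lerDl ?lerDr.
apply: (le_trans e1); rewrite (addrC _ 1) [leRHS]gdomM mul1r.
rewrite -mulr2n -mulr_natl ler_wpM2r ?gdom_ge0//.
by rewrite (le_trans _ (expR_ge1Dx _))// lerD2l norm1_1_ge1.
Qed.

Lemma norm_coord_gdom c z i : `|z ord0 i| * gdom c z <= gdom (1 + c) z.
Proof.
rewrite gdomM ler_wpM2r ?gdom_ge0// mul1r (le_trans _ (expR_ge1Dx _))//.
by rewrite (le_trans (ler_norm1 z i))// addrA ler_wpDl.
Qed.

Lemma gauss1E z : gauss 1 z =
  (Num.sqrt (4 * pi * 1 ^+ 2))^-1 ^+ n * expR (- (sqnorm z / 4)).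
Proof. by rewrite /gauss !expr1n !mulr1. Qed.

(** The logarithm of [gauss 1 (z + v) / gauss 1 z]. *)
Definition shift_exponent z v : R :=
  - (2 * \sum_i z ord0 i * v ord0 i + sqnorm v) / 4.

Lemma gauss1_shift z v : gauss 1 (z + v) = gauss 1 z * expR (shift_exponent z v).
Proof.
rewrite !gauss1E -[RHS]mulrA -expRD; congr (_ * expR _).
have -> : sqnorm (z + v) = sqnorm z + (2 * \sum_i z ord0 i * v ord0 i + sqnorm v).
  rewrite /sqnorm mulr_sumr -!big_split/=; apply: eq_bigr => i _.
  by rewrite mxE; ring.
by rewrite /shift_exponent; field.
Qed.

Lemma norm_shift_exponent z v b : 0 <= b <= 1 -> (forall i, `|v ord0 i| <= b) ->
  `|shift_exponent z v| <= b * (n%:R + 1) * (1 + norm1 z).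
Proof.
move=> /andP[b0 b1] vb.
have e1 : `|\sum_i z ord0 i * v ord0 i| <= b * norm1 z.
  rewrite (le_trans (ler_norm_sum _ _ _))// /norm1 mulr_sumr ler_sum// => i _.
  by rewrite normrM mulrC ler_wpM2r.
have e2 : 0 <= sqnorm v <= b * n%:R.
  rewrite sqnorm_ge0/= /sqnorm -[n in n%:R]card_ord -sumr_const mulr_sumr.
  rewrite ler_sum// => i _; rewrite mulr1 -sqr_normr expr2.
  by rewrite (le_trans (ler_pM _ _ (vb i) (vb i)))// ler_piMr.
have N0 := norm1_ge0 z; have n0 : 0 <= n%:R :> R by [].
have : `|shift_exponent z v| <= (2 * (b * norm1 z) + b * n%:R) / 4.
  rewrite /shift_exponent normrM normrN [`|4^-1|]ger0_norm// ler_wpM2r//.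
  rewrite (le_trans (ler_normD _ _))// lerD//.
    by rewrite normrM ger0_norm// ler_wpM2l.
  by case/andP: e2 => ? ?; rewrite ger0_norm.
move=> e3; apply: (le_trans e3).
have p1 : 0 <= b * norm1 z by exact: mulr_ge0.
have p2 : 0 <= b * n%:R by exact: mulr_ge0.
have p3 : 0 <= b * n%:R * norm1 z by exact: mulr_ge0.
nra.
Qed.

Lemma norm_shift_exponent_le z v b : 0 <= b <= 1 -> (forall i, `|v ord0 i| <= b) ->
  expR `|shift_exponent z v| <= expR ((n%:R + 1) * (1 + norm1 z)).
Proof.
move=> b01 vb; rewrite ler_expR (le_trans (norm_shift_exponent z b01 vb))//.
rewrite -mulrA ler_piMl//; first by rewrite mulr_ge0 ?addr_ge0 ?norm1_ge0.
by case/andP: b01.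
Qed.

Lemma gdom_shift c z v b : 0 <= c -> 0 <= b <= 1 -> (forall i, `|v ord0 i| <= b) ->
  gdom c (z + v) <= gdom (c * (n%:R + 1) + (n%:R + 1)) z.
Proof.
move=> c0 b01 vb; rewrite /gdom gauss1_shift -mulrA ler_wpM2l ?gauss_ge0//.
rewrite mulrDl expRD mulrC ler_pM ?expR_ge0//; last first.
  by rewrite (le_trans _ (norm_shift_exponent_le z b01 vb))// ler_expR ler_norm.
rewrite ler_expR -mulrA ler_wpM2l//.
have e : norm1 (z + v) <= norm1 z + n%:R.
  rewrite /norm1 -[n in n%:R]card_ord -sumr_const -big_split ler_sum// => i _.
  rewrite mxE (le_trans (ler_normD _ _))// lerD2l (le_trans (vb i))//.
  by case/andP: b01.
have := norm1_ge0 z; have n0 : 0 <= n%:R :> R by [].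
nra.
Qed.

Lemma kernel_dom_gauss : kernel_dom (gauss 1).
Proof.
exists 0 => // z; rewrite /gdom mul0r expR0 mulr1 ger0_norm//; exact: gauss_ge0.
Qed.

Lemma kernel_lip_gauss : kernel_lip (gauss 1).
Proof.
exists (2 * (n%:R + 1)) => [|z v b b01 vb]; first by rewrite mulr_ge0.
have b0 : 0 <= b by case/andP: b01.
rewrite gauss1_shift -{2}[gauss 1 z]mulr1 -mulrBr normrM ger0_norm ?gauss_ge0//.
rewrite mulrCA ler_wpM2l ?gauss_ge0// (le_trans (norm_expRB1 _))//.
rewrite mulr_natl mulr2n mulrDl expRD mulrA ler_pM ?expR_ge0//; last first.
  exact: norm_shift_exponent_le vb.
rewrite (le_trans (norm_shift_exponent z b01 vb))// -mulrA ler_wpM2l//.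
by rewrite (le_trans _ (expR_ge1Dx _))// lerDr.
Qed.

Lemma basis_vec_coord i j : (basis_vec i : 'rV[R]_n) ord0 j = (j == i)%:R.
Proof. by rewrite /basis_vec mxE. Qed.

Lemma norm_basis_vec i t j : `|(t *: basis_vec i : 'rV[R]_n) ord0 j| <= `|t|.
Proof.
by rewrite mxE basis_vec_coord; case: (j == i); rewrite ?mulr1 ?mulr0 ?normr0.
Qed.

Lemma shift_exponent_basis z i t :
  shift_exponent z (t *: basis_vec i) = - (2 * t * z ord0 i + t ^+ 2) / 4.
Proof.
rewrite /shift_exponent /sqnorm (bigD1 i)//= [X in _ + X](bigD1 i)//=.
rewrite !big1 => [|j /negbTE ji|j /negbTE ji];
  rewrite !mxE ?eqxx ?ji/= ?mulr0 ?expr0n//.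
by rewrite !mulr1 !addr0 mulrA mulrAC.
Qed.

Lemma kernel_diff_gauss i :
  kernel_diff i (gauss 1) (fun z => - (2^-1 * (z ord0 i * gauss 1 z))).
Proof.
pose m : R := n%:R + 1.
have m1 : 1 <= m by rewrite lerDr.
(* The square of the exponent costs [2 * m], the factor [expR] of its absolute value costs [m], and
   the last 2 absorbs the factor 2 from adding two terms of the same size. *)
exists (3 * m + 1 + 1) => [|z t t1]; first by lra.
have b01 : 0 <= `|t| <= 1 by rewrite normr_ge0.
have vb := norm_basis_vec i t.
set v := t *: basis_vec i; set u := shift_exponent z v.
have E : gauss 1 (z + v) - gauss 1 z - t * - (2^-1 * (z ord0 i * gauss 1 z)) =
    gauss 1 z * ((expR u - 1 - u) - t ^+ 2 / 4).
  have -> : t ^+ 2 / 4 = - u - t * z ord0 i / 2 by rewrite /u shift_exponent_basis; field.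
  by rewrite gauss1_shift -/u; field.
rewrite E normrM ger0_norm ?gauss_ge0// mulrCA ler_wpM2l ?gauss_ge0//.
have N1 := norm1_1_ge1 z.
have eu : u ^+ 2 <= t ^+ 2 * expR (2 * m * (1 + norm1 z)).
  rewrite -sqr_normr -[t ^+ 2]sqr_normr mulr_natl mulr2n mulrDl expRD -expr2 -exprMn.
  rewrite ler_sqr ?nnegrE ?mulr_ge0 ?expR_ge0//.
  rewrite (le_trans (norm_shift_exponent z b01 vb))// -mulrA ler_wpM2l//.
  by rewrite (le_trans _ (expR_ge1Dx _))// lerDr.
have eu2 := norm_shift_exponent_le z b01 vb.
have e3 : `|expR u - 1 - u| <= t ^+ 2 * expR (3 * m * (1 + norm1 z)).
  apply: (le_trans (norm_expRB1B _)).
  rewrite (_ : 3 * m = 2 * m + m); last by ring.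
  by rewrite mulrDl expRD mulrA ler_pM ?expR_ge0 ?sqr_ge0.
have e4 : t ^+ 2 / 4 <= t ^+ 2 * expR (3 * m * (1 + norm1 z)).
  have e5 : 1 <= expR (3 * m * (1 + norm1 z)).
    by rewrite -[leLHS]expR0 ler_expR mulr_ge0//; lra.
  rewrite ler_wpM2l ?sqr_ge0//; apply: le_trans e5; lra.
rewrite (le_trans (ler_normB _ _))// [`|_ / 4|]ger0_norm ?divr_ge0 ?sqr_ge0//.
apply: (le_trans (lerD e3 e4)); rewrite -mulrDr ler_wpM2l ?sqr_ge0//.
set N := 1 + norm1 z in N1 *.
have -> : (3 * m + 1 + 1) * N = 3 * m * N + 2 * N by ring.
rewrite expRD -mulr2n -[leLHS]mulr_natr ler_wpM2l ?expR_ge0//.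
by rewrite (le_trans _ (expR_ge1Dx _))//; lra.
Qed.

Lemma kernel_dom_lin a b q q' : kernel_dom q -> kernel_dom q' ->
  kernel_dom (fun z => a * q z + b * q' z).
Proof.
move=> [c c0 hq] [c' c'0 hq'].
exists (`|a| + c + (`|b| + c') + 1) => [|z]; first by rewrite !addr_ge0.
apply: le_trans (gdomD _ _ _); rewrite ?addr_ge0//.
rewrite (le_trans (ler_normD _ _))// !normrM lerD//.
- by rewrite (le_trans _ (le_scale_gdom _ _ _))// ler_wpM2l.
- by rewrite (le_trans _ (le_scale_gdom _ _ _))// ler_wpM2l.
Qed.

Lemma kernel_lip_lin a b q q' : kernel_lip q -> kernel_lip q' ->
  kernel_lip (fun z => a * q z + b * q' z).
Proof.
move=> [c c0 hq] [c' c'0 hq'].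
exists (`|a| + c + (`|b| + c') + 1) => [|z v d d01 vd]; first by rewrite !addr_ge0.
have d0 : 0 <= d by case/andP: d01.
apply: (@le_trans _ _ (d * (gdom (`|a| + c) z + gdom (`|b| + c') z))); last first.
  by rewrite ler_wpM2l// gdomD ?addr_ge0.
rewrite (_ : _ - _ = a * (q (z + v) - q z) + b * (q' (z + v) - q' z)); last by ring.
rewrite (le_trans (ler_normD _ _))// !normrM mulrDr lerD//.
- rewrite (@le_trans _ _ (d * (`|a| * gdom c z)))//; last by rewrite ler_wpM2l// le_scale_gdom.
  by rewrite mulrCA ler_wpM2l// hq.
- rewrite (@le_trans _ _ (d * (`|b| * gdom c' z)))//; last by rewrite ler_wpM2l// le_scale_gdom.
  by rewrite mulrCA ler_wpM2l// hq'.
Qed.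

Lemma kernel_diff_lin i a b q q' r r' : kernel_diff i q r -> kernel_diff i q' r' ->
  kernel_diff i (fun z => a * q z + b * q' z) (fun z => a * r z + b * r' z).
Proof.
move=> [c c0 hq] [c' c'0 hq'].
exists (`|a| + c + (`|b| + c') + 1) => [|z t t1]; first by rewrite !addr_ge0.
set v := t *: _.
apply: (@le_trans _ _ (t ^+ 2 * (gdom (`|a| + c) z + gdom (`|b| + c') z))); last first.
  by rewrite ler_wpM2l ?sqr_ge0// gdomD ?addr_ge0.
rewrite (_ : _ - _ = a * (q (z + v) - q z - t * r z)
   + b * (q' (z + v) - q' z - t * r' z)); last by ring.
rewrite (le_trans (ler_normD _ _))// !normrM mulrDr lerD//.
- rewrite (@le_trans _ _ (t ^+ 2 * (`|a| * gdom c z)))//; last by rewrite ler_wpM2l ?sqr_ge0// le_scale_gdom.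
  by rewrite mulrCA ler_wpM2l// hq.
- rewrite (@le_trans _ _ (t ^+ 2 * (`|b| * gdom c' z)))//; last by rewrite ler_wpM2l ?sqr_ge0// le_scale_gdom.
  by rewrite mulrCA ler_wpM2l// hq'.
Qed.

Lemma kernel_dom_coord i q : kernel_dom q -> kernel_dom (fun z => z ord0 i * q z).
Proof.
move=> [c c0 hq]; exists (1 + c) => [|z]; first by rewrite addr_ge0.
by rewrite normrM (le_trans _ (norm_coord_gdom _ _ i))// ler_wpM2l.
Qed.

Lemma kernel_lip_coord i q : kernel_dom q -> kernel_lip q ->
  kernel_lip (fun z => z ord0 i * q z).
Proof.
move=> [c c0 hq] [c' c'0 hq'].
pose k := c * (n%:R + 1) + (n%:R + 1) .
have k0 : 0 <= k by rewrite addr_ge0 ?mulr_ge0.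
exists (k + (1 + c') + 1) => [|z v d d01 vd]; first by rewrite !addr_ge0// mulr_ge0.
have d0 : 0 <= d by case/andP: d01.
apply: (@le_trans _ _ (d * (gdom k z + gdom (1 + c') z))); last first.
  by rewrite ler_wpM2l// gdomD// addr_ge0.
rewrite (_ : _ - _ = v ord0 i * q (z + v) + z ord0 i * (q (z + v) - q z)); last first.
  by rewrite mxE; ring.
rewrite (le_trans (ler_normD _ _))// !normrM mulrDr lerD//.
- rewrite ler_pM// (le_trans (hq _))//; exact: (@gdom_shift c z v d).
- apply: (@le_trans _ _ (d * (`|z ord0 i| * gdom c' z))); last first.
    by rewrite ler_wpM2l// norm_coord_gdom.
  by rewrite mulrCA ler_wpM2l// hq'.
Qed.

Lemma kernel_diff_coord i j q q' : kernel_lip q -> kernel_diff j q q' ->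
  kernel_diff j (fun z => z ord0 i * q z) (fun z => (i == j)%:R * q z + z ord0 i * q' z).
Proof.
move=> [c c0 hq] [c' c'0 hq'].
exists (c + (1 + c') + 1) => [|z t t1]; first by rewrite !addr_ge0.
set v := t *: _.
have b01 : 0 <= `|t| <= 1 by rewrite normr_ge0.
have vb := norm_basis_vec j t.
apply: (@le_trans _ _ (t ^+ 2 * (gdom c z + gdom (1 + c') z))); last first.
  by rewrite ler_wpM2l ?sqr_ge0// gdomD ?addr_ge0.
have vi : v ord0 i = t * (i == j)%:R by rewrite /v mxE basis_vec_coord.
rewrite (_ : _ - _ = v ord0 i * (q (z + v) - q z) +
   z ord0 i * (q (z + v) - q z - t * q' z)); last first.
  by rewrite mxE vi; ring.
rewrite (le_trans (ler_normD _ _))// !normrM mulrDr lerD//.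
- by rewrite -sqr_normr expr2 -mulrA ler_pM// hq.
- apply: (@le_trans _ _ (t ^+ 2 * (`|z ord0 i| * gdom c' z))); last first.
    by rewrite ler_wpM2l ?sqr_ge0// norm_coord_gdom.
  by rewrite mulrCA ler_wpM2l// hq'.
Qed.

(** Doubling the scale leaves room in the quadratic exponent to absorb a linear one. Every kernel
    bound can thus be expressed by a single Gaussian, whose mass is known. *)
Lemma gdom_le_gauss2 c : exists2 C : R, 0 <= C & forall z, gdom c z <= C * gauss 2 z.
Proof.
exists (2 ^+ n * expR (c + 2 * c ^+ 2 * n%:R)) => [|z].
  by rewrite mulr_ge0 ?exprn_ge0 ?expR_ge0.
pose P : R := (Num.sqrt (4 * pi))^-1.
have P0 : 0 <= P by rewrite invr_ge0.
have e1 : gauss 1 z = P ^+ n * expR (- (sqnorm z / 4)).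
  by rewrite gauss1E expr1n mulr1.
have e2 : gauss 2 z = (2^-1 * P) ^+ n * expR (- (sqnorm z / (4 * 2 ^+ 2))).
  by rewrite /gauss sqrt_peak// invfM.
rewrite /gdom e1 e2 -mulrA -expRD mulrACA -exprMn -expRD mulVKf//.
rewrite ler_wpM2l ?exprn_ge0// ler_expR.
have -> : 2 * c ^+ 2 * n%:R = \sum_(i < n) 2 * c ^+ 2.
  by rewrite sumr_const card_ord mulr_natr.
have -> : sqnorm z / 4 = \sum_i (z ord0 i ^+ 2 / 4) by rewrite mulr_suml.
have -> : sqnorm z / (4 * 2 ^+ 2) = \sum_i (z ord0 i ^+ 2 / (4 * 2 ^+ 2)).
  by rewrite mulr_suml.
rewrite mulrDr mulr1 addrCA -addrA lerD2l -!sumrN mulr_sumr -!big_split/=.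
apply: ler_sum => i _; rewrite -[z ord0 i ^+ 2]sqr_normr.
(* Divided by 48, this square is [3 / 16 * a ^+ 2 - c * a + 4 / 3 * c ^+ 2]; hence [2 * c ^+ 2] per
   coordinate is enough. *)
move: `|_| => a; have := sqr_ge0 (3 * a - 8 * c); nra.
Qed.

End kernel_classes.

(** * Integrals and convolutions *)

Section real_integral.
Context d (T : measurableType d) (R : realType).
Variable m : {measure set T -> \bar R}.
Implicit Types f g : T -> R.

Definition integ f := m.-integrable setT (EFin \o f).

Lemma integ_measurable f : integ f -> measurable_fun setT f.
Proof. by move=> /measurable_int/measurable_EFinP. Qed.

Lemma integ_le f g : measurable_fun setT f -> (forall x, `|f x| <= g x) ->
  integ g -> integ f.
Proof.
move=> mf fg ig; apply: (le_integrable measurableT _ _ ig).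
  exact/measurable_EFinP.
by move=> x _ /=; rewrite lee_fin (le_trans (fg x))// ler_norm.
Qed.

Lemma integD f g : integ f -> integ g -> integ (fun x => f x + g x).
Proof. by move=> fi gi; exact: (integrableD measurableT fi gi). Qed.

Lemma integZ c f : integ f -> integ (fun x => c * f x).
Proof. by move=> fi; exact: (integrableZl measurableT c fi). Qed.

Lemma integB f g : integ f -> integ g -> integ (fun x => f x - g x).
Proof. by move=> fi gi; exact: (integrableB measurableT fi gi). Qed.

Lemma integ_norm f : integ f -> integ (fun x => `|f x|).
Proof. by move=> fi; exact: (integrable_abse fi). Qed.

Lemma Rint_norm_le f g : measurable_fun setT f -> (forall x, `|f x| <= g x) ->
  integ g -> `|\int[m]_x f x| <= \int[m]_x g x.
Proof.
move=> mf fg ig; have fi := integ_le mf fg ig.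
rewrite (le_trans (le_normr_Rintegral measurableT fi))//.
by apply: le_Rintegral => //; exact: integ_norm.
Qed.

Lemma integral_Rint f : integ f -> (\int[m]_x (f x)%:E)%E = (\int[m]_x f x)%:E.
Proof. by move=> fi; rewrite fineK//; exact: integrable_fin_num. Qed.

Lemma Rint_eq f g : f =1 g -> \int[m]_x f x = \int[m]_x g x.
Proof. by move=> fg; apply: eq_Rintegral => x _. Qed.

Lemma integ_Rint_sum (I : finType) (F : I -> T -> R) : (forall i, integ (F i)) ->
  integ (fun x => \sum_i F i x) /\
  \int[m]_x (\sum_i F i x) = \sum_i \int[m]_x F i x.
Proof.
move=> iF; suff H (s : seq I) : integ (fun x => \sum_(i <- s) F i x) /\
  \int[m]_x (\sum_(i <- s) F i x) = \sum_(i <- s) \int[m]_x F i x by exact: H.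
elim: s => [|i s [IH1 IH2]].
  rewrite (_ : (fun x => _) = cst 0); last by apply/funext => x; rewrite big_nil.
  by rewrite big_nil; split; [exact: integrable0|rewrite Rintegral_cst// mul0r].
have E : (fun x => \sum_(j <- i :: s) F j x) = (fun x => F i x + \sum_(j <- s) F j x).
  by apply/funext => x; rewrite big_cons.
split; first by rewrite E; exact: integD.
rewrite big_cons -IH2 -(RintegralD measurableT (iF i) IH1).
by apply: Rint_eq => x; rewrite big_cons.
Qed.

Lemma integ_sum (I : finType) (F : I -> T -> R) : (forall i, integ (F i)) ->
  integ (fun x => \sum_i F i x).
Proof. by case/integ_Rint_sum. Qed.

Lemma Rint_sum (I : finType) (F : I -> T -> R) : (forall i, integ (F i)) ->
  \int[m]_x (\sum_i F i x) = \sum_i \int[m]_x F i x.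
Proof. by case/integ_Rint_sum. Qed.

End real_integral.

Section gauss_integral.
Context {R : realType}.
Notation mu := (@borel_lebesgue_rV R).

Lemma measurable_sqnorm n : measurable_fun setT (@sqnorm R n).
Proof.
apply: measurable_sum => i; apply: measurable_funX; exact: measurable_coord_rV.
Qed.

Lemma measurable_gauss n (s : R) : measurable_fun setT (@gauss R n s).
Proof.
apply: measurable_funM => //; apply: measurableT_comp => //.
apply: measurableT_comp => //; apply: measurable_funM => //.
exact: measurable_sqnorm.
Qed.

Lemma integral_gauss n (s : R) : 0 < s -> (\int[mu n]_z (gauss s z)%:E = 1)%E.
Proof.
move=> s0; elim: n => [|n IH].
  have mg : measurable_fun setT (fun z : 'rV[R]_0 => (gauss s z)%:E).
    by apply/measurable_EFinP; exact: measurable_gauss.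
  rewrite (integral_dirac _ measurableT mg).
  rewrite diracE mem_set// mul1e /gauss expr0 mul1r.
  by rewrite /sqnorm big_ord0 mul0r oppr0 expR0.
have mg := @measurable_gauss n.+1 s.
rewrite ge0_integral_rV_succ//; last 2 first.
- exact/measurable_EFinP.
- by move=> x; rewrite lee_fin gauss_ge0.
pose g a := normal_pdf 0 (s * Num.sqrt 2) a.
have s2 : (s * Num.sqrt 2) ^+ 2 = 2 * s ^+ 2 :> R by rewrite exprMn sqr_sqrtr// mulrC.
have sn0 : s * Num.sqrt 2 != 0 :> R by rewrite gt_eqF// mulr_gt0// sqrtr_gt0.
have gE (a : R) (w : 'rV[R]_n) : gauss s (rV_cons (a, w)) = g a * gauss s w.
  rewrite /gauss /g /normal_pdf (negbTE sn0) /normal_peak /normal_fun subr0 s2.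
  have -> : sqnorm (rV_cons (a, w)) = a ^+ 2 + sqnorm w.
    rewrite /sqnorm (@big_split_ord _ _ _ 1 n) big_ord1; congr (_ ^+ 2 + _).
      exact: rV_cons0.
    by apply: eq_bigr => i _; congr (_ ^+ 2); exact: rV_consS.
  rewrite exprS [RHS]mulrACA; congr (_ * _ * _).
    by congr (_^-1); congr Num.sqrt; rewrite -[RHS]mulr_natr; ring.
  rewrite -expRD; congr expR; rewrite -[_ *+ 2]mulr_natr.
  by field; rewrite gt_eqF.
under eq_integral => a _.
  under eq_integral => w _ do rewrite gE EFinM.
  rewrite ge0_integralZl//; last 3 first.
  - by apply/measurable_EFinP; exact: measurable_gauss.
  - by move=> w _; rewrite lee_fin gauss_ge0.
  - by rewrite lee_fin normal_pdf_ge0.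
  rewrite IH mule1.
  over.
exact: integral_normal_pdf.
Qed.

Lemma integ_gauss n (s : R) : 0 < s -> integ (mu n) (gauss s).
Proof.
move=> s0; apply/integrableP; split; first by apply/measurable_EFinP; exact: measurable_gauss.
under eq_integral => z _ do rewrite /= ger0_norm ?gauss_ge0//.
by rewrite integral_gauss// ltry.
Qed.

Lemma Rint_gauss n (s : R) : 0 < s -> \int[mu n]_z gauss s z = 1.
Proof. by move=> s0; rewrite /Rintegral integral_gauss. Qed.

End gauss_integral.

Section rV_integral.
Context {R : realType} {n : nat}.
Notation mu := (@borel_lebesgue_rV R n).
Implicit Types (f g p q k : 'rV[R]_n -> R) (x y z v : 'rV[R]_n).

Lemma integ_affine c v f : c != 0 -> integ mu f -> integ mu (fun x => f (c *: x + v)).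
Proof.
move=> c0 fi; have mf := integ_measurable fi.
have mf' : measurable_fun setT (fun x => f (c *: x + v)).
  exact: (measurableT_comp mf (measurable_affine_rV c v)).
apply/integrableP; split; first exact/measurable_EFinP.
have /integrableP[_ foo] := fi.
rewrite (ge0_integral_affine (- (c^-1 *: v)) (invr_neq0 c0))//; last first.
  by apply/measurable_EFinP; apply: measurableT_comp.
rewrite lte_mul_pinfty// ?lee_fin ?exprn_ge0//.
under eq_integral => x _.
  rewrite /= scalerDr scalerN !scalerA divff// !scale1r -addrA addNr addr0.
  over.
exact: foo.
Qed.

Lemma Rint_affine c v f : c != 0 -> integ mu f ->
  \int[mu]_x f x = `|c| ^+ n * \int[mu]_x f (c *: x + v).
Proof.
move=> c0 fi; have mf := integ_measurable fi.
have fi' := integ_affine v c0 fi.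
have mP : measurable_fun setT (fun x => Num.max (f x) 0) by apply: measurable_maxr.
have mN : measurable_fun setT (fun x => Num.max (- f x) 0).
  by apply: measurable_maxr => //; exact: measurableT_comp.
have iP : integ mu (fun x => Num.max (f x) 0).
  apply: (integ_le _ _ (integ_norm fi)) => // x.
  by rewrite ger0_norm ?le_max ?lexx ?orbT// ge_max ler_norm normr_ge0.
have iN : integ mu (fun x => Num.max (- f x) 0).
  apply: (integ_le _ _ (integ_norm fi)) => // x.
  by rewrite ger0_norm ?le_max ?lexx ?orbT// ge_max -normrN ler_norm normr_ge0.
have E x : f x = Num.max (f x) 0 - Num.max (- f x) 0.
  case: (leP 0 (f x)) => h.
  - by rewrite max_r ?subr0// oppr_le0.
  - by rewrite max_l ?oppr_ge0 ?ltW// sub0r opprK.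
have Rpos g : (forall x, 0 <= g x) -> integ mu g ->
    \int[mu]_x g x = `|c| ^+ n * \int[mu]_x g (c *: x + v).
  move=> g0 gi; apply: EFin_inj; rewrite EFinM -!integral_Rint//; last first.
    exact: integ_affine.
  rewrite (ge0_integral_affine v c0)//.
  by apply/measurable_EFinP; exact: integ_measurable gi.
rewrite (Rint_eq mu E) RintegralB// Rpos//; last by move=> x; rewrite le_max lexx orbT.
rewrite [X in _ - X]Rpos//; last by move=> x; rewrite le_max lexx orbT.
rewrite -mulrBr -RintegralB//; last 2 first.
- exact: (integ_affine v c0 iP).
- exact: (integ_affine v c0 iN).
by congr (_ * _); apply: Rint_eq => x; rewrite -E.
Qed.

Lemma integ_shift v f : integ mu f -> integ mu (fun x => f (x + v)).
Proof.
move=> /(integ_affine v (oner_neq0 R)).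
by under eq_fun do rewrite scale1r.
Qed.

Lemma Rint_shift v f : integ mu f -> \int[mu]_x f (x + v) = \int[mu]_x f x.
Proof.
move=> /(Rint_affine v (oner_neq0 R)) ->.
by rewrite normr1 expr1n mul1r; apply: Rint_eq => x; rewrite scale1r.
Qed.

Let N1_neq0 : -1 != 0 :> R. Proof. by rewrite oppr_eq0 oner_neq0. Qed.

Lemma integ_reflect v f : integ mu f -> integ mu (fun x => f (v - x)).
Proof.
move=> /(integ_affine v N1_neq0).
by under eq_fun do rewrite scaleN1r addrC.
Qed.

Lemma Rint_reflect v f : integ mu f -> \int[mu]_x f (v - x) = \int[mu]_x f x.
Proof.
move=> /(Rint_affine v N1_neq0) ->.
by rewrite normrN1 expr1n mul1r; apply: Rint_eq => x; rewrite scaleN1r addrC.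
Qed.

End rV_integral.

Section bounded_integrable.
Context {R : realType} {n : nat}.
Notation mu := (@borel_lebesgue_rV R n).
Implicit Types (f g p q k : 'rV[R]_n -> R) (x y z v : 'rV[R]_n).

Definition bmf f := measurable_fun setT f /\ exists M : R, forall x, `|f x| <= M.

(** Boundedness is kept along with integrability so that the class is stable under products and
    convolutions; integrability of a product then follows from its factors. *)
Definition L1b f := integ mu f /\ exists M : R, forall x, `|f x| <= M.

Lemma L1b_bmf f : L1b f -> bmf f.
Proof. by move=> [/integ_measurable]. Qed.

Lemma bmf_ub f : bmf f -> exists2 M : R, 0 < M & forall x, `|f x| <= M.
Proof.
move=> [_ [M fM]]; exists (`|M| + 1) => [|x]; first by rewrite ltr_wpDl.
by rewrite (le_trans (fM x))// (le_trans (ler_norm _))// lerDl.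
Qed.

Lemma bmf_cst c : bmf (cst c).
Proof. by split; [exact: measurable_cst|exists `|c|]. Qed.

Lemma bmfD f g : bmf f -> bmf g -> bmf (fun x => f x + g x).
Proof.
move=> [mf [M fM]] [mg [N gN]]; split; first exact: measurable_funD.
by exists (M + N) => x; rewrite (le_trans (ler_normD _ _))// lerD.
Qed.

Lemma bmfM f g : bmf f -> bmf g -> bmf (fun x => f x * g x).
Proof.
move=> [mf [M fM]] [mg [N gN]]; split; first exact: measurable_funM.
by exists (M * N) => x; rewrite normrM ler_pM.
Qed.

Lemma bmfZ c f : bmf f -> bmf (fun x => c * f x).
Proof. exact: bmfM (bmf_cst c). Qed.

Lemma bmfB f g : bmf f -> bmf g -> bmf (fun x => f x - g x).
Proof.
move=> bf /(bmfZ (-1)) bg; have := bmfD bf bg.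
by under eq_fun do rewrite mulN1r.
Qed.

Lemma bmf_norm f : bmf f -> bmf (fun x => `|f x|).
Proof.
move=> [mf [M fM]]; split; first exact: measurableT_comp.
by exists M => x; rewrite normr_id.
Qed.

Lemma bmf_affine c v f : bmf f -> bmf (fun x => f (c *: x + v)).
Proof.
move=> [mf [M fM]]; split; last by exists M.
exact: (measurableT_comp mf (measurable_affine_rV c v)).
Qed.

Lemma bmf_shift v f : bmf f -> bmf (fun x => f (x + v)).
Proof. by move/(bmf_affine 1 v); under eq_fun do rewrite scale1r. Qed.

Lemma bmf_reflect v f : bmf f -> bmf (fun x => f (v - x)).
Proof. by move/(bmf_affine (-1) v); under eq_fun do rewrite scaleN1r addrC. Qed.

Lemma L1b_integ f : L1b f -> integ mu f. Proof. by case. Qed.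

Lemma L1b_le f g : measurable_fun setT f -> (forall x, `|f x| <= g x) -> L1b g -> L1b f.
Proof.
move=> mf fg [ig [M gM]]; split; first exact: integ_le ig.
exists M => x; rewrite (le_trans (fg x))// (le_trans (ler_norm _))//.
Qed.

Lemma L1bD f g : L1b f -> L1b g -> L1b (fun x => f x + g x).
Proof.
by move=> f1 g1; split; [apply: integD; exact: L1b_integ|exact: (bmfD (L1b_bmf f1) (L1b_bmf g1)).2].
Qed.

Lemma L1bZ c f : L1b f -> L1b (fun x => c * f x).
Proof.
by move=> f1; split; [apply: integZ; exact: L1b_integ|exact: (bmfZ c (L1b_bmf f1)).2].
Qed.

Lemma L1bB f g : L1b f -> L1b g -> L1b (fun x => f x - g x).
Proof.
by move=> f1 g1; split; [apply: integB; exact: L1b_integ|exact: (bmfB (L1b_bmf f1) (L1b_bmf g1)).2].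
Qed.

Lemma L1b_norm f : L1b f -> L1b (fun x => `|f x|).
Proof.
by move=> f1; split; [apply: integ_norm; exact: L1b_integ|exact: (bmf_norm (L1b_bmf f1)).2].
Qed.

Lemma L1bMr f g : L1b f -> bmf g -> L1b (fun x => f x * g x).
Proof.
move=> f1 bg; have [M M0 gM] := bmf_ub bg.
apply: (@L1b_le _ (fun x => M * `|f x|)); last exact/L1bZ/L1b_norm.
  by apply: measurable_funM; [exact: (L1b_bmf f1).1|exact: bg.1].
by move=> x; rewrite normrM mulrC ler_wpM2r.
Qed.

Lemma L1bMl f g : bmf f -> L1b g -> L1b (fun x => f x * g x).
Proof. by move=> bf g1; have := L1bMr g1 bf; under eq_fun do rewrite mulrC. Qed.

Lemma L1b_shift v f : L1b f -> L1b (fun x => f (x + v)).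
Proof.
move=> f1; split; last exact: (bmf_shift v (L1b_bmf f1)).2.
exact/integ_shift/L1b_integ.
Qed.

Lemma L1b_reflect v f : L1b f -> L1b (fun x => f (v - x)).
Proof.
move=> f1; split; last exact: (bmf_reflect v (L1b_bmf f1)).2.
exact/integ_reflect/L1b_integ.
Qed.

Lemma L1b_gauss s : 0 < s -> L1b (gauss s).
Proof.
move=> s0; split; first exact: integ_gauss.
by eexists => x; rewrite ger0_norm ?gauss_ge0//; exact: gauss_le_peak.
Qed.

End bounded_integrable.

(** * Double integrals and Fubini's theorem *)

Section double_integral.
Context {R : realType} {n : nat}.
Notation V := 'rV[R]_n.
Notation mu := (@borel_lebesgue_rV R n).
Notation mu2 := (mu \x mu)%E.
Implicit Types (f g p q k : V -> R) (x y z v : V) (P Q : V -> V -> R).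

Definition unc P (z : V * V) : R := P z.1 z.2.

Definition mfun2 P := measurable_fun setT (unc P).

(* Not square integrability: these kernels are integrable over pairs and on every
   section, so that Fubini's theorem holds with real-valued integrals. *)
Definition L2 P := [/\ mfun2 P, integ mu2 (unc P),
  forall x, integ mu (P x) & forall y, integ mu (P^~ y)].

Definition dint P : R := \int[mu2]_z unc P z.

Lemma mfun2_fst f : measurable_fun setT f -> mfun2 (fun x _ => f x).
Proof. by move=> mf; exact: (measurableT_comp mf measurable_fst). Qed.

Lemma mfun2_snd f : measurable_fun setT f -> mfun2 (fun _ y => f y).
Proof. by move=> mf; exact: (measurableT_comp mf measurable_snd). Qed.

Lemma mfun2_sub f : measurable_fun setT f -> mfun2 (fun x y => f (x - y)).
Proof.
move=> mf.
have mB : measurable_fun setT (fun z : V * V => z.1 - z.2 : V).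
  apply: measurable_fun_rV => i.
  rewrite (_ : (fun _ => _) = fun z : V * V => z.1 ord0 i - z.2 ord0 i).
    apply: measurable_funB.
      exact: (measurableT_comp (measurable_coord_rV i) measurable_fst).
    exact: (measurableT_comp (measurable_coord_rV i) measurable_snd).
  by apply/funext => z; rewrite !mxE.
exact: (measurableT_comp mf mB).
Qed.

Lemma mfun2D P Q : mfun2 P -> mfun2 Q -> mfun2 (fun x y => P x y + Q x y).
Proof. by move=> mP mQ; exact: measurable_funD. Qed.

Lemma mfun2M P Q : mfun2 P -> mfun2 Q -> mfun2 (fun x y => P x y * Q x y).
Proof. by move=> mP mQ; exact: measurable_funM. Qed.

Lemma integ2_fst p k : integ mu p -> integ mu k ->
  integ mu2 (unc (fun x y => p x * k (x - y))).
Proof.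
move=> ip ik.
have m2 : mfun2 (fun x y => p x * k (x - y)).
  exact: (mfun2M (mfun2_fst (integ_measurable ip)) (mfun2_sub (integ_measurable ik))).
apply/integrable12ltyP; first exact/measurable_EFinP.
under eq_integral => x _.
  under eq_integral => y _ do rewrite /unc /= normrM EFinM.
  rewrite ge0_integralZl//; last first.
    apply/measurable_EFinP; apply: measurableT_comp => //.
    exact: integ_measurable (integ_reflect x ik).
  rewrite (integral_Rint (integ_norm (integ_reflect x ik))).
  rewrite (Rint_reflect x (integ_norm ik)) -EFinM.
  over.
rewrite (integral_Rint (f := fun x => `|p x| * \int[mu]_y `|k y|)) ?ltry//.
by under [X in integ _ X]eq_fun do rewrite mulrC; apply: integZ; exact: integ_norm.
Qed.

Lemma integ2_snd p k : integ mu p -> integ mu k ->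
  integ mu2 (unc (fun x y => p y * k (x - y))).
Proof.
move=> ip ik.
have m2 : mfun2 (fun x y => p y * k (x - y)).
  exact: (mfun2M (mfun2_snd (integ_measurable ip)) (mfun2_sub (integ_measurable ik))).
apply/integrable21ltyP; first exact/measurable_EFinP.
under eq_integral => y _.
  under eq_integral => x _ do rewrite /unc /= normrM EFinM.
  rewrite ge0_integralZl//; last first.
    apply/measurable_EFinP; apply: measurableT_comp => //.
    exact: integ_measurable (integ_shift (- y) ik).
  rewrite (integral_Rint (integ_norm (integ_shift (- y) ik))).
  rewrite (Rint_shift (- y) (integ_norm ik)) -EFinM.
  over.
rewrite (integral_Rint (f := fun x => `|p x| * \int[mu]_y `|k y|)) ?ltry//.
by under [X in integ _ X]eq_fun do rewrite mulrC; apply: integZ; exact: integ_norm.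
Qed.

Lemma L2_integ P : L2 P -> integ mu2 (unc P).
Proof. by case. Qed.

Lemma L2_integ1 P x : L2 P -> integ mu (P x).
Proof. by case. Qed.

Lemma L2_integ2 P y : L2 P -> integ mu (P^~ y).
Proof. by case. Qed.

Lemma L2_mfun P : L2 P -> mfun2 P.
Proof. by case. Qed.

Lemma L2_le P Q : mfun2 P -> L2 Q -> (forall x y, `|P x y| <= Q x y) -> L2 P.
Proof.
move=> mP [mQ iQ iQ1 iQ2] PQ; split => //.
- by apply: (integ_le mP _ iQ) => z; exact: PQ.
- move=> x; apply: (integ_le _ _ (iQ1 x)); last exact: PQ.
  exact: (measurable_fun_pair2 x mP).
- move=> y; apply: (integ_le _ _ (iQ2 y)); last by move=> x; exact: PQ.
  exact: (measurable_fun_pair1 y mP).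
Qed.

Lemma L2_fst p k : L1b p -> L1b k -> L2 (fun x y => p x * k (x - y)).
Proof.
move=> p1 k1; have H := integ2_fst p1.1 k1.1; split => //.
- exact: integ_measurable H.
- by move=> x; apply: integZ; exact: integ_reflect k1.1.
- move=> y; apply: L1b_integ; apply: L1bMr => //; exact/L1b_bmf/L1b_shift.
Qed.

Lemma L2_snd p k : L1b p -> L1b k -> L2 (fun x y => p y * k (x - y)).
Proof.
move=> p1 k1; have H := integ2_snd p1.1 k1.1; split => //.
- exact: integ_measurable H.
- by move=> x; apply: L1b_integ; apply: L1bMr => //; exact/L1b_bmf/L1b_reflect.
- by move=> y; apply: integZ; exact: integ_shift k1.1.
Qed.

Lemma L2_prod p k : L1b p -> L1b k -> L2 (fun x y => p x * k y).
Proof.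
move=> p1 k1.
have m2 : mfun2 (fun x y => p x * k y).
  exact: (mfun2M (mfun2_fst (L1b_bmf p1).1) (mfun2_snd (L1b_bmf k1).1)).
split => //.
- apply/integrable12ltyP; first exact/measurable_EFinP.
  under eq_integral => x _.
    under eq_integral => y _ do rewrite /unc /= normrM EFinM.
    rewrite ge0_integralZl//; last first.
      by apply/measurable_EFinP; apply: measurableT_comp => //; exact: (L1b_bmf k1).1.
    rewrite (integral_Rint (integ_norm k1.1)) -EFinM.
    over.
  rewrite (integral_Rint (f := fun x => `|p x| * \int[mu]_y `|k y|)) ?ltry//.
  by under [X in integ _ X]eq_fun do rewrite mulrC; apply: integZ; exact: integ_norm p1.1.
- by move=> x; apply: integZ; exact: L1b_integ.
- move=> y; apply: L1b_integ; apply: L1bMr => //; exact: bmf_cst.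
Qed.

Lemma L2_swap P : L2 P -> L2 (fun x y => P y x).
Proof.
move=> [mP iP iP1 iP2].
have mP' : mfun2 (fun x y => P y x).
  exact: (measurableT_comp mP (measurable_fun_pair measurable_snd measurable_fst)).
split => //; apply/integrable21ltyP; first exact/measurable_EFinP.
by have /integrable12ltyP := iP; apply; exact/measurable_EFinP.
Qed.

Lemma L2_integ12 P : L2 P -> integ mu (fun x => \int[mu]_y P x y).
Proof.
move=> P2; have := integrable_fubini_F (L2_integ P2).
rewrite /fubini_F /unc/=.
by under eq_fun => x do rewrite (integral_Rint (L2_integ1 x P2)).
Qed.

Lemma dint12 P : L2 P -> dint P = \int[mu]_x \int[mu]_y P x y.
Proof.
move=> P2; rewrite /dint /Rintegral -(integral12_prod_meas1 (L2_integ P2)).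
congr fine; apply: eq_integral => x _; rewrite /fubini_F /unc/=.
by rewrite (integral_Rint (L2_integ1 x P2)).
Qed.

Lemma dint21 P : L2 P -> dint P = \int[mu]_y \int[mu]_x P x y.
Proof.
move=> P2; rewrite /dint /Rintegral -(integral21_prod_meas1 (L2_integ P2)).
congr fine; apply: eq_integral => y _; rewrite /fubini_G /unc/=.
by rewrite (integral_Rint (L2_integ2 y P2)).
Qed.

Lemma L2_integ21 P : L2 P -> integ mu (fun y => \int[mu]_x P x y).
Proof. by move=> /L2_swap; exact: L2_integ12. Qed.

Lemma dintD P Q : L2 P -> L2 Q -> dint (fun x y => P x y + Q x y) = dint P + dint Q.
Proof. by move=> P2 Q2; rewrite -RintegralD//; exact: L2_integ. Qed.

Lemma dintB P Q : L2 P -> L2 Q -> dint (fun x y => P x y - Q x y) = dint P - dint Q.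
Proof. by move=> P2 Q2; rewrite -RintegralB//; exact: L2_integ. Qed.

Lemma dintZ c P : L2 P -> dint (fun x y => c * P x y) = c * dint P.
Proof. by move=> P2; rewrite -RintegralZl//; exact: L2_integ. Qed.

Lemma dint_norm_le P Q : mfun2 P -> L2 Q -> (forall x y, `|P x y| <= Q x y) ->
  `|dint P| <= dint Q.
Proof.
move=> mP Q2 PQ; apply: Rint_norm_le => //; last exact: L2_integ.
by move=> z; exact: PQ.
Qed.

Lemma eq_dint P Q : (forall x y, P x y = Q x y) -> dint P = dint Q.
Proof. by move=> PQ; apply: Rint_eq => z; exact: PQ. Qed.

Lemma dint_swap P : L2 P -> dint (fun x y => P y x) = dint P.
Proof. by move=> P2; rewrite (dint12 P2) dint21//; exact: L2_swap. Qed.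

Lemma L2Z c P : L2 P -> L2 (fun x y => c * P x y).
Proof.
move=> [mP iP iP1 iP2]; split.
- exact: (mfun2M (mfun2_fst (measurable_cst c)) mP).
- exact: integZ.
- by move=> x; exact: integZ.
- by move=> y; exact: integZ.
Qed.

Lemma L2D P Q : L2 P -> L2 Q -> L2 (fun x y => P x y + Q x y).
Proof.
move=> [mP iP iP1 iP2] [mQ iQ iQ1 iQ2]; split.
- exact: mfun2D.
- exact: (integD iP iQ).
- by move=> x; exact: integD.
- by move=> y; exact: (integD (iP2 y) (iQ2 y)).
Qed.

Lemma L2B P Q : L2 P -> L2 Q -> L2 (fun x y => P x y - Q x y).
Proof.
move=> P2 /(L2Z (-1)) Q2; have := L2D P2 Q2.
suff -> : (fun x y => P x y + -1 * Q x y) = (fun x y => P x y - Q x y) by [].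
by apply/funext => x; apply/funext => y; rewrite mulN1r.
Qed.

Lemma L2_kernel p k g : L1b p -> L1b k -> bmf g ->
  L2 (fun x y => p x * k (x - y) * g y).
Proof.
move=> p1 k1 bg; have [M M0 gM] := bmf_ub bg.
apply: (L2_le _ (L2_fst (L1b_norm p1) (L1bZ M (L1b_norm k1)))).
  exact: (mfun2M (mfun2M (mfun2_fst (L1b_bmf p1).1) (mfun2_sub (L1b_bmf k1).1)) (mfun2_snd bg.1)).
by move=> x y; rewrite !normrM -mulrA ler_wpM2l// mulrC ler_wpM2r.
Qed.

Lemma L2_kernel' p k g : bmf p -> L1b k -> L1b g ->
  L2 (fun x y => p x * k (x - y) * g y).
Proof.
move=> bp k1 g1; have [M M0 pM] := bmf_ub bp.
apply: (L2_le _ (L2_snd (L1b_norm g1) (L1bZ M (L1b_norm k1)))).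
  exact: (mfun2M (mfun2M (mfun2_fst bp.1) (mfun2_sub (L1b_bmf k1).1)) (mfun2_snd (L1b_bmf g1).1)).
by move=> x y; rewrite !normrM mulrC ler_wpM2l// ler_wpM2r.
Qed.

End double_integral.

(** * Convolutions *)

Section convolution.
Context {R : realType} {n : nat}.
Notation V := 'rV[R]_n.
Notation mu := (@borel_lebesgue_rV R n).
Implicit Types (f g p q k : V -> R) (x y z v : V).

(** The counterpart of [convolution] for the Borel measure instead of its completion. *)
Definition kconv q f x : R := \int[mu]_y (q (x - y) * f y).

Lemma L1b_conv_integrand q f x : L1b q -> bmf f -> L1b (fun y => q (x - y) * f y).
Proof. by move=> q1 bf; apply: L1bMr => //; exact: L1b_reflect. Qed.

Lemma conv_bound q k f x : measurable_fun setT q -> (forall z, `|q z| <= k z) ->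
  integ mu k -> measurable_fun setT f -> (forall y, `|f y| <= 1) ->
  `|kconv q f x| <= \int[mu]_z k z.
Proof.
move=> mq qk ik mf f1; rewrite -(Rint_reflect x ik); apply: Rint_norm_le.
- apply: measurable_funM => //.
  exact: integ_measurable (integ_reflect x (integ_le mq qk ik)).
- by move=> y; rewrite normrM -[leRHS]mulr1 ler_pM.
- exact: integ_reflect.
Qed.

Lemma L1b_conv q f : L1b q -> L1b f -> L1b (kconv q f).
Proof.
move=> q1 f1.
have H := L2_kernel' (bmf_cst 1) q1 f1.
split.
  have := L2_integ12 H; congr (integ _ _); apply/funext => x.
  by apply: Rint_eq => y; rewrite /= mul1r.
have [M M0 fM] := bmf_ub (L1b_bmf f1).
exists (M * \int[mu]_z `|q z|) => x.
have iq := integ_norm (L1b_integ q1).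
rewrite -(Rint_reflect x iq) -RintegralZl//; last exact: (integ_reflect x iq).
apply: Rint_norm_le.
- exact: (L1b_bmf (L1b_conv_integrand x q1 (L1b_bmf f1))).1.
- by move=> y; rewrite normrM mulrC ler_wpM2r.
- by apply: integZ; exact: (integ_reflect x iq).
Qed.

Lemma dint_conv p q f : bmf p -> L1b q -> L1b f ->
  dint (fun x y => p x * q (x - y) * f y) = \int[mu]_x (p x * kconv q f x).
Proof.
move=> bp q1 f1; rewrite dint12; last exact: L2_kernel'.
apply: Rint_eq => x; rewrite /kconv -RintegralZl//.
  by apply: Rint_eq => y; rewrite mulrA.
exact: L1b_integ (L1b_conv_integrand x q1 (L1b_bmf f1)).
Qed.

Lemma dint_conv21 p q f : L1b p -> L1b q -> bmf f ->
  dint (fun x y => p x * q (x - y) * f y) =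
  \int[mu]_y (f y * \int[mu]_x (p x * q (x - y))).
Proof.
move=> p1 q1 bf; rewrite dint21; last exact: L2_kernel.
apply: Rint_eq => y; rewrite -RintegralZl//.
  by apply: Rint_eq => x; rewrite mulrC.
by apply: L1b_integ; apply: L1bMr => //; exact/L1b_bmf/L1b_shift.
Qed.

Lemma convB q f g x : L1b q -> bmf f -> bmf g ->
  kconv q (fun y => f y - g y) x = kconv q f x - kconv q g x.
Proof.
move=> q1 bf bg; rewrite -RintegralB//; last 2 first.
- exact: L1b_integ (L1b_conv_integrand x q1 bf).
- exact: L1b_integ (L1b_conv_integrand x q1 bg).
by apply: Rint_eq => y; rewrite mulrBr.
Qed.

End convolution.

(** * The Euler-Lagrange identity *)

Section weak_derivative.
Context {R : realType} {n : nat}.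
Notation V := 'rV[R]_n.
Notation mu := (@borel_lebesgue_rV R n).
Implicit Types (f g p q k : V -> R) (x y z v : V) (i : 'I_n) (t M e : R).

(** A partial derivative with a quadratic remainder uniform in [x]: difference quotients can be
    compared under an integral without a limit theorem. In [L1diff] the remainder is moreover
    integrable in space, so that it passes through a convolution. *)
Definition wdiff i f f' := exists M : R, 0 <= M /\ exists2 e : R, 0 < e &
  forall x t, `|t| <= e ->
    `|f (x + t *: basis_vec i) - f x - t * f' x| <= t ^+ 2 * M.

Definition L1diff i q q' := exists k, L1b k /\ exists2 e : R, 0 < e &
  forall z t, `|t| <= e ->
    `|q (z + t *: basis_vec i) - q z - t * q' z| <= t ^+ 2 * k z.

(** Division by [t] and [t -> 0]. This replaces every passage to the limit in the integral
    identities below. *)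
Lemma le0_of_quadratic (X K e : R) : 0 < e ->
  (forall t, 0 < t -> t <= e -> t * X <= t ^+ 2 * K) -> X <= 0.
Proof.
move=> e0 H; rewrite leNgt; apply/negP => X0.
have K0 : 0 < `|K| + 1 by rewrite ltr_wpDl.
pose t := Num.min e (X / (2 * (`|K| + 1))).
have t0 : 0 < t by rewrite lt_min e0 divr_gt0// mulr_gt0.
have te : t <= e by rewrite ge_min lexx.
have tX : t * (2 * (`|K| + 1)) <= X.
  by rewrite -ler_pdivlMr ?mulr_gt0// ge_min lexx orbT.
have := H t t0 te; rewrite expr2 -mulrA ler_pM2l// => XtK.
have : t * K <= t * (`|K| + 1).
  by rewrite ler_wpM2l ?(ltW t0)// (le_trans (ler_norm _))// lerDl.
nra.
Qed.

Lemma L1diff_wdiff i q q' : L1diff i q q' -> wdiff i q q'.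
Proof.
move=> [k [k1 [e e0 H]]]; have [M M0 kM] := bmf_ub (L1b_bmf k1).
exists M; split; first exact: ltW.
exists e => // x t te; rewrite (le_trans (H x t te))// ler_wpM2l ?sqr_ge0//.
by rewrite (le_trans (ler_norm _)).
Qed.

Lemma wdiff_shift i f f' v : wdiff i f f' ->
  wdiff i (fun x => f (x + v)) (fun x => f' (x + v)).
Proof.
move=> [M [M0 [e e0 H]]]; exists M; split=> //; exists e => // x t te.
by have := H (x + v) t te; rewrite (addrAC x v).
Qed.

Lemma L1diff_conv i q q' f : L1diff i q q' -> L1b q -> L1b q' -> L1b f ->
  wdiff i (kconv q f) (kconv q' f).
Proof.
move=> [k [k1 [e e0 H]]] q1 q1' f1.
have [M M0 fM] := bmf_ub (L1b_bmf f1).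
(* The remainder estimate at [t = e] already forces [k] to be nonnegative. *)
have k0 z : 0 <= k z.
  have e2 : 0 < e ^+ 2 by rewrite exprn_gt0.
  have ee : `|e| <= e by rewrite gtr0_norm.
  by have := le_trans (normr_ge0 _) (H z e ee); rewrite (pmulr_rge0 _ e2).
exists (M * \int[mu]_z k z); split.
  by rewrite mulr_ge0 ?(ltW M0)//; apply: Rintegral_ge0.
exists e => // x t te.
have bf := L1b_bmf f1.
have i1 := L1b_integ (L1b_conv_integrand (x + t *: basis_vec i) q1 bf).
have i2 := L1b_integ (L1b_conv_integrand x q1 bf).
have i3 := L1b_integ (L1b_conv_integrand x q1' bf).
have ik := integ_reflect x (L1b_integ k1).
rewrite /kconv -(RintegralZl t measurableT i3) -(RintegralB measurableT i1 i2).
rewrite -(RintegralB measurableT (integB i1 i2) (integZ t i3)).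
rewrite -(Rint_reflect x (L1b_integ k1)) mulrA -(RintegralZl (t ^+ 2 * M) measurableT ik).
apply: Rint_norm_le; last exact: integZ.
  exact: integ_measurable (integB (integB i1 i2) (integZ t i3)).
move=> y; have := H (x - y) t te.
rewrite (_ : x - y + _ = x + t *: basis_vec i - y); last by rewrite addrAC.
by rewrite mulrA -!mulrBl normrM -mulrA (mulrC M) mulrA => h; exact: ler_pM.
Qed.

(** Translation invariance gives [\int f(x) g(x + w) = \int f(x - w) g(x)]; the two sides are
    expanded to first order in the step and compared. *)
Lemma wdiff_ibp i f f' g g' : wdiff i f f' -> wdiff i g g' ->
  L1b f -> L1b f' -> L1b g -> L1b g' ->
  \int[mu]_x (f x * g' x) = - \int[mu]_x (f' x * g x).
Proof.
move=> [Mf [Mf0 [ef ef0 Hf]]] [Mg [Mg0 [eg eg0 Hg]]] f1 f'1 g1 g'1.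
have M1 p q : L1b p -> L1b q -> integ mu (fun x => p x * q x).
  by move=> p1 q1; exact: L1b_integ (L1bMr p1 (L1b_bmf q1)).
pose e := Num.min ef eg.
have e0 : 0 < e by rewrite lt_min ef0.
have i1 := M1 _ _ f1 g'1; have i2 := M1 _ _ f'1 g1.
set X1 := \int[mu]_x _; set X2 := \int[mu]_x _.
pose K := Mg * \int[mu]_x `|f x| + Mf * \int[mu]_x `|g x|.
suff H t : 0 < t -> t <= e -> t * `|X1 + X2| <= t ^+ 2 * K.
  have : `|X1 + X2| <= 0 by apply: (le0_of_quadratic e0) => t; exact: H.
  by rewrite normr_le0 addr_eq0 => /eqP.
move=> t0 te; pose w : V := t *: basis_vec i.
have tf : `|- t| <= ef by rewrite normrN gtr0_norm// (le_trans te)// ge_min lexx.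
have tg : `|t| <= eg by rewrite gtr0_norm// (le_trans te)// ge_min lexx orbT.
have fw := L1b_shift (- w) f1; have gw := L1b_shift w g1.
have A : \int[mu]_x (f x * g (x + w)) = \int[mu]_x (f (x - w) * g x).
  rewrite -[RHS](Rint_shift w (M1 _ _ fw g1)).
  by apply: Rint_eq => x; rewrite addrK.
have i3 := M1 _ _ f1 g1; have i4 := M1 _ _ f1 gw; have i5 := M1 _ _ fw g1.
have E1 : `|\int[mu]_x (f x * g (x + w)) - \int[mu]_x (f x * g x) - t * X1|
    <= t ^+ 2 * (Mg * \int[mu]_x `|f x|).
  rewrite -(RintegralZl t measurableT i1) -(RintegralB measurableT i4 i3).
  rewrite -(RintegralB measurableT (integB i4 i3) (integZ t i1)) mulrA.
  have if1 := integ_norm (L1b_integ f1).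
  rewrite -(RintegralZl (t ^+ 2 * Mg) measurableT if1).
  apply: Rint_norm_le; last exact: integZ.
    exact: integ_measurable (integB (integB i4 i3) (integZ t i1)).
  by move=> x; rewrite mulrCA -!mulrBr normrM mulrC ler_wpM2r// Hg.
have E2 : `|\int[mu]_x (f (x - w) * g x) - \int[mu]_x (f x * g x) + t * X2|
    <= t ^+ 2 * (Mf * \int[mu]_x `|g x|).
  rewrite -(RintegralZl t measurableT i2) -(RintegralB measurableT i5 i3).
  rewrite -(RintegralD measurableT (integB i5 i3) (integZ t i2)) mulrA.
  have ig1 := integ_norm (L1b_integ g1).
  rewrite -(RintegralZl (t ^+ 2 * Mf) measurableT ig1).
  apply: Rint_norm_le; last exact: integZ.
    exact: integ_measurable (integD (integB i5 i3) (integZ t i2)).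
  move=> x; rewrite mulrA -!mulrBl -mulrDl normrM ler_wpM2r//.
  by have := Hf x (- t) tf; rewrite mulNr opprK sqrrN scaleNr.
rewrite -[X in X * _ <= _](gtr0_norm t0) -normrM /K (mulrDr (t ^+ 2)).
rewrite A in E1; set B := \int[mu]_x (f (x - w) * g x) in E1 E2.
set D := \int[mu]_x (f x * g x) in E1 E2.
rewrite (_ : t * (X1 + X2) = (B - D + t * X2) - (B - D - t * X1)); last by ring.
by rewrite (le_trans (ler_normB _ _))// addrC lerD.
Qed.

(* With [psi = (phi - lambda)_+], convexity gives
   [psi x - psi (x - v) <= a x * (phi x - phi (x - v))]; integrate against [eta]
   shifted to be nonnegative and use both signs of the step. *)
Lemma level_set_ibp i (phi phi' eta eta' : V -> R) (lambda : R) :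
  let a := \1_[set x | lambda < phi x] in
  L1b a -> bmf phi -> bmf phi' -> bmf eta -> bmf eta' ->
  wdiff i phi phi' -> wdiff i eta eta' ->
  lambda * \int[mu]_x (a x * eta' x) =
  \int[mu]_x (a x * (phi x * eta' x)) + \int[mu]_x (a x * (phi' x * eta x)).
Proof.
move=> a a1 bphi bphi' beta beta' [Mp [Mp0 [ep ep0 Hp]]] [Me [Me0 [ee ee0 He]]].
have aM f : bmf f -> integ mu (fun x => a x * f x).
  by move=> bf; exact: L1b_integ (L1bMr a1 bf).
pose psi x : R := a x * (phi x - lambda).
have psi1 : L1b psi by apply: L1bMr => //; apply: bmfB => //; exact: bmf_cst.
have psiM f : bmf f -> integ mu (fun x => psi x * f x).
  by move=> bf; exact: L1b_integ (L1bMr psi1 bf).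
have psi_le x y : psi x - psi y <= a x * (phi x - phi y).
  rewrite /psi /a !indicE; case: (boolP (x \in _)); case: (boolP (y \in _));
    rewrite ?inE ?notin_setE /= => h1 h2; rewrite ?mul1r ?mul0r; try by lra.
have [M M0 etaM] := bmf_ub beta.
pose e := Num.min ep ee.
have e0 : 0 < e by rewrite lt_min ep0.
pose X1 := \int[mu]_x (psi x * eta' x).
(* The convexity inequality can only be integrated against a nonnegative weight, so [eta] is raised
   by [C]. The weight has the same derivative [eta']. *)
have key C : M <= C -> X1 + \int[mu]_x (a x * (phi' x * (eta x + C))) = 0.
  move=> MC; pose z x : R := eta x + C.
  have z0 x : 0 <= z x.
    by have := le_trans (etaM x) MC; rewrite ler_norml => /andP[? _]; rewrite /z; lra.
  have bz : bmf z by apply: bmfD => //; exact: bmf_cst.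
  have i1 := psiM _ beta'.
  have i2 := aM _ (bmfM bphi' bz).
  set X2 := \int[mu]_x _.
  pose K := Me * \int[mu]_x `|psi x| + Mp * \int[mu]_x `|a x * z x|.
  have H t : `|t| <= e -> - t * (X1 + X2) <= t ^+ 2 * K.
    move=> te; pose w : V := t *: basis_vec i.
    have tp : `|- t| <= ep by rewrite normrN (le_trans te)// ge_min lexx.
    have tt : `|t| <= ee by rewrite (le_trans te)// ge_min lexx orbT.
    have psiw1 := L1b_shift (- w) psi1.
    have i3 := psiM _ bz; have i4 := L1b_integ (L1bMr psiw1 bz).
    have i5 := psiM _ (bmf_shift w bz).
    have A : \int[mu]_x (psi (x - w) * z x) = \int[mu]_x (psi x * z (x + w)).
      rewrite -(Rint_shift w i4).
      by apply: Rint_eq => x; rewrite addrK.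
    have bd : bmf (fun x => phi x - phi (x - w)).
      by apply: bmfB => //; exact: bmf_shift.
    have i6 := aM _ (bmfM bd bz).
    have L : \int[mu]_x (psi x * z x) - \int[mu]_x (psi x * z (x + w))
        <= \int[mu]_x (a x * ((phi x - phi (x - w)) * z x)).
      rewrite -A -(RintegralB measurableT i3 i4).
      apply: le_Rintegral => //; first exact: integB.
      by move=> x _; rewrite -mulrBl mulrA ler_wpM2r.
    have E1 : `|\int[mu]_x (psi x * z (x + w)) - \int[mu]_x (psi x * z x) - t * X1|
        <= t ^+ 2 * (Me * \int[mu]_x `|psi x|).
      rewrite -(RintegralZl t measurableT i1) -(RintegralB measurableT i5 i3).
      rewrite -(RintegralB measurableT (integB i5 i3) (integZ t i1)) mulrA.
      have ip := integ_norm (L1b_integ psi1).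
      rewrite -(RintegralZl (t ^+ 2 * Me) measurableT ip).
      apply: Rint_norm_le; last exact: integZ.
        exact: integ_measurable (integB (integB i5 i3) (integZ t i1)).
      move=> x; rewrite mulrCA -!mulrBr normrM mulrC ler_wpM2r//.
      have := He x t tt; rewrite /z -/w.
      by rewrite (_ : eta (x + w) + C - (eta x + C) = eta (x + w) - eta x)//; ring.
    have E2 : `|\int[mu]_x (a x * ((phi x - phi (x - w)) * z x)) - t * X2|
        <= t ^+ 2 * (Mp * \int[mu]_x `|a x * z x|).
      rewrite -(RintegralZl t measurableT i2) -(RintegralB measurableT i6 (integZ t i2)) mulrA.
      have iz := integ_norm (aM _ bz).
      rewrite -(RintegralZl (t ^+ 2 * Mp) measurableT iz).
      apply: Rint_norm_le; last exact: integZ.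
        exact: integ_measurable (integB i6 (integZ t i2)).
      move=> x.
      rewrite (_ : _ - _ = - (phi (x - w) - phi x - - t * phi' x) * (a x * z x)); last by ring.
      rewrite normrM normrN ler_wpM2r//.
      by have := Hp x (- t) tp; rewrite sqrrN scaleNr.
    rewrite mulNr mulrDr /K mulrDr.
    move: E1 E2 L; rewrite !ler_norml => /andP[E1 E1'] /andP[E2 E2'] L.
    lra.
  apply/eqP; rewrite eq_le; apply/andP; split.
  - apply: (le0_of_quadratic e0 (K := K)) => t t0 te.
    have := H (- t); rewrite normrN gtr0_norm// => /(_ te).
    by rewrite opprK sqrrN.
  - rewrite -oppr_le0; apply: (le0_of_quadratic e0 (K := K)) => t t0 te.
    have := H t; rewrite gtr0_norm// => /(_ te).
    by rewrite mulrN mulNr.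
have i7 := aM _ (bmfM bphi' beta).
have i8 := aM _ bphi'.
have split C : \int[mu]_x (a x * (phi' x * (eta x + C))) =
    \int[mu]_x (a x * (phi' x * eta x)) + C * \int[mu]_x (a x * phi' x).
  rewrite -(RintegralZl C measurableT i8) -(RintegralD measurableT i7 (integZ C i8)).
  by apply: Rint_eq => x; ring.
(* Two admissible values of [C] give two identities; their difference says that [\int a phi']
   vanishes, and the auxiliary constant drops out. *)
have M1 : M <= M + 1 by rewrite lerDl.
have k0 := key M (lexx _); have k1 := key (M + 1) M1.
have X1E : X1 = \int[mu]_x (a x * (phi x * eta' x)) - lambda * \int[mu]_x (a x * eta' x).
  have i9 := aM _ (bmfM bphi beta').
  have i10 := aM _ beta'.
  rewrite -(RintegralZl lambda measurableT i10) -(RintegralB measurableT i9 (integZ lambda i10)).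
  by apply: Rint_eq => x; rewrite /psi; ring.
rewrite !split in k0 k1; rewrite X1E in k0 k1.
set Y := \int[mu]_x (a x * phi' x) in k0 k1.
have Y0 : Y = 0 by lra.
by rewrite Y0 mulr0 in k0; lra.
Qed.

End weak_derivative.

(** * Estimate for one step *)

Section scaled_kernels.
Context {R : realType} {n : nat}.
Notation V := 'rV[R]_n.
Notation mu := (@borel_lebesgue_rV R n).
Implicit Types (q : V -> R) (x y z v : V) (i j : 'I_n) (s t b : R).

Definition kscale s q z : R := s^-1 ^+ n * q (s^-1 *: z).

Lemma gauss_kscale s z : 0 < s -> gauss s z = kscale s (gauss 1) z.
Proof.
by move=> s0; rewrite /kscale -{1}[s]mulr1 -gauss_scale// scalerA divff ?scale1r// gt_eqF.
Qed.

Lemma gauss2_kscale s z : 0 < s -> s^-1 ^+ n * gauss 2 (s^-1 *: z) = gauss (2 * s) z.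
Proof.
by move=> s0; rewrite -gauss_scale// scalerA divff ?gt_eqF// scale1r mulrC.
Qed.

Lemma measurable_kscale s q : measurable_fun setT q -> measurable_fun setT (kscale s q).
Proof.
move=> mq; apply: measurable_funM => //.
have := measurableT_comp mq (measurable_affine_rV s^-1 (0 : V)).
by apply: eq_measurable_fun => z _; rewrite /= addr0.
Qed.

(** The constant does not depend on [s]: both sides are the same dilation of a bound at scale one.
    The two lemmas that follow rest on the same remark. *)
Lemma kscale_bound q : kernel_dom q ->
  exists2 C : R, 0 <= C & forall s z, 0 < s -> `|kscale s q z| <= C * gauss (2 * s) z.
Proof.
move=> [c c0 hq]; have [C C0 hC] := @gdom_le_gauss2 R n c.
exists C => // s z s0; have sn0 : 0 <= s^-1 ^+ n by rewrite exprn_ge0 ?invr_ge0 ?ltW.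
rewrite /kscale normrM ger0_norm// -gauss2_kscale// mulrCA ler_wpM2l//.
exact: le_trans (hq _) (hC _).
Qed.

Lemma kscale_lip q : kernel_lip q ->
  exists2 C : R, 0 <= C & forall s z v b, 0 < s -> 0 <= b <= s ->
    (forall i, `|v ord0 i| <= b) ->
    `|kscale s q (z + v) - kscale s q z| <= C * (b / s) * gauss (2 * s) z.
Proof.
move=> [c c0 hq]; have [C C0 hC] := @gdom_le_gauss2 R n c.
exists C => // s z v b s0 /andP[b0 bs] vb.
have sn0 : 0 <= s^-1 ^+ n by rewrite exprn_ge0 ?invr_ge0 ?ltW.
have bs0 : 0 <= b / s by rewrite divr_ge0// ltW.
rewrite /kscale -mulrBr normrM ger0_norm// -gauss2_kscale// mulrCA ler_wpM2l//.
rewrite scalerDr (mulrC C) -mulrA (le_trans (hq _ _ (b / s) _ _))//.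
- by rewrite bs0 ler_pdivrMr// mul1r.
- move=> i; rewrite mxE normrM (@gtr0_norm _ s^-1) ?invr_gt0// [leLHS]mulrC.
  by rewrite ler_wpM2r// invr_ge0 ltW.
- by rewrite ler_wpM2l.
Qed.

Lemma kscale_diff i q q' : kernel_diff i q q' ->
  exists2 C : R, 0 <= C & forall s z t, 0 < s -> `|t| <= s ->
    `|kscale s q (z + t *: basis_vec i) - kscale s q z - t * (s^-1 * kscale s q' z)|
    <= t ^+ 2 * ((C / s ^+ 2) * gauss (2 * s) z).
Proof.
move=> [c c0 hq]; have [C C0 hC] := @gdom_le_gauss2 R n c.
exists C => // s z t s0 ts.
have sn0 : 0 <= s^-1 ^+ n by rewrite exprn_ge0 ?invr_ge0 ?ltW.
have t1 : `|t / s| <= 1.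
  by rewrite normrM [`|s^-1|]gtr0_norm ?invr_gt0// ler_pdivrMr// mul1r.
rewrite /kscale (_ : _ - _ = s^-1 ^+ n * (q (s^-1 *: z + (t / s) *: basis_vec i)
    - q (s^-1 *: z) - (t / s) * q' (s^-1 *: z))); last first.
  by rewrite scalerDr scalerA (mulrC _ t); ring.
rewrite normrM ger0_norm// -gauss2_kscale// (mulrCA (C / _)) (mulrCA (t ^+ 2)).
rewrite ler_wpM2l// (le_trans (hq _ _ t1))//.
have e : t ^+ 2 * (C / s ^+ 2 * gauss 2 (s^-1 *: z)) = (t / s) ^+ 2 * (C * gauss 2 (s^-1 *: z)).
  by rewrite exprMn exprVn; ring.
by rewrite e ler_wpM2l ?sqr_ge0.
Qed.

Lemma kscale_L1b s q : 0 < s -> measurable_fun setT q -> kernel_dom q -> L1b (kscale s q).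
Proof.
move=> s0 mq dq; have [C C0 hC] := kscale_bound dq.
apply: (L1b_le (measurable_kscale s mq) (fun z => hC s z s0)).
by apply: L1bZ; apply: L1b_gauss; rewrite mulr_gt0.
Qed.

Lemma kscale_L1diff s i q q' : 0 < s -> kernel_diff i q q' ->
  L1diff i (kscale s q) (fun z => s^-1 * kscale s q' z).
Proof.
move=> s0 dq; have [C C0 hC] := kscale_diff dq.
exists (fun z => (C / s ^+ 2) * gauss (2 * s) z); split.
  by apply: L1bZ; apply: L1b_gauss; rewrite mulr_gt0.
by exists s => // z t ts; exact: hC.
Qed.

(* [Kx] is the field K_1 of the header, and [Kxx i j] is the derivative of [Kx i]
   in direction [j]. *)
Definition Kx i z : R := 2^-1 * (z ord0 i * gauss 1 z).

Definition Kxx i j z : R :=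
  2^-1 * ((i == j)%:R * gauss 1 z + z ord0 i * - (2^-1 * (z ord0 j * gauss 1 z))).

Lemma measurable_Kx i : measurable_fun setT (Kx i).
Proof.
apply: measurable_funM => //; apply: measurable_funM.
  exact: measurable_coord_rV.
exact: measurable_gauss.
Qed.

Lemma measurable_Kxx i j : measurable_fun setT (Kxx i j).
Proof.
have mg := @measurable_gauss R n 1.
apply: measurable_funM => //; apply: measurable_funD.
  by apply: measurable_funM.
apply: measurable_funM; first exact: measurable_coord_rV.
apply: measurableT_comp => //; exact: measurable_Kx.
Qed.

Lemma KxE i : Kx i = (fun z => 2^-1 * (z ord0 i * gauss 1 z) + 0 * gauss 1 z).
Proof. by apply/funext => z; rewrite mul0r addr0. Qed.

Lemma kernel_dom_Kx i : kernel_dom (Kx i).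
Proof.
rewrite KxE; apply: kernel_dom_lin; last exact: kernel_dom_gauss.
exact/kernel_dom_coord/kernel_dom_gauss.
Qed.

Lemma kernel_lip_Kx i : kernel_lip (Kx i).
Proof.
rewrite KxE; apply: kernel_lip_lin; last exact: kernel_lip_gauss.
by apply: kernel_lip_coord; [exact: kernel_dom_gauss|exact: kernel_lip_gauss].
Qed.

Lemma KxxE i j : Kxx i j =
  (fun z => (2^-1 * (i == j)%:R) * gauss 1 z + (- 2^-1) * (z ord0 i * Kx j z)).
Proof. by apply/funext => z; rewrite /Kxx /Kx; ring. Qed.

Lemma kernel_dom_Kxx i j : kernel_dom (Kxx i j).
Proof.
by rewrite KxxE; apply: kernel_dom_lin;
  [exact: kernel_dom_gauss|exact/kernel_dom_coord/kernel_dom_Kx].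
Qed.

Lemma kernel_lip_Kxx i j : kernel_lip (Kxx i j).
Proof.
rewrite KxxE; apply: kernel_lip_lin; first exact: kernel_lip_gauss.
by apply: kernel_lip_coord; [exact: kernel_dom_Kx|exact: kernel_lip_Kx].
Qed.

Lemma kernel_diff_gaussKx i : kernel_diff i (gauss 1) (fun z => - Kx i z).
Proof. exact: kernel_diff_gauss. Qed.

Lemma kernel_diff_Kx i j : kernel_diff j (Kx i) (Kxx i j).
Proof.
have -> : Kxx i j = (fun z =>
    2^-1 * ((i == j)%:R * gauss 1 z + z ord0 i * - (2^-1 * (z ord0 j * gauss 1 z)))
    + 0 * - (2^-1 * (z ord0 j * gauss 1 z))).
  by apply/funext => z; rewrite mul0r addr0.
rewrite KxE; apply: kernel_diff_lin; last exact: kernel_diff_gauss.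
by apply: kernel_diff_coord; [exact: kernel_lip_gauss|exact: kernel_diff_gauss].
Qed.

(** The right-hand side is [- 1/2] times the derivative of [gauss r z] in [r] at [r = 1], which is
    how the test field was found. *)
Lemma sum_Kxx z : \sum_i Kxx i i z = 2^-1 * ((n%:R - 2^-1 * sqnorm z) * gauss 1 z).
Proof.
rewrite -mulr_sumr; congr (_ * _).
have -> : n%:R = \sum_(i < n) (1 : R) by rewrite sumr_const card_ord.
rewrite /sqnorm mulr_sumr -sumrB mulr_suml.
by apply: eq_bigr => i _; rewrite eqxx /= mulr1n; ring.
Qed.

(** The factor [norm1 z] is worth one power of [s] and cancels [s^-1]; this is the bounded first
    moment of the derivative of the heat kernel. *)
Lemma norm1_Kx_bound i : exists2 C : R, 0 <= C & forall s z, 0 < s ->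
  norm1 z * (s^-1 * `|kscale s (Kx i) z|) <= C * gauss (2 * s) z.
Proof.
have H j := kscale_bound (kernel_dom_coord j (kernel_dom_Kx i)).
pose C j := sval (cid2 (H j)).
have C0 j : 0 <= C j by rewrite /C; case: cid2.
have HC j s z : 0 < s -> `|kscale s (fun z => z ord0 j * Kx i z) z| <= C j * gauss (2 * s) z.
  by rewrite /C; case: cid2 => /= c _ h; exact: h.
exists (\sum_j C j) => [|s z s0]; first exact: sumr_ge0.
rewrite /norm1 !mulr_suml ler_sum// => j _.
rewrite (le_trans _ (HC j s z s0))// /kscale mxE !normrM.
rewrite (@gtr0_norm _ s^-1) ?invr_gt0//.
by rewrite le_eqVlt; apply/orP; left; apply/eqP; ring.
Qed.

End scaled_kernels.

(** * The thresholding energy as a function of the scale *)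

Section heat_energy.
Context {R : realType} {n : nat}.
Notation V := 'rV[R]_n.
Notation mu := (@borel_lebesgue_rV R n).
Implicit Types (a q : V -> R) (x y z v : V) (i j : 'I_n) (r s t b : R).

Definition unit_ind a :=
  [/\ L1b a, forall x, a x = 0 \/ a x = 1 & \int[mu]_x a x = 1].

Definition overlap a s := dint (fun x y => a x * gauss s (x - y) * a y).
(* [s] times the thresholding energy of time step [s ^+ 2]. *)
Definition henergy a s := dint (fun x y => a x * gauss s (x - y) * (1 - a y)).

Lemma unit_ind_ge0 a x : unit_ind a -> 0 <= a x.
Proof. by case=> _ /(_ x) [] -> _. Qed.

Lemma unit_ind_le1 a x : unit_ind a -> a x <= 1.
Proof. by case=> _ /(_ x) [] -> _. Qed.

Lemma unit_ind_norm a x : unit_ind a -> `|a x| <= 1.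
Proof. by move=> ua; rewrite ger0_norm ?unit_ind_ge0// unit_ind_le1. Qed.

Lemma bmf_compl a : bmf a -> bmf (fun x => 1 - a x).
Proof. by move=> ba; exact: bmfB (bmf_cst 1) ba. Qed.

Section unit.
Variable a : V -> R.
Hypothesis ua : unit_ind a.
Let a1 : L1b a. Proof. by case: ua. Qed.
Let ba := L1b_bmf a1.
Let bca := bmf_compl ba.

Lemma L2_henergy s : 0 < s -> L2 (fun x y => a x * gauss s (x - y) * (1 - a y)).
Proof. by move=> s0; apply: L2_kernel => //; exact: L1b_gauss. Qed.

Lemma L2_overlap s : 0 < s -> L2 (fun x y => a x * gauss s (x - y) * a y).
Proof. by move=> s0; apply: L2_kernel => //; exact: L1b_gauss. Qed.

Lemma overlapE s : 0 < s -> overlap a s = 1 - henergy a s.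
Proof.
move=> s0; apply/eqP; rewrite -subr_eq opprK -dintD; [|exact: L2_overlap|exact: L2_henergy].
rewrite (@eq_dint _ _ _ (fun x y => a x * gauss s (x - y) * 1)); last by move=> x y; ring.
rewrite dint12; last by apply: L2_kernel => //; [exact: L1b_gauss|exact: bmf_cst].
case: (ua) => _ _ ea; rewrite -[X in _ == X]ea; apply/eqP/Rint_eq => x.
transitivity (a x * \int[mu]_y gauss s (x - y)); last first.
  by rewrite (Rint_reflect x (integ_gauss n s0)) Rint_gauss// mulr1.
rewrite -RintegralZl//; last exact: (integ_reflect x (integ_gauss n s0)).
by apply: Rint_eq => y; rewrite mulr1.
Qed.

Lemma henergy_ge0 s : 0 <= henergy a s.
Proof.
apply: Rintegral_ge0 => z _; rewrite mulr_ge0 ?mulr_ge0 ?gauss_ge0 ?subr_ge0//.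
- exact: unit_ind_ge0.
- exact: unit_ind_le1.
Qed.

Lemma henergy_sym s : 0 < s ->
  dint (fun x y => (1 - a x) * gauss s (x - y) * a y) = henergy a s.
Proof.
move=> s0; rewrite /henergy -(dint_swap (L2_henergy s0)).
by apply: eq_dint => x y; rewrite gauss_sym; ring.
Qed.

Lemma henergy_widen s t : 0 < s -> s <= t -> henergy a s <= (t / s) ^+ n * henergy a t.
Proof.
move=> s0 st; have t0 : 0 < t by exact: lt_le_trans st.
rewrite /henergy -dintZ; last exact: L2_henergy.
apply: le_Rintegral => //; first exact: L2_integ (L2_henergy s0).
  by apply: integZ; exact: L2_integ (L2_henergy t0).
move=> [x y] _; rewrite /unc /=.
rewrite mulrA (mulrCA ((t / s) ^+ n)) ler_wpM2r ?subr_ge0 ?unit_ind_le1//.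
by rewrite ler_wpM2l ?unit_ind_ge0// gauss_widen.
Qed.

(** The measure of [A] minus its translate [A + z], where [a] is the indicator of [A]. *)
Definition escape z : R := \int[mu]_x (a x * (1 - a (x - z))).

Lemma integ_escape z : integ mu (fun x => a x * (1 - a (x - z))).
Proof. by apply: L1b_integ; apply: L1bMr => //; exact: (bmf_shift (- z) bca). Qed.

Lemma escape_ge0 z : 0 <= escape z.
Proof.
apply: Rintegral_ge0 => x _.
by rewrite mulr_ge0 ?subr_ge0 ?unit_ind_ge0 ?unit_ind_le1.
Qed.

(** If [x] is in the set and [x - z - v] is not, the set is left either between [x] and [x - z] or
    between [x - z] and [x - z - v]. *)
Lemma escapeD z v : escape (z + v) <= escape z + escape v.
Proof.
have iz := integ_escape z; have iv := integ_escape v.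
have iv' := integ_shift (- z) iv.
rewrite {3}/escape -(Rint_shift (- z) iv) -(RintegralD measurableT iz iv').
apply: le_Rintegral => //; [exact: integ_escape|exact: integD|].
move=> x _ /=; rewrite opprD addrA.
case: (ua) => _ ai _.
by case: (ai x) => ->; case: (ai (x - z)) => ->; case: (ai (x - z - v)) => ->; lra.
Qed.

Lemma escapeMn z m : escape (m%:R *: z) <= m%:R * escape z.
Proof.
elim: m => [|m IH].
  rewrite scale0r mul0r /escape (Rint_eq mu (g := cst 0)) ?Rintegral_cst ?mul0r// => x.
  by rewrite subr0; case: (ua) => _ /(_ x) [] -> _; rewrite ?mul0r ?subrr ?mulr0.
rewrite -natr1 scalerDl scale1r mulrDl mul1r.
by apply: le_trans (escapeD _ _) _; rewrite lerD2r.
Qed.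

Lemma L2_escape s : 0 < s -> L2 (fun x z => a x * gauss s z * (1 - a (x - z))).
Proof.
move=> s0; have g1 := L1b_gauss (n := n) s0; apply: (L2_le _ (L2_prod a1 g1)).
  apply: mfun2M; first exact: mfun2M (mfun2_fst ba.1) (mfun2_snd (L1b_bmf g1).1).
  exact: (mfun2_sub bca.1).
move=> x z; rewrite normrM (normrM (a x)) (ger0_norm (unit_ind_ge0 x ua)) (ger0_norm (gauss_ge0 s z)).
rewrite ler_piMr ?mulr_ge0 ?unit_ind_ge0 ?gauss_ge0// ger0_norm ?subr_ge0 ?unit_ind_le1//.
by rewrite gerBl unit_ind_ge0.
Qed.

Lemma henergy_escape s : 0 < s -> henergy a s = \int[mu]_z (gauss s z * escape z).
Proof.
move=> s0; rewrite /henergy dint12; last exact: L2_henergy.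
transitivity (dint (fun x z => a x * gauss s z * (1 - a (x - z)))).
  rewrite dint12; last exact: L2_escape.
  apply: Rint_eq => x.
  rewrite -[RHS](Rint_reflect x (L2_integ1 x (L2_escape s0))).
  by apply: Rint_eq => y /=; rewrite (_ : x - (x - y) = y)// opprB addrC subrK.
rewrite dint21; last exact: L2_escape.
apply: Rint_eq => z; rewrite -RintegralZl//; last exact: integ_escape.
by apply: Rint_eq => x; ring.
Qed.

Lemma integ_gauss_escape s : 0 < s -> integ mu (fun z => gauss s z * escape z).
Proof.
move=> s0; have := L2_integ21 (L2_escape s0); congr (integ _ _).
apply/funext => z; rewrite -RintegralZl//; last exact: integ_escape.
by apply: Rint_eq => x; ring.
Qed.

(* [escape] is subadditive, and [gauss (m * s)] is a dilation of [gauss s]. *)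
Lemma henergy_dilate s m : 0 < s -> (0 < m)%N ->
  henergy a (m%:R * s) <= m%:R * henergy a s.
Proof.
move=> s0 m0; have mR : 0 < m%:R :> R by rewrite ltr0n.
have ms0 : 0 < m%:R * s by rewrite mulr_gt0.
have mn0 : m%:R != 0 :> R by rewrite gt_eqF.
have i1 := integ_gauss_escape ms0; have i2 := integ_gauss_escape s0.
have i3 := integ_affine 0 mn0 i1.
have Ez z : gauss s z * escape (m%:R *: z) =
    `|m%:R| ^+ n * (gauss (m%:R * s) (m%:R *: z + 0) * escape (m%:R *: z + 0)).
  rewrite addr0 gtr0_norm// gauss_scale// !(mulrA (m%:R ^+ n)) -exprMn divff//.
  by rewrite expr1n mul1r.
have E : henergy a (m%:R * s) = \int[mu]_z (gauss s z * escape (m%:R *: z)).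
  rewrite (henergy_escape ms0) (Rint_eq mu Ez).
  by rewrite [RHS](RintegralZl _ measurableT i3); exact: Rint_affine.
rewrite E (henergy_escape s0) -(RintegralZl m%:R measurableT i2).
have i4 : integ mu (fun z => gauss s z * escape (m%:R *: z)).
  by have := integZ (`|m%:R| ^+ n) i3; congr (integ _ _); apply/funext => z; rewrite Ez.
apply: le_Rintegral => //; first exact: integZ.
by move=> z _; rewrite mulrCA ler_wpM2l ?gauss_ge0// escapeMn.
Qed.

End unit.

(** Equal to [gauss r z] for positive [r], but written with powers of [r^-1], so that the rules of
    differentiation in [r] apply directly. *)
Definition gauss_radial r z : R :=
  (Num.sqrt (4 * pi))^-1 ^+ n * (r^-1 ^+ n * expR (- (sqnorm z / 4) * r^-1 ^+ 2)).

Lemma gauss_radialE r z : 0 < r -> gauss r z = gauss_radial r z.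
Proof.
move=> r0; rewrite /gauss /gauss_radial sqrt_peak// invfM exprMn.
rewrite [RHS]mulrA [X in X * _ = _]mulrC; congr (_ * expR _).
by rewrite exprVn; field; rewrite gt_eqF.
Qed.

(** The derivative of [gauss r z] in [r], encoded as a divergence in space; through this form the
    scale derivative of the energy becomes a sum of test integrals. *)
Definition dgauss r z : R := - 2 * \sum_i (r^-1 * kscale r (Kxx i i) z).

Lemma dgaussE r z : 0 < r ->
  dgauss r z = (- n%:R / r + sqnorm z / (2 * r ^+ 3)) * gauss r z.
Proof.
move=> r0; rewrite /dgauss -mulr_sumr /kscale -mulr_sumr sum_Kxx sqnormZ.
rewrite [in RHS](gauss_kscale z r0) /kscale exprVn; set g := gauss 1 _.
by rewrite ?exprVn; field; rewrite (gt_eqF r0) gt_eqF ?exprn_gt0.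
Qed.

Lemma is_derive_gauss_radial r z : 0 < r ->
  is_derive r 1 (fun r => gauss_radial r z) (dgauss r z).
Proof.
move=> r0; have rn0 : r != 0 by rewrite gt_eqF.
have dV : is_derive r 1 (fun r : R => r^-1) (- r ^- 2).
  have := @is_deriveV R id r 1 1 rn0 (is_derive_id r 1).
  by rewrite /= -[_ *: 1]mulr1 /GRing.scale /= !mulr1.
have dX k := @is_deriveX _ _ (fun r : R => r^-1) k r 1 _ dV.
pose c : R := - (sqnorm z / 4).
have dE := is_derive1_comp (is_derive_expR _) (is_deriveZ c (dX 2)).
have := is_deriveZ ((Num.sqrt (4 * pi))^-1 ^+ n) (is_deriveM (dX n) dE).
rewrite dgaussE// gauss_radialE// /gauss_radial -/c.
set f := (X in is_derive _ _ X _ -> _); set g := (X in _ -> is_derive _ _ X _).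
have -> : f = g.
  by apply/funext => t; rewrite /f /g /c /= !fctE /GRing.scale/= mulrC.
move=> H; apply: (is_derive_eq H); rewrite !fctE /GRing.scale /=.
(* The power rule produces the exponent [n.-1], which is a truncated predecessor when [n = 0]; there
   the factor [n%:R] vanishes. *)
have -> : n%:R * r^-1 ^+ n.-1 = n%:R * r * r^-1 ^+ n.
  case: (n) => [|k]; first by rewrite !mul0r.
  by rewrite /= exprS -mulrA (mulrA r) divff// mul1r.
set u := r^-1 ^+ n; set P := _^-1 ^+ n.
rewrite -/(r^-1 ^+ 2); set E := expR _; rewrite expr1 /c.
by field.
Qed.

Lemma dgauss_bound : exists2 C : R, 0 <= C & forall r z, 0 < r ->
  `|dgauss r z| <= C / r * gauss (2 * r) z.
Proof.
have H i := kscale_bound (@kernel_dom_Kxx R n i i).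
pose C i := sval (cid2 (H i)).
have C0 i : 0 <= C i by rewrite /C; case: cid2.
have HC i r z : 0 < r -> `|kscale r (Kxx i i) z| <= C i * gauss (2 * r) z.
  by rewrite /C; case: cid2 => /= c _ h; exact: h.
exists (2 * \sum_i C i) => [|r z r0]; first by rewrite mulr_ge0// sumr_ge0.
rewrite /dgauss normrM normrN (@ger0_norm _ 2)// -!mulrA ler_wpM2l//.
rewrite (le_trans (ler_norm_sum _ _ _))// mulr_suml ler_sum// => i _.
rewrite normrM (@gtr0_norm _ r^-1) ?invr_gt0// mulrCA ler_wpM2l ?invr_ge0 ?(ltW r0)//.
exact: HC.
Qed.

Definition doverlap a r := dint (fun x y => a x * dgauss r (x - y) * a y).

Lemma is_derive_overlap a r : unit_ind a -> 0 < r ->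
  is_derive r 1 (fun r => dint (fun x y => a x * gauss_radial r (x - y) * a y))
    (doverlap a r).
Proof.
move=> ua r0; have a1 : L1b a by case: ua.
pose u := r / 2; pose v := 2 * r.
have u0 : 0 < u by rewrite divr_gt0.
have uv : `]u, v[%classic r by rewrite /= in_itv /= /u /v; apply/andP; split; lra.
have Ipos t : `]u, v[%classic t -> 0 < t.
  by rewrite /= in_itv/= => /andP[ut _]; exact: lt_trans ut.
pose f t (z : V * V) := a z.1 * gauss_radial t (z.1 - z.2) * a z.2.
have intf t : `]u, v[%classic t -> (mu \x mu)%E.-integrable setT (EFin \o f t).
  move=> /Ipos t0; have := L2_integ (L2_overlap ua t0); congr (integ _ _).
  by apply/funext => -[x y]; rewrite /unc/f/= gauss_radialE.
have dE t (z : V * V) : 0 < t -> is_derive t 1 (f ^~ z) (a z.1 * dgauss t (z.1 - z.2) * a z.2).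
  move=> t0; have D := is_derive_gauss_radial (z.1 - z.2) t0.
  have := is_deriveZ (a z.2 * a z.1) D.
  set g := (X in is_derive _ _ X _ -> _); have -> : g = f ^~ z.
    by apply/funext => w; rewrite /f [RHS]mulrC [RHS]mulrA.
  by move=> H; apply: (is_derive_eq H); rewrite /GRing.scale/=; ring.
have derf t (z : V * V) : `]u, v[%classic t -> setT z -> derivable (f ^~ z) t 1.
  by move=> /Ipos t0 _; have [] := dE t z t0.
have d1E t (z : V * V) : 0 < t -> partial1of2 f t z = a z.1 * dgauss t (z.1 - z.2) * a z.2.
  by move=> t0; rewrite partial1of2E; exact: (@derive_val _ _ _ _ _ _ _ (dE t z t0)).
have [C C0 hC] := dgauss_bound.
(* A majorant independent of [t] in []u, v[]: the Gaussian is widened to the largest scale, and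
   since [v / u = 4] the factor [8 ^+ n] is ample. *)
pose G (z : V * V) := C / u * 8 ^+ n * (a z.1 * gauss (2 * v) (z.1 - z.2) * a z.2).
have v0 : 0 < 2 * v by rewrite /v; lra.
have G0 (z : V * V) : 0 <= G z.
  apply: mulr_ge0; first by rewrite !mulr_ge0 ?invr_ge0 ?(ltW u0) ?exprn_ge0.
  by apply: mulr_ge0; [apply: mulr_ge0|]; rewrite ?gauss_ge0 ?(unit_ind_ge0 _ ua).
have intG : (mu \x mu)%E.-integrable setT (EFin \o G).
  exact: (integZ (C / u * 8 ^+ n) (L2_integ (L2_overlap ua v0))).
have Gub t (z : V * V) : `]u, v[%classic t -> setT z -> `|partial1of2 f t z| <= G z.
  move=> tI _; have t0 := Ipos t tI; rewrite d1E// /G.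
  move: tI; rewrite /= in_itv/= => /andP[ut tv].
  rewrite normrM (normrM (a z.1)) !(ger0_norm (unit_ind_ge0 _ ua)).
  rewrite mulrA ler_wpM2r ?unit_ind_ge0// mulrCA ler_wpM2l ?unit_ind_ge0//.
  apply: (le_trans (hC t _ t0)).
  have tt : 2 * t <= 2 * v by lra.
  have t20 : 0 < 2 * t by lra.
  have W := gauss_widen (z.1 - z.2) t20 tt.
  rewrite -(mulrA (C / u)); apply: ler_pM; rewrite ?gauss_ge0 ?divr_ge0 ?(ltW t0)//.
    by rewrite ler_wpM2l// lef_pV2 ?posrE// ltW.
  apply: (le_trans W); rewrite ler_wpM2r ?gauss_ge0// lerXn2r ?nnegrE//.
    by rewrite divr_ge0// ltW.
  by rewrite ler_pdivrMr//; rewrite /u /v in ut *; lra.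
have dF := derivable_under_integral measurableT uv intf derf G0 intG Gub.
have eF := differentiation_under_integral measurableT uv intf derf G0 intG Gub.
apply: DeriveDef => //.
rewrite -derive1E; rewrite [LHS]eF.
by apply: Rint_eq => z; rewrite d1E.
Qed.

Lemma overlap_mvt a r s : unit_ind a -> 0 < r -> r < s ->
  exists2 c, r < c < s & overlap a s - overlap a r = doverlap a c * (s - r).
Proof.
move=> ua r0 rs.
pose f t := dint (fun x y => a x * gauss_radial t (x - y) * a y).
have fE t : 0 < t -> overlap a t = f t.
  by move=> t0; apply: eq_dint => x y; rewrite gauss_radialE.
have dpos t : r <= t -> is_derive t 1 f (doverlap a t).
  by move=> rt; apply: is_derive_overlap => //; exact: lt_le_trans rt.
have [||c] := @MVT _ f (doverlap a) r s rs.
- by move=> t; rewrite in_itv/= => /andP[/ltW rt _]; exact: dpos.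
- apply: derivable_within_continuous => t; rewrite in_itv/= => /andP[rt _].
  by have [] := dpos t rt.
rewrite in_itv/= => rcs E; exists c => //; rewrite !fE//.
exact: lt_trans rs.
Qed.

End heat_energy.

(** * First variation of the energy *)

Section step.
Context {R : realType} {n : nat}.
Notation V := 'rV[R]_n.
Notation mu := (@borel_lebesgue_rV R n).
Implicit Types (a p q u f g : V -> R) (x y z v : V) (i j : 'I_n) (r s t b : R).

(** The derivative of [gauss s] in direction [i]. It is a multiple of the test field at scale [s],
    so the bounds on [Kx] serve both. *)
Definition dxgauss i s z : R := - (s^-1 * kscale s (Kx i) z).

Lemma L1b_dxgauss i s : 0 < s -> L1b (dxgauss i s).
Proof.
move=> s0; have := L1bZ (- s^-1) (kscale_L1b s0 (measurable_Kx i) (kernel_dom_Kx i)).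
by congr (L1b _); apply/funext => z; rewrite mulNr.
Qed.

Lemma dxgauss_odd i s z : dxgauss i s (- z) = - dxgauss i s z.
Proof.
rewrite /dxgauss /kscale /Kx scalerN gaussN !mxE; ring.
Qed.

Lemma Rint_dxgauss i s : 0 < s -> \int[mu]_z dxgauss i s z = 0.
Proof.
move=> s0; have i1 := L1b_integ (L1b_dxgauss i s0).
have := Rint_reflect 0 i1.
have -> : \int[mu]_x dxgauss i s (0 - x) = \int[mu]_x (-1 * dxgauss i s x).
  by apply: Rint_eq => x; rewrite sub0r dxgauss_odd mulN1r.
by rewrite RintegralZl// mulN1r => h; lra.
Qed.

Lemma L1diff_gauss i s : 0 < s -> L1diff i (gauss s) (dxgauss i s).
Proof.
move=> s0; have := kscale_L1diff s0 (@kernel_diff_gaussKx R n i).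
have -> : kscale s (gauss 1) = (gauss s : V -> R) by apply/funext => z; rewrite -gauss_kscale.
move=> H; rewrite (_ : dxgauss i s = (fun z => s^-1 * kscale s (fun z => - Kx i z) z))//.
by apply/funext => z; rewrite /dxgauss /kscale; ring.
Qed.

Lemma dxgauss_bound i : exists2 C : R, 0 <= C & forall s z, 0 < s ->
  `|dxgauss i s z| <= C / s * gauss (2 * s) z /\
  norm1 z * `|dxgauss i s z| <= C * gauss (2 * s) z.
Proof.
have [C C0 hC] := kscale_bound (@kernel_dom_Kx R n i).
have [C' C'0 hC'] := @norm1_Kx_bound R n i.
exists (C + C') => [|s z s0]; first exact: addr_ge0.
have g0 := @gauss_ge0 R n (2 * s) z.
rewrite /dxgauss normrN normrM (@gtr0_norm _ s^-1) ?invr_gt0//; split.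
- rewrite (mulrC (C + C')) -mulrA ler_wpM2l ?invr_ge0 ?(ltW s0)//.
  by rewrite (le_trans (hC _ _ s0))// ler_wpM2r// lerDl.
- by rewrite (le_trans (hC' _ _ s0))// ler_wpM2r// lerDr.
Qed.

(** It identifies two expressions of the same derivative without computing an integral. *)
Lemma wdiff_unique i f f1 f2 : wdiff i f f1 -> wdiff i f f2 -> f1 = f2.
Proof.
move=> [M [M0 [e e0 H]]] [N [N0 [e' e'0 H']]]; apply/funext => x.
apply/eqP; rewrite -subr_eq0 -normr_le0.
have ee0 : 0 < Num.min e e' by rewrite lt_min e0.
apply: (le0_of_quadratic ee0 (K := M + N)) => t t0.
rewrite le_min => /andP[te te'].
have h := H x t; have h' := H' x t; rewrite gtr0_norm// in h h'.
rewrite -[X in X * _ <= _](gtr0_norm t0) -normrM (mulrDr (t ^+ 2)).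
set A := f (x + _) - f x in h h'.
rewrite (_ : t * (f1 x - f2 x) = (A - t * f2 x) - (A - t * f1 x)); last by ring.
by rewrite (le_trans (ler_normB _ _))// addrC lerD// ?h ?h'.
Qed.

(** Cauchy-Schwarz recovered from Young's inequality with a free parameter; the choice is
    [t = X / (2 P)], and [t] large when [P = 0]. *)
Lemma sqr_le_of_amgm (X P Q : R) : 0 <= X -> 0 <= P -> 0 <= Q ->
  (forall t, 0 < t -> X <= t * P + Q / t) -> X ^+ 2 <= 4 * P * Q.
Proof.
move=> X0 P0 Q0 H; have [->|Xn0] := eqVneq X 0; first by rewrite expr0n/= !mulr_ge0.
have Xp : 0 < X by rewrite lt_def Xn0.
have [P00|Pn0] := eqVneq P 0.
  have t0 : 0 < 2 * Q / X + 1 by rewrite ltr_wpDl// divr_ge0 ?mulr_ge0.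
  have := H _ t0; rewrite P00 mulr0 add0r ler_pdivlMr// mulrDr mulr1.
  by rewrite mulrC divfK//; lra.
have Pp : 0 < P by rewrite lt_def Pn0.
have t0 : 0 < X / (2 * P) by rewrite divr_gt0 ?mulr_gt0.
have := H _ t0; have -> : X / (2 * P) * P = X / 2 by field.
have -> : Q / (X / (2 * P)) = 2 * P * Q / X by field; apply/andP.
move=> h; have : X / 2 <= 2 * P * Q / X by lra.
by rewrite ler_pdivlMr// expr2; lra.
Qed.

Section fixed.
Variable a : V -> R.
Hypothesis ua : unit_ind a.
Let a1 : L1b a. Proof. by case: ua. Qed.
Let ba := L1b_bmf a1.
Let bca := bmf_compl ba.
Variables (i : 'I_n) (s : R) (eta eta1 : V -> R) (M1 L : R).
Hypotheses (s0 : 0 < s) (eta_1 : L1b eta) (eta1_1 : L1b eta1).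
Hypothesis deta : wdiff i eta eta1.
Hypothesis eta1M : forall x, `|eta1 x| <= M1.
Hypothesis etaL : forall x y, `|eta x - eta y| <= L * norm1 (x - y).

Let G1 := L1b_gauss (n := n) s0.
Let dG1 := L1b_dxgauss i s0.
Let phi := kconv (gauss s) a.
Let phi1 := kconv (dxgauss i s) a.
Let phi_1 : L1b phi. Proof. exact: L1b_conv. Qed.
Let phi1_1 : L1b phi1. Proof. exact: L1b_conv. Qed.
Let dphi : wdiff i phi phi1.
Proof. by apply: L1diff_conv => //; exact: L1diff_gauss. Qed.

Let B := dint (fun x y => a x * dxgauss i s (x - y) * (1 - a y) * (eta x - eta y)).

Let L2B1 : L2 (fun x y => (a x * eta x) * dxgauss i s (x - y) * (1 - a y)).
Proof. by apply: L2_kernel => //; apply: L1bMr => //; exact: L1b_bmf. Qed.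

Let L2B2 : L2 (fun x y => a x * dxgauss i s (x - y) * ((1 - a y) * eta y)).
Proof. by apply: L2_kernel => //; apply: bmfM => //; exact: L1b_bmf. Qed.

(** The kernel [dxgauss] has integral zero, which handles the part with [eta x], and is odd, which
    handles the part with [eta y]; [\int phi1 eta] is then integrated by parts. *)
Let BE : B = - (\int[mu]_x (phi x * eta1 x)) - 2 * \int[mu]_x (a x * (phi1 x * eta x)).
Proof.
have bz := L1b_bmf eta_1.
have -> : B = dint (fun x y => (a x * eta x) * dxgauss i s (x - y) * (1 - a y))
    - dint (fun x y => a x * dxgauss i s (x - y) * ((1 - a y) * eta y)).
  by rewrite -dintB//; apply: eq_dint => x y; ring.
have az1 : L1b (fun x => a x * eta x) by exact: L1bMr.
have -> : dint (fun x y => (a x * eta x) * dxgauss i s (x - y) * (1 - a y)) =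
    - \int[mu]_x (a x * (phi1 x * eta x)).
  transitivity (dint (fun x y => (a x * eta x) * dxgauss i s (x - y) * 1) -
      dint (fun x y => (a x * eta x) * dxgauss i s (x - y) * a y)).
    rewrite -dintB; [by apply: eq_dint => x y; ring| |].
      by apply: L2_kernel => //; exact: bmf_cst.
    exact: L2_kernel.
  rewrite [X in X - _]dint12; last by apply: L2_kernel => //; exact: bmf_cst.
  rewrite [X in X - _](Rint_eq mu (g := cst 0)); last first.
    move=> x /=; have ix := integ_reflect x (L1b_integ dG1).
    rewrite (Rint_eq mu (g := fun y => a x * eta x * dxgauss i s (x - y))).
      by rewrite RintegralZl// (Rint_reflect x (L1b_integ dG1)) Rint_dxgauss// mulr0.
    by move=> y; rewrite mulr1.
  rewrite Rintegral_cst// mul0r sub0r; congr (- _).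
  rewrite dint_conv//; last exact: L1b_bmf.
  by apply: Rint_eq => x; rewrite -/phi1; ring.
have -> : dint (fun x y => a x * dxgauss i s (x - y) * ((1 - a y) * eta y)) =
    - \int[mu]_y ((1 - a y) * (phi1 y * eta y)).
  rewrite dint_conv21//; last by exact: bmfM.
  have iz : integ mu (fun y => (1 - a y) * (phi1 y * eta y)).
    apply: L1b_integ; apply: L1bMl => //; apply: L1bMr => //.
  rewrite -[RHS]mulN1r -(RintegralZl (-1) measurableT iz).
  apply: Rint_eq => y.
  have -> : \int[mu]_x (a x * dxgauss i s (x - y)) = - phi1 y.
    have iy := L1b_integ (L1b_conv_integrand y dG1 ba).
    rewrite -[RHS]mulN1r -(RintegralZl (-1) measurableT iy).
    by apply: Rint_eq => x; rewrite -(opprB y x) dxgauss_odd; ring.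
  by ring.
have i1 : integ mu (fun x => phi1 x * eta x) by apply: L1b_integ; exact: L1bMr.
have i2 : integ mu (fun x => a x * (phi1 x * eta x)).
  by apply: L1b_integ; apply: L1bMr => //; exact/L1b_bmf/L1bMr.
have -> : \int[mu]_y ((1 - a y) * (phi1 y * eta y)) =
    \int[mu]_x (phi1 x * eta x) - \int[mu]_x (a x * (phi1 x * eta x)).
  by rewrite -RintegralB//; apply: Rint_eq => x; ring.
rewrite (wdiff_ibp dphi deta phi_1 phi1_1 eta_1 eta1_1); ring.
Qed.

(** The quantity equals [- (N + B) / 2]. In [N] the derivative [eta1] is weighted by
    [a (1 - phi) + (1 - a) phi], of mass [2 * henergy a s]; in [B] the Lipschitz bound on [eta]
    pairs with the first moment of [dxgauss]. This is where the value 1/2 of the threshold comes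
    from. *)
Lemma energy_variation_bound (C : R) : 0 <= L ->
  (forall z, norm1 z * `|dxgauss i s z| <= C * gauss (2 * s) z) ->
  `|\int[mu]_x (a x * (phi x * eta1 x)) + \int[mu]_x (a x * (phi1 x * eta x))
    - 2^-1 * \int[mu]_x (a x * eta1 x)| <=
  L * C * henergy a (2 * s) + M1 * henergy a s.
Proof.
move=> L0 HC.
have bphi := L1b_bmf phi_1; have be1 := L1b_bmf eta1_1; have be := L1b_bmf eta_1.
have s20 : 0 < 2 * s by rewrite mulr_gt0.
have B_le : `|B| <= L * C * henergy a (2 * s).
  rewrite /henergy -dintZ; last exact: (L2_henergy ua s20).
  apply: dint_norm_le.
  - have := L2_mfun (L2B L2B1 L2B2); congr (mfun2 _).
    by apply/funext => x; apply/funext => y; ring.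
  - exact: L2Z (L2_henergy ua s20).
  - move=> x y; rewrite !normrM (ger0_norm (unit_ind_ge0 x ua)).
    rewrite (@ger0_norm _ (1 - a y)) ?subr_ge0 ?unit_ind_le1//.
    have e : `|dxgauss i s (x - y)| * `|eta x - eta y| <= L * C * gauss (2 * s) (x - y).
      apply: (@le_trans _ _ (`|dxgauss i s (x - y)| * (L * norm1 (x - y)))).
        by rewrite ler_wpM2l.
      by rewrite mulrCA -mulrA ler_wpM2l// mulrC.
    rewrite (_ : a x * _ * _ * _ = a x * (1 - a y) * (`|dxgauss i s (x - y)| * `|eta x - eta y|)); last by ring.
    rewrite (_ : L * C * _ = a x * (1 - a y) * (L * C * gauss (2 * s) (x - y))); last by ring.
    by rewrite ler_wpM2l// mulr_ge0 ?unit_ind_ge0// subr_ge0 unit_ind_le1.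
pose N := \int[mu]_x ((a x * (1 - phi x) + (1 - a x) * phi x) * eta1 x).
have b1phi := bmf_compl bphi.
have n1 : L1b (fun x => a x * (1 - phi x)) by exact: L1bMr.
have n2 : L1b (fun x => (1 - a x) * phi x) by exact: L1bMl.
have phi0 x : 0 <= phi x.
  by apply: Rintegral_ge0 => y _; rewrite mulr_ge0 ?gauss_ge0 ?unit_ind_ge0.
have phi_le1 x : phi x <= 1.
  rewrite -(Rint_gauss n s0) (le_trans (ler_norm _))//.
  apply: (@conv_bound _ _ _ (gauss s)).
  - exact: measurable_gauss.
  - by move=> z; rewrite ger0_norm ?gauss_ge0.
  - exact: integ_gauss.
  - exact: ba.1.
  - by move=> y; exact: unit_ind_norm.
have N_le : `|N| <= 2 * M1 * henergy a s.
  have e1 : \int[mu]_x (a x * (1 - phi x)) = henergy a s.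
    have ia : integ mu a by exact: L1b_integ.
    have ip : integ mu (fun x => a x * phi x) by apply: L1b_integ; exact: L1bMr.
    transitivity (\int[mu]_x a x - \int[mu]_x (a x * phi x)).
      by rewrite -RintegralB//; apply: Rint_eq => x; ring.
    by rewrite -dint_conv// -/(overlap a s) (overlapE ua s0); case: (ua) => _ _ ->; ring.
  have e2 : \int[mu]_x ((1 - a x) * phi x) = henergy a s.
    by rewrite -dint_conv//; exact: henergy_sym.
  have i12 := L1b_integ (L1bD n1 n2).
  have -> : 2 * M1 * henergy a s = \int[mu]_x (M1 * (a x * (1 - phi x) + (1 - a x) * phi x)).
    rewrite RintegralZl// RintegralD//; [|exact: L1b_integ|exact: L1b_integ].
    by rewrite e1 e2; ring.
  apply: Rint_norm_le; [|move=> x|exact: integZ].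
    by apply: measurable_funM; [exact: integ_measurable i12|exact: be1.1].
  have nn : 0 <= a x * (1 - phi x) + (1 - a x) * phi x.
    by apply: addr_ge0; apply: mulr_ge0; rewrite ?subr_ge0 ?(unit_ind_ge0 _ ua) ?(unit_ind_le1 _ ua).
  by rewrite normrM (ger0_norm nn) mulrC ler_wpM2r.
have i3 : integ mu (fun x => a x * (phi x * eta1 x)).
  by apply: L1b_integ; apply: L1bMr => //; exact: bmfM.
have i4 : integ mu (fun x => a x * eta1 x) by apply: L1b_integ; exact: L1bMr.
have i5 : integ mu (fun x => phi x * eta1 x) by apply: L1b_integ; exact: L1bMr.
have NE : N = \int[mu]_x (a x * eta1 x) + \int[mu]_x (phi x * eta1 x)
    - 2 * \int[mu]_x (a x * (phi x * eta1 x)).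
  rewrite -(RintegralZl 2 measurableT i3) -RintegralD// -(RintegralB measurableT (integD i4 i5) (integZ 2 i3)).
  by apply: Rint_eq => x; ring.
move: NE N_le B_le BE; set X1 := \int[mu]_x (a x * (phi x * eta1 x)).
set X2 := \int[mu]_x (a x * (phi1 x * eta x)).
set X3 := \int[mu]_x (a x * eta1 x); set X4 := \int[mu]_x (phi x * eta1 x).
move=> NE N_le B_le eB.
have -> : X1 + X2 - 2^-1 * X3 = - (2^-1 * N) - 2^-1 * B by rewrite NE eB; field.
rewrite (le_trans (ler_normB _ _))// normrN !normrM (@ger0_norm _ 2^-1)//.
have B0 := normr_ge0 B; lra.
Qed.

End fixed.
End step.

(** * The error of the convolution, controlled by the dissipation *)

Section dissipation.
Context {R : realType} {n : nat}.
Notation V := 'rV[R]_n.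
Notation mu := (@borel_lebesgue_rV R n).
Implicit Types (a p q u f g : V -> R) (x y z v : V) (i j : 'I_n) (r s t b : R).

Lemma kconv_gauss_semigroup s u x : 0 < s -> L1b u ->
  kconv (gauss (s / Num.sqrt 2)) (kconv (gauss (s / Num.sqrt 2)) u) x = kconv (gauss s) u x.
Proof.
move=> s0 u1; have h0 : 0 < s / Num.sqrt 2 by rewrite divr_gt0// sqrtr_gt0.
have s20 : 0 < s / 2 by rewrite divr_gt0.
have g1 := L1b_gauss (n := n) h0; have gx := L1b_reflect x g1.
rewrite {1}/kconv -(dint_conv (L1b_bmf gx) g1 u1) (dint_conv21 gx g1 (L1b_bmf u1)).
apply: Rint_eq => z; rewrite mulrC; congr (_ * _).
have i0 := L1b_integ (L1b_gauss (n := n) s20).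
have iP : integ mu (fun y => gauss (s / Num.sqrt 2) (x - z - y) * gauss (s / Num.sqrt 2) y).
  by apply: L1b_integ; apply: L1bMr; [exact: (L1b_reflect (x - z) g1)|exact: L1b_bmf].
transitivity (gauss s (x - z) * \int[mu]_y gauss (s / 2) (y - 2^-1 *: (x - z))); last first.
  by rewrite (Rint_shift (- (2^-1 *: (x - z))) i0) Rint_gauss// mulr1.
rewrite -(RintegralZl _ measurableT (integ_shift (- (2^-1 *: (x - z))) i0)).
rewrite -(Rint_eq mu (fun y => gauss_mul (x - z) y s0)).
rewrite -[RHS](Rint_shift (- z) iP); apply: Rint_eq => y.
by congr (gauss _ _ * _); rewrite opprB addrA subrK.
Qed.

Lemma kconv_gauss_selfadjoint s f g : 0 < s -> L1b f -> L1b g ->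
  \int[mu]_x (f x * kconv (gauss s) g x) = \int[mu]_x (g x * kconv (gauss s) f x).
Proof.
move=> s0 f1 g1; have G1 := L1b_gauss (n := n) s0.
rewrite -(dint_conv (L1b_bmf f1) G1 g1) (dint_conv21 f1 G1 (L1b_bmf g1)).
apply: Rint_eq => y; congr (_ * _); apply: Rint_eq => x.
by rewrite gauss_sym mulrC.
Qed.

Definition diss s u : R := \int[mu]_x (u x * kconv (gauss s) u x).

(* The semigroup property splits [gauss s] into two factors at scale [s / sqrt 2]. *)
Lemma diss_sqr s u : 0 < s -> L1b u ->
  diss s u = \int[mu]_x (kconv (gauss (s / Num.sqrt 2)) u x ^+ 2).
Proof.
move=> s0 u1; have h0 : 0 < s / Num.sqrt 2 by rewrite divr_gt0// sqrtr_gt0.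
have g1 := L1b_gauss (n := n) h0; have w1 := L1b_conv g1 u1.
rewrite [RHS](Rint_eq mu (fun x => expr2 _)) (kconv_gauss_selfadjoint h0 w1 u1).
by apply: Rint_eq => x; rewrite kconv_gauss_semigroup.
Qed.

Lemma diss_ge0 s u : 0 < s -> L1b u -> 0 <= diss s u.
Proof.
by move=> s0 u1; rewrite diss_sqr//; apply: Rintegral_ge0 => x _; exact: sqr_ge0.
Qed.

(** Both sides are the derivative of [kconv (gauss s) u], once directly and once after the semigroup
    property. *)
Lemma kconv_dxgauss_semigroup i s u : 0 < s -> L1b u ->
  kconv (dxgauss i s) u =
  kconv (dxgauss i (s / Num.sqrt 2)) (kconv (gauss (s / Num.sqrt 2)) u).
Proof.
move=> s0 u1; have h0 : 0 < s / Num.sqrt 2 by rewrite divr_gt0// sqrtr_gt0.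
have g1 := L1b_gauss (n := n) h0; have w1 := L1b_conv g1 u1.
apply: (@wdiff_unique _ _ i (kconv (gauss s) u)).
  by apply: L1diff_conv => //; [exact: L1diff_gauss|exact: L1b_gauss|exact: L1b_dxgauss].
have -> : kconv (gauss s) u = kconv (gauss (s / Num.sqrt 2)) (kconv (gauss (s / Num.sqrt 2)) u).
  by apply/funext => x; rewrite kconv_gauss_semigroup.
by apply: L1diff_conv => //; [exact: L1diff_gauss|exact: L1b_dxgauss].
Qed.

Section fixed.
Variables (a u : V -> R) (i : 'I_n) (s : R) (eta eta1 : V -> R) (kappa : R).
Hypotheses (ua : unit_ind a) (u1 : L1b u) (s0 : 0 < s).
Hypotheses (eta_1 : L1b eta) (eta1_1 : L1b eta1) (deta : wdiff i eta eta1).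
Let h := s / Num.sqrt 2.
Hypothesis k0 : 0 <= kappa.
Hypothesis Zbound : forall x z,
  `|eta1 x| * gauss h z + `|eta x| * `|dxgauss i h z| <= kappa * gauss (2 * h) z.

Let a1 : L1b a. Proof. by case: ua. Qed.
Let ba := L1b_bmf a1.
Let h0 : 0 < h. Proof. by rewrite divr_gt0// sqrtr_gt0. Qed.
Let h20 : 0 < 2 * h. Proof. by rewrite mulr_gt0. Qed.
Let g1 := L1b_gauss (n := n) h0.
Let dg1 := L1b_dxgauss i h0.
Let w := kconv (gauss h) u.
Let w1 : L1b w. Proof. exact: L1b_conv. Qed.
(** The derivative in [x] of [eta x * gauss h (x - y)]; its integral in [x] therefore vanishes. *)
Let Z x y := eta1 x * gauss h (x - y) + eta x * dxgauss i h (x - y).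

Let L2Za f : L1b f -> L2 (fun x y => f x * Z x y * w y).
Proof.
move=> f1.
have := L2D (L2_kernel (L1bMr f1 (L1b_bmf eta1_1)) g1 (L1b_bmf w1))
  (L2_kernel (L1bMr f1 (L1b_bmf eta_1)) dg1 (L1b_bmf w1)).
congr (L2 _); apply/funext => x; apply/funext => y; rewrite /Z; ring.
Qed.

Let L2Zb f : bmf f -> L2 (fun x y => f y * Z x y * w y).
Proof.
move=> bf; have fw := bmfM bf (L1b_bmf w1).
have := L2D (L2_kernel eta1_1 g1 fw) (L2_kernel eta_1 dg1 fw).
congr (L2 _); apply/funext => x; apply/funext => y; rewrite /Z; ring.
Qed.

Let X := \int[mu]_x (a x * (kconv (gauss s) u x * eta1 x)) +
  \int[mu]_x (a x * (kconv (dxgauss i s) u x * eta x)).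

(** Half of the kernel is moved onto [u], which yields [w]. Subtracting the term with [a y] changes
    nothing, because [Z] integrates to zero in [x], and it confines the integral to pairs separated
    by the set. *)
Let XE : X = dint (fun x y => (a x - a y) * Z x y * w y).
Proof.
have aeta1 := L1bMr a1 (L1b_bmf eta1_1); have aeta := L1bMr a1 (L1b_bmf eta_1).
have aw : bmf (fun y => a y * w y) by exact: bmfM ba (L1b_bmf w1).
have -> : X = dint (fun x y => a x * Z x y * w y).
  transitivity (dint (fun x y => (a x * eta1 x) * gauss h (x - y) * w y) +
      dint (fun x y => (a x * eta x) * dxgauss i h (x - y) * w y)); last first.
    rewrite -dintD; [|exact: (L2_kernel aeta1 g1 (L1b_bmf w1))|exact: (L2_kernel aeta dg1 (L1b_bmf w1))].
    by apply: eq_dint => x y; rewrite /Z; ring.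
  rewrite (dint_conv (L1b_bmf aeta1) g1 w1) (dint_conv (L1b_bmf aeta) dg1 w1).
  rewrite /X kconv_dxgauss_semigroup//; congr (_ + _); apply: Rint_eq => x.
    by rewrite /w /h kconv_gauss_semigroup//; ring.
  by rewrite -/h -/w; ring.
have E0 : dint (fun x y => a y * Z x y * w y) = 0.
  transitivity (dint (fun x y => eta1 x * gauss h (x - y) * (a y * w y)) +
      dint (fun x y => eta x * dxgauss i h (x - y) * (a y * w y))).
    rewrite -dintD; [|exact: (L2_kernel eta1_1 g1 aw)|exact: (L2_kernel eta_1 dg1 aw)].
    by apply: eq_dint => x y; rewrite /Z; ring.
  rewrite (dint_conv21 eta1_1 g1 aw) (dint_conv21 eta_1 dg1 aw).
  rewrite [X in X + _ = _](Rint_eq mu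
    (g := fun y => -1 * (a y * w y * \int[mu]_x (eta x * dxgauss i h (x - y))))).
    have iI : integ mu (fun y => a y * w y * \int[mu]_x (eta x * dxgauss i h (x - y))).
      have := L2_integ21 (L2_kernel eta_1 dg1 aw); congr (integ _ _); apply/funext => y.
      rewrite -RintegralZl//; first by apply: Rint_eq => x; rewrite mulrC.
      by apply: L1b_integ; apply: L1bMr => //; exact: (bmf_shift (- y) (L1b_bmf dg1)).
    by rewrite (RintegralZl (-1) measurableT iI) mulN1r addNr.
  move=> y; rewrite mulN1r -mulrN; congr (_ * _).
  have dgy := wdiff_shift (- y) (L1diff_wdiff (L1diff_gauss i h0)).
  have := wdiff_ibp deta dgy eta_1 eta1_1 (L1b_shift (- y) g1) (L1b_shift (- y) dg1).
  by move=> ->; rewrite opprK.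
rewrite -[LHS]subr0 -E0 -dintB; [|exact: L2Za|exact: L2Zb].
by apply: eq_dint => x y; ring.
Qed.

(** Cauchy-Schwarz with weight [gauss (2 * h) (x - y)]: since [a] is an indicator, the square of
    [a x - a y] is [a x (1 - a y) + (1 - a x) a y] and integrates to twice the energy, while the
    square of [w] integrates to [diss s u]. *)
Lemma dissipation_bound : X ^+ 2 <= 2 * kappa ^+ 2 * henergy a (2 * h) * diss s u.
Proof.
have G1 := L1b_gauss (n := n) h20.
have w2 : L1b (fun y => w y ^+ 2).
  by have := L1bMr w1 (L1b_bmf w1); congr (L1b _); apply/funext => y; rewrite expr2.
have W2 : L2 (fun x y => cst 1 x * gauss (2 * h) (x - y) * w y ^+ 2).
  exact: (L2_kernel' (bmf_cst 1) G1 w2).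
have DE : dint (fun x y => cst 1 x * gauss (2 * h) (x - y) * w y ^+ 2) = diss s u.
  rewrite dint21// (diss_sqr s0 u1); apply: Rint_eq => y.
  rewrite (Rint_eq mu (g := fun x => w y ^+ 2 * gauss (2 * h) (x - y))); last first.
    by move=> x /=; ring.
  rewrite RintegralZl//; last exact: (integ_shift (- y) (L1b_integ G1)).
  by rewrite (Rint_shift (- y) (L1b_integ G1)) Rint_gauss// mulr1.
have H1 := L2_henergy ua h20.
have H2 : L2 (fun x y => (1 - a x) * gauss (2 * h) (x - y) * a y).
  by apply: L2_kernel' => //; exact: bmf_compl.
have F0 := henergy_ge0 ua (2 * h).
have D0 := diss_ge0 s0 u1.
rewrite -[X ^+ 2]sqr_normr.
rewrite (_ : 2 * kappa ^+ 2 * _ * _ =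
  4 * (kappa * henergy a (2 * h)) * (kappa / 2 * diss s u)); last by field.
apply: sqr_le_of_amgm => //; [exact: mulr_ge0|by rewrite !mulr_ge0|].
move=> t t0.
have L2T : L2 (fun x y => kappa * (t / 2 * (a x * gauss (2 * h) (x - y) * (1 - a y)
      + (1 - a x) * gauss (2 * h) (x - y) * a y)
    + (2 * t)^-1 * (cst 1 x * gauss (2 * h) (x - y) * w y ^+ 2))).
  by apply: L2Z; apply: L2D; [apply: L2Z; exact: L2D|exact: L2Z].
have -> : t * (kappa * henergy a (2 * h)) + kappa / 2 * diss s u / t =
  dint (fun x y => kappa * (t / 2 * (a x * gauss (2 * h) (x - y) * (1 - a y)
      + (1 - a x) * gauss (2 * h) (x - y) * a y)
    + (2 * t)^-1 * (cst 1 x * gauss (2 * h) (x - y) * w y ^+ 2))).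
  rewrite dintZ; last by apply: L2D; [apply: L2Z; exact: L2D|exact: L2Z].
  rewrite dintD; [|by apply: L2Z; exact: L2D|exact: L2Z].
  rewrite dintZ; last exact: L2D.
  rewrite dintD// dintZ// DE henergy_sym// -/(henergy a (2 * h)).
  by field; rewrite gt_eqF.
rewrite XE; apply: dint_norm_le => //.
  have := L2_mfun (L2B (L2Za a1) (L2Zb ba)); congr (mfun2 _).
  by apply/funext => x; apply/funext => y; ring.
move=> x y; rewrite !normrM.
have Zle : `|Z x y| <= kappa * gauss (2 * h) (x - y).
  apply: le_trans (Zbound x (x - y)); rewrite (le_trans (ler_normD _ _))//.
  by rewrite lerD// normrM// ler_wpM2l// ger0_norm// gauss_ge0.
set q := gauss (2 * h) (x - y) in Zle *.
have q0 : 0 <= q by exact: gauss_ge0.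
apply: (@le_trans _ _ (`|a x - a y| * (kappa * q) * `|w y|)).
  by rewrite ler_wpM2r// ler_wpM2l.
rewrite [leLHS](_ : _ = kappa * (q * (`|a x - a y| * `|w y|))); last by ring.
rewrite ler_wpM2l//.
rewrite [leRHS](_ : _ = q * (t / 2 * (a x * (1 - a y) + (1 - a x) * a y)
   + (2 * t)^-1 * w y ^+ 2)); last first.
  by rewrite /= -/q; field; rewrite gt_eqF.
rewrite ler_wpM2l//.
have -> : a x * (1 - a y) + (1 - a x) * a y = `|a x - a y| ^+ 2.
  case: (ua) => _ ai _; case: (ai x) => ->; case: (ai y) => ->;
    by rewrite sqr_normr; ring.
move: (normr_ge0 (a x - a y)) (normr_ge0 (w y)); rewrite -(sqr_normr (w y)).
move: `|a x - a y| `|w y| => A W A0 W0.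
have -> : t / 2 * A ^+ 2 + (2 * t)^-1 * W ^+ 2 = A * W + (t * A - W) ^+ 2 / (2 * t).
  by field; rewrite gt_eqF.
by rewrite lerDl divr_ge0 ?sqr_ge0// mulr_ge0// ltW.
Qed.

End fixed.
End dissipation.

(** * Nondegeneracy of the test integral and the estimate of one threshold *)

Section step_estimate.
Context {R : realType} {n : nat}.
Notation V := 'rV[R]_n.
Notation mu := (@borel_lebesgue_rV R n).
Implicit Types (a p q u f g : V -> R) (x y z v : V) (i j : 'I_n) (r s t b : R).

(** The derivative in direction [i] of the [i]-th component of the field, hence a single summand of
    the divergence. *)
Definition divKx i r z : R := r^-1 * kscale r (Kxx i i) z.

Lemma L1b_divKx i r : 0 < r -> L1b (divKx i r).
Proof. by move=> r0; exact: L1bZ (kscale_L1b r0 (measurable_Kxx i i) (kernel_dom_Kxx i i)). Qed.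

Lemma L1b_Kx i r : 0 < r -> L1b (kscale r (Kx i)).
Proof. by move=> r0; exact: kscale_L1b r0 (measurable_Kx i) (kernel_dom_Kx i). Qed.

Lemma doverlapE a r : unit_ind a -> 0 < r ->
  doverlap a r = - 2 * \sum_i \int[mu]_x (a x * kconv (divKx i r) a x).
Proof.
move=> ua r0; have a1 : L1b a by case: ua.
have ba := L1b_bmf a1.
have H i : L2 (fun x y => a x * divKx i r (x - y) * a y).
  exact: L2_kernel a1 (L1b_divKx i r0) ba.
transitivity (dint (fun x y => -2 * \sum_i (a x * divKx i r (x - y) * a y))).
  apply: eq_dint => x y; rewrite /dgauss !mulr_sumr mulr_suml; apply: eq_bigr => i _.
  by rewrite /divKx; ring.
have S : \int[(mu \x mu)%E]_w (\sum_i unc (fun x y => a x * divKx i r (x - y) * a y) w) =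
   \sum_i \int[mu]_x (a x * kconv (divKx i r) a x).
  rewrite Rint_sum; last by move=> i; exact: L2_integ (H i).
  by apply: eq_bigr => i _; exact: (dint_conv ba (L1b_divKx i r0) a1).
have iS : integ (mu \x mu)%E (fun w => \sum_i unc (fun x y => a x * divKx i r (x - y) * a y) w).
  by apply: integ_sum => i; exact: L2_integ (H i).
by rewrite -S -(RintegralZl (-2) measurableT iS).
Qed.

(** The kernel is at most its peak, which is below 1/4 at such scales, and [a x * a y] has total
    mass one. In dimension zero the peak would be 1. *)
Lemma overlap_le a t : (0 < n)%N -> unit_ind a -> 4 <= t -> overlap a t <= 4^-1.
Proof.
move=> n0 ua t4; have a1 : L1b a by case: ua.
have t0 : 0 < t by apply: lt_le_trans t4.
have ia := L1b_integ a1.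
have E : dint (fun x y => 4^-1 * (a x * a y)) = 4^-1.
  rewrite dintZ; last exact: L2_prod.
  rewrite dint12; last exact: L2_prod.
  rewrite (Rint_eq mu (g := a)); first by case: (ua) => _ _ ->; rewrite mulr1.
  by move=> x; rewrite RintegralZl//; case: (ua) => _ _ ->; rewrite mulr1.
rewrite -E; apply: le_Rintegral => //.
- exact: L2_integ (L2_overlap ua t0).
- exact: L2_integ (L2Z _ (L2_prod a1 a1)).
move=> [x y] _; rewrite /unc /= mulrAC mulrC ler_wpM2r ?mulr_ge0 ?(unit_ind_ge0 _ ua)//.
apply: (le_trans (gauss_le_peak _ _)); rewrite sqrt_peak//.
have p1 : 1 <= Num.sqrt (4 * pi) :> R.
  rewrite -[leLHS]sqrtr1 ler_wsqrtr//; have := @pi_ge2 R; lra.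
have p4 : (t * Num.sqrt (4 * pi))^-1 <= 4^-1.
  rewrite lef_pV2 ?posrE ?mulr_gt0 ?(lt_le_trans _ p1)//.
  by rewrite (le_trans t4)// ler_peMr// ltW.
have p0 : 0 <= (t * Num.sqrt (4 * pi))^-1 by rewrite invr_ge0 mulr_ge0 ?sqrtr_ge0 ?ltW.
case: (n) n0 => // k _; rewrite exprS; apply: (le_trans _ p4).
by rewrite ler_piMr// exprn_ile1// (le_trans p4)//; lra.
Qed.

(** The overlap drops by at least 1/2 on an interval of length less than 4, so at some scale its
    derivative is at most -1/8 and the [n] integrals sum to at least 1/16. The extra factor 2 in 32
    leaves the pigeonhole argument some room. *)
Lemma choose_direction a s : (0 < n)%N -> unit_ind a -> 0 < s -> henergy a s <= 4^-1 ->
  exists i r, s <= r /\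
    (32 * n%:R)^-1 <= \int[mu]_x (a x * kconv (divKx i r) a x).
Proof.
move=> n0 ua s0 Hs.
have Os : 3 / 4 <= overlap a s by rewrite overlapE//; lra.
have s4 : s < 4.
  by rewrite ltNge; apply/negP => /(overlap_le n0 ua); lra.
have O4 := overlap_le n0 ua (lexx 4).
have [c /andP[sc c4] E] := overlap_mvt ua s0 s4.
have c0 : 0 < c := lt_trans s0 sc.
rewrite doverlapE// in E.
set S := \sum_i _ in E.
have S16 : 16^-1 <= S.
  move: E Os O4; move: (overlap a 4) (overlap a s) S => o4 os S E Os O4.
  by clear -E Os O4 s0 s4; nra.
have nR : 0 < n%:R :> R by rewrite ltr0n.
have [i Hi] : exists i, (32 * n%:R)^-1 <= \int[mu]_x (a x * kconv (divKx i c) a x).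
  apply: contrapT => /forallNP H.
  have : S <= \sum_(i < n) (32 * n%:R)^-1.
    by apply: ler_sum => i _; rewrite leNgt; apply/negP => /ltW; exact: H.
  rewrite sumr_const card_ord -[_ *+ n]mulr_natr invfM -mulrA mulVf ?gt_eqF// => S32.
  by clear -S16 S32; lra.
by exists i, c; split => //; exact: ltW.
Qed.

Lemma uniform_const (P : 'I_n -> R -> Prop) :
  (forall i c c', c <= c' -> P i c -> P i c') ->
  (forall i, exists2 c : R, 0 <= c & P i c) ->
  exists2 c : R, 0 <= c & forall i, P i c.
Proof.
move=> Pmono H; pose c i := sval (cid2 (H i)).
have c0 i : 0 <= c i by rewrite /c; case: cid2.
have cP i : P i (c i) by rewrite /c; case: cid2.
exists (\sum_i c i); first exact: sumr_ge0.
by move=> i; apply: Pmono (cP i); rewrite (bigD1 i)//= lerDl sumr_ge0.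
Qed.

Definition kernel_bounds (i : 'I_n) (C : R) : Prop := forall s z, 0 < s ->
  [/\ `|kscale s (Kx i) z| <= C * gauss (2 * s) z,
      `|kscale s (Kxx i i) z| <= C * gauss (2 * s) z,
      forall v b, 0 <= b <= s -> (forall j, `|v ord0 j| <= b) ->
        `|kscale s (Kx i) (z + v) - kscale s (Kx i) z| <= C * (b / s) * gauss (2 * s) z,
      `|dxgauss i s z| <= C / s * gauss (2 * s) z &
      norm1 z * `|dxgauss i s z| <= C * gauss (2 * s) z].

Lemma kernel_bounds_uniform : exists2 C : R, 0 <= C & forall i, kernel_bounds i C.
Proof.
apply: uniform_const.
  move=> i c c' cc H s z s0; have [h1 h2 h3 h4 h5] := H s z s0.
  have g0 := @gauss_ge0 R n (2 * s) z.
  have mono k : 0 <= k -> c * k * gauss (2 * s) z <= c' * k * gauss (2 * s) z.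
    by move=> k0; rewrite !ler_wpM2r.
  have mono1 := mono 1 ler01; rewrite !mulr1 in mono1.
  split; [exact: le_trans h1 mono1|exact: le_trans h2 mono1| | |exact: le_trans h5 mono1].
  - move=> v b bs vb; apply: (le_trans (h3 v b bs vb)); apply: mono.
    by case/andP: bs => b0 _; rewrite divr_ge0// ltW.
  - by apply: (le_trans h4); apply: mono; rewrite invr_ge0 ltW.
move=> i.
have [c1 c10 h1] := kscale_bound (@kernel_dom_Kx R n i).
have [c2 c20 h2] := kscale_bound (@kernel_dom_Kxx R n i i).
have [c3 c30 h3] := kscale_lip (@kernel_lip_Kx R n i).
have [c4 c40 h4] := @dxgauss_bound R n i.
exists (c1 + c2 + c3 + c4); first by rewrite !addr_ge0.
move=> s z s0; have g0 := @gauss_ge0 R n (2 * s) z.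
have mono c k : 0 <= k -> c <= c1 + c2 + c3 + c4 ->
    c * k * gauss (2 * s) z <= (c1 + c2 + c3 + c4) * k * gauss (2 * s) z.
  by move=> k0 cc; rewrite !ler_wpM2r.
have mono1 c := mono c 1 ler01.
have [h5 h6] := h4 s z s0.
split.
- by apply: (le_trans (h1 s z s0)); have := mono1 c1; rewrite !mulr1; apply; lra.
- by apply: (le_trans (h2 s z s0)); have := mono1 c2; rewrite !mulr1; apply; lra.
- move=> v b bs vb; apply: (le_trans (h3 s z v b s0 bs vb)); apply: mono; last by lra.
  by case/andP: bs => b0 _; rewrite divr_ge0// ltW.
- by apply: (le_trans h5); apply: mono; [rewrite invr_ge0 ltW|lra].
- by apply: (le_trans h6); have := mono1 c4; rewrite !mulr1; apply; lra.
Qed.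

Lemma kconv_norm_le C q k f x : 0 <= C -> measurable_fun setT q ->
  (forall z, `|q z| <= C * k z) -> integ mu k -> \int[mu]_z k z = 1 ->
  measurable_fun setT f -> (forall y, `|f y| <= 1) -> `|kconv q f x| <= C.
Proof.
move=> C0 mq qk ik k1 mf f1; have iCk := integZ C ik.
by rewrite (le_trans (conv_bound x mq qk iCk mf f1))// RintegralZl// k1 mulr1.
Qed.

(** The kernel is only Lipschitz for displacements up to [r]; for longer ones the sup bound gives
    [2 * C], which is less than [2 * C / r] times the displacement. *)
Lemma kconv_kscale_lip q a r C : unit_ind a -> 0 < r -> 0 <= C ->
  measurable_fun setT q -> (forall z, `|kscale r q z| <= C * gauss (2 * r) z) ->
  (forall z v b, 0 <= b <= r -> (forall j, `|v ord0 j| <= b) ->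
    `|kscale r q (z + v) - kscale r q z| <= C * (b / r) * gauss (2 * r) z) ->
  forall x y, `|kconv (kscale r q) a x - kconv (kscale r q) a y|
    <= 2 * C / r * norm1 (x - y).
Proof.
move=> ua r0 C0 mq qC qL x y; have a1 : L1b a by case: ua.
have ba := L1b_bmf a1.
have r20 : 0 < 2 * r by rewrite mulr_gt0.
have mK := measurable_kscale r mq.
have K1 : L1b (kscale r q) by apply: (L1b_le mK qC); apply: L1bZ; exact: L1b_gauss.
have ig := integ_gauss n r20.
set b := norm1 (x - y); have b0 : 0 <= b by exact: norm1_ge0.
have [br|rb] := leP b r.
  apply: (@le_trans _ _ (C * (b / r))); last first.
    have Cbr : 0 <= C * (b / r) by rewrite mulr_ge0// divr_ge0// ltW.
    by rewrite (_ : 2 * C / r * b = 2 * (C * (b / r))); [lra|ring].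
  have ix := L1b_integ (L1b_conv_integrand x K1 ba).
  have iy := L1b_integ (L1b_conv_integrand y K1 ba).
  rewrite /kconv -RintegralB//.
  have igy := integ_reflect y ig.
  rewrite -[leRHS]mulr1.
  rewrite [X in _ * X](_ : 1 = \int[mu]_w gauss (2 * r) (y - w)); last first.
    by rewrite (Rint_reflect y ig) Rint_gauss.
  rewrite -(RintegralZl _ measurableT igy).
  apply: Rint_norm_le; last exact: integZ.
    exact: integ_measurable (integB ix iy).
  move=> w; rewrite -mulrBl normrM -[leRHS]mulr1 ler_pM//; last exact: unit_ind_norm.
  have := qL (y - w) (x - y) b; rewrite b0 br => /(_ isT).
  rewrite (_ : y - w + (x - y) = x - w); last by rewrite addrC addrA subrK.
  by apply=> j; exact: ler_norm1.
have le1 z : `|kconv (kscale r q) a z| <= C.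
  apply: (kconv_norm_le z C0 mK qC ig (Rint_gauss n r20) ba.1).
  by move=> w; exact: unit_ind_norm.
rewrite (le_trans (ler_normB _ _))// (le_trans (lerD (le1 x) (le1 y)))//.
have br1 : 1 <= b / r by rewrite ler_pdivlMr// mul1r ltW.
have Cbr : C <= C * (b / r) by rewrite ler_peMr.
by rewrite (_ : 2 * C / r * b = 2 * (C * (b / r))); [lra|ring].
Qed.

Lemma sqr_lower_bound (x c I b : R) : 0 < c -> c <= I -> x * I = b ->
  x ^+ 2 * c ^+ 2 <= b ^+ 2.
Proof.
move=> c0 cI <-; rewrite exprMn ler_wpM2l ?sqr_ge0// lerXn2r ?nnegrE ?(ltW c0)//.
by rewrite (le_trans (ltW c0)).
Qed.

Lemma kconv_kscale_lipP q a r : unit_ind a -> 0 < r ->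
  measurable_fun setT q -> kernel_dom q -> kernel_lip q ->
  exists2 L : R, 0 <= L & forall x y,
    `|kconv (kscale r q) a x - kconv (kscale r q) a y| <= L * norm1 (x - y).
Proof.
move=> ua r0 mq dq lq; have [c c0 hc] := kscale_bound dq; have [d d0 hd] := kscale_lip lq.
have cd0 : 0 <= c + d by exact: addr_ge0.
exists (2 * (c + d) / r); first by rewrite divr_ge0 ?mulr_ge0// ltW.
apply: kconv_kscale_lip => //.
- by move=> z; rewrite (le_trans (hc r z r0))// ler_wpM2r ?gauss_ge0// lerDl.
- move=> z v b bs vb; rewrite (le_trans (hd r z v b r0 bs vb))// ler_wpM2r ?gauss_ge0//.
  by case/andP: bs => b0 _; rewrite ler_wpM2r ?lerDr// divr_ge0// ltW.
Qed.

Lemma step_estimate : (0 < n)%N -> exists2 C : R, 0 < C &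
  forall a a' (lambda s E : R), unit_ind a -> unit_ind a' -> 0 < s -> 0 < E ->
    a' = \1_[set x | lambda < kconv (gauss s) a x] ->
    henergy a' s <= E * s -> 8 * s * E <= 1 ->
    (lambda - 2^-1) ^+ 2 <=
      C * (s ^+ 2 * E ^+ 4 + E / s * diss s (fun x => a x - a' x)).
Proof.
move=> n0; have [C C0 HC] := kernel_bounds_uniform.
have nR : 0 < n%:R :> R by rewrite ltr0n.
pose c0 : R := (32 * n%:R)^-1.
have c00 : 0 < c0 by rewrite invr_gt0 mulr_gt0.
(* [CA] collects the two terms of [energy_variation_bound] after [r^-1 <= 8 * E]; [CT / s] will
   bound the kernel [Z] of [dissipation_bound], the power of 2 being the price of doubling the
   width. *)
pose CA := 8 * (4 * C ^+ 2 + C); pose CT := 2 * (C * 2 ^+ n + C ^+ 2).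
have CA0 : 0 <= CA by rewrite mulr_ge0// addr_ge0// mulr_ge0// sqr_ge0.
have CT0 : 0 <= CT by rewrite mulr_ge0// addr_ge0 ?mulr_ge0 ?exprn_ge0 ?sqr_ge0.
pose CD := 2 * CT ^+ 2 * (2 ^+ n * 2).
have CD0 : 0 <= CD by apply: mulr_ge0; apply: mulr_ge0 => //; rewrite ?sqr_ge0 ?exprn_ge0.
exists (2 * (CA ^+ 2 + CD + 1) / c0 ^+ 2).
  by rewrite divr_gt0 ?exprn_gt0// mulr_gt0// ltr_wpDl// addr_ge0// sqr_ge0.
move=> a a' lambda s E ua ua' s0 E0 a'E HE sE1.
have a1 : L1b a by case: ua.
have a'1 : L1b a' by case: ua'.
have ba := L1b_bmf a1; have ba' := L1b_bmf a'1.
have sE0 : 0 < s * E by rewrite mulr_gt0.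
(* With [m] the integer part of [q], [m * E * s <= 1/4] as [choose_direction] demands. Since
   [q >= 2], also [m >= 1] and [q <= 2 * m], whence [r^-1 <= (m * s)^-1 <= 8 * E]. *)
pose q := (4 * (s * E))^-1.
have q4 : 0 < 4 * (s * E) by rewrite mulr_gt0.
have q2 : 2 <= q by rewrite -[q]mul1r ler_pdivlMr//; clear -sE1; lra.
have q0 : 0 <= q by exact: le_trans q2.
have /andP[mq qm] := truncn_itv q0; set m := Num.truncn q in mq qm.
rewrite -natr1 in qm.
have m1 : (0 < m)%N by rewrite lt0n; apply/negP => /eqP m0; rewrite m0 in qm; clear -qm q2; lra.
have mR : 1 <= m%:R :> R by rewrite ler1n.
have ms0 : 0 < m%:R * s by rewrite mulr_gt0// ltr0n.
have qE : q * (4 * (s * E)) = 1 by rewrite mulVf// gt_eqF// mulr_gt0.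
have H4 : henergy a' (m%:R * s) <= 4^-1.
  apply: (le_trans (henergy_dilate ua' s0 m1)).
  have t1 : m%:R * henergy a' s <= m%:R * (E * s) by rewrite ler_wpM2l.
  have t2 : m%:R * (E * s) <= q * (E * s) by rewrite ler_wpM2r// mulr_ge0 ?(ltW E0) ?(ltW s0).
  by apply: (le_trans t1); apply: (le_trans t2); clear -qE; lra.
have [i [r [rms Hc]]] := choose_direction n0 ua' ms0 H4.
rewrite -/c0 in Hc.
have r0 : 0 < r := lt_le_trans ms0 rms.
have sr : s <= r by rewrite (le_trans _ rms)// ler_peMl// ltW.
have rE : r^-1 <= 8 * E.
  have h1 : 1 <= 8 * E * (m%:R * s).
    have qm2 : q <= 2 * m%:R by clear -qm mR; lra.
    by clear -qm2 qE sE0; nra.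
  rewrite -[leLHS]mul1r ler_pdivrMr//; apply: (le_trans h1).
  by rewrite ler_wpM2l// mulr_ge0// ltW.
pose eta := kconv (kscale r (Kx i)) a'; pose eta1 := kconv (divKx i r) a'.
have eta_1 : L1b eta by apply: L1b_conv => //; exact: L1b_Kx.
have eta1_1 : L1b eta1 by apply: L1b_conv => //; exact: L1b_divKx.
have deta : wdiff i eta eta1.
  apply: L1diff_conv => //; [|exact: L1b_Kx|exact: L1b_divKx].
  exact: kscale_L1diff r0 (kernel_diff_Kx i i).
have r20 : 0 < 2 * r by rewrite mulr_gt0.
have ig := integ_gauss n r20.
have a'n y : `|a' y| <= 1 := unit_ind_norm y ua'.
have etaC x : `|eta x| <= C.
  apply: (kconv_norm_le x C0 (measurable_kscale r (measurable_Kx i)) _ ig (Rint_gauss n r20) ba'.1) => //.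
  by move=> w; have [] := HC i r w r0.
have eta1C x : `|eta1 x| <= C / r.
  apply: (kconv_norm_le x _ _ _ ig (Rint_gauss n r20) ba'.1) => //.
  - by rewrite divr_ge0// ltW.
  - exact: (L1b_bmf (L1b_divKx i r0)).1.
  - move=> w; rewrite /divKx normrM gtr0_norm ?invr_gt0// (mulrC C) -mulrA.
    by rewrite ler_wpM2l ?invr_ge0 ?(ltW r0)//; have [] := HC i r w r0.
have L0 : 0 <= 2 * C / r by rewrite divr_ge0 ?mulr_ge0// ltW.
have etaL : forall x y, `|eta x - eta y| <= 2 * C / r * norm1 (x - y).
  apply: kconv_kscale_lip => //; first exact: measurable_Kx.
    by move=> z; have [] := HC i r z r0.
  by move=> z v b bs vb; have [_ _ h _ _] := HC i r z r0; exact: h.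
have HA := energy_variation_bound ua' s0 eta_1 eta1_1 deta eta1C etaL
  L0 (fun z => let: And5 _ _ _ _ h := HC i s z s0 in h).
pose u x := a x - a' x.
have u1 : L1b u by exact: L1bB.
pose h := s / Num.sqrt 2.
have q2p : 0 < Num.sqrt 2 :> R by rewrite sqrtr_gt0.
have q2s : Num.sqrt 2 ^+ 2 = 2 :> R by rewrite sqr_sqrtr.
have q2_2 : Num.sqrt 2 <= 2 :> R by clear -q2p q2s; nra.
have q2_1 : 1 <= Num.sqrt 2 :> R by clear -q2p q2s; nra.
have h0 : 0 < h by rewrite divr_gt0.
have hs : h <= s by rewrite ler_pdivrMr// ler_peMr// ltW.
have hV : h^-1 <= 2 / s.
  by rewrite /h invf_div ler_pM2r ?invr_gt0.
pose kappa := CT / s.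
have kappa0 : 0 <= kappa by rewrite divr_ge0// ltW.
have Zb x z : `|eta1 x| * gauss h z + `|eta x| * `|dxgauss i h z| <= kappa * gauss (2 * h) z.
  have g0 := @gauss_ge0 R n (2 * h) z.
  have gh : gauss h z <= 2 ^+ n * gauss (2 * h) z.
    have hh : h <= 2 * h by clear -h0; lra.
    by have := gauss_widen z h0 hh; rewrite mulfK// gt_eqF.
  have [_ _ _ dx _] := HC i h z h0.
  have e1 : `|eta1 x| * gauss h z <= (C / r) * (2 ^+ n * gauss (2 * h) z).
    by apply: ler_pM => //; exact: gauss_ge0.
  have e2 : `|eta x| * `|dxgauss i h z| <= C * (C / h * gauss (2 * h) z).
    exact: ler_pM.
  have e3 : C / r * (2 ^+ n * gauss (2 * h) z) <= 2 * (C * 2 ^+ n) / s * gauss (2 * h) z.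
    rewrite mulrA ler_wpM2r//.
    have : r^-1 <= s^-1 by rewrite lef_pV2.
    have : 0 <= s^-1 by rewrite invr_ge0 ltW.
    have c2n : 0 <= C * 2 ^+ n by rewrite mulr_ge0// exprn_ge0.
    move=> si rs.
    rewrite (_ : C / r * 2 ^+ n = C * 2 ^+ n * r^-1); last by ring.
    rewrite (_ : 2 * (C * 2 ^+ n) / s = C * 2 ^+ n * (2 * s^-1)); last by ring.
    by rewrite ler_wpM2l//; clear -si rs; lra.
  have e4 : C * (C / h * gauss (2 * h) z) <= 2 * C ^+ 2 / s * gauss (2 * h) z.
    rewrite mulrA ler_wpM2r//.
    rewrite (_ : C * (C / h) = C ^+ 2 * h^-1); last by ring.
    rewrite (_ : 2 * C ^+ 2 / s = C ^+ 2 * (2 / s)); last by ring.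
    by rewrite ler_wpM2l// sqr_ge0.
  rewrite /kappa /CT (_ : 2 * _ / s * _ = 2 * (C * 2 ^+ n) / s * gauss (2 * h) z +
    2 * C ^+ 2 / s * gauss (2 * h) z); last by ring.
  by rewrite lerD// (le_trans e1, le_trans e2).
have HT := dissipation_bound ua' u1 s0 eta_1 eta1_1 deta kappa0 Zb.
pose phi := kconv (gauss s) a; pose phi1 := kconv (dxgauss i s) a.
have G1 := L1b_gauss (n := n) s0; have dG1 := L1b_dxgauss i s0.
have phi_1 : L1b phi by exact: L1b_conv.
have phi1_1 : L1b phi1 by exact: L1b_conv.
have dphi : wdiff i phi phi1 by apply: L1diff_conv => //; exact: L1diff_gauss.
have a'2 : L1b (\1_[set x | lambda < phi x] : V -> R) by rewrite -a'E.
have EL := level_set_ibp a'2 (L1b_bmf phi_1) (L1b_bmf phi1_1) (L1b_bmf eta_1)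
  (L1b_bmf eta1_1) dphi deta.
rewrite -a'E in EL.
move: HA HT.
set A := _ + _ - _ => HA; set X := _ + _ => HT.
have split1 f k : L1b f -> L1b k ->
   \int[mu]_x (a' x * (kconv k a x * f x)) =
   \int[mu]_x (a' x * (kconv k a' x * f x)) + \int[mu]_x (a' x * (kconv k u x * f x)).
  move=> f1 k1; rewrite -RintegralD//.
  - apply: Rint_eq => x; rewrite (convB x k1 ba ba'); ring.
  - apply: L1b_integ; apply: L1bMr => //; apply: bmfM; last exact: L1b_bmf.
    exact/L1b_bmf/L1b_conv.
  - apply: L1b_integ; apply: L1bMr => //; apply: bmfM; last exact: L1b_bmf.
    exact/L1b_bmf/L1b_conv.
set I1 := \int[mu]_x (a' x * eta1 x) in EL Hc A HA.
have alg (b1 b2 b3 b4 b5 : R) : (b1 + b2) + (b3 + b4) - b5 = (b1 + b3 - b5) + (b2 + b4).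
  by ring.
(* In the Euler-Lagrange identity [a] is written as [a' + u]: the part with [a'], minus half of
   [I1], is [A], and the part with [u] is [X]. *)
have key : (lambda - 2^-1) * I1 = A + X.
  rewrite mulrBl EL /A /X (split1 eta1 (gauss s))// (split1 eta (dxgauss i s))//.
have H2s : henergy a' (2 * s) <= 2 * (E * s).
  have := henergy_dilate ua' s0 (isT : (0 < 2)%N).
  by move=> hd; apply: (le_trans hd); rewrite ler_wpM2l.
have A2 : A ^+ 2 <= CA ^+ 2 * (s ^+ 2 * E ^+ 4).
  have : `|A| <= CA * (s * E ^+ 2).
    apply: (le_trans HA).
    have F0 := henergy_ge0 ua' s; have F20 := henergy_ge0 ua' (2 * s).
    have t1 : 2 * C / r * C * henergy a' (2 * s) <= 2 * C ^+ 2 * (8 * E) * (2 * (E * s)).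
      apply: ler_pM; [by rewrite mulr_ge0|exact: F20| |exact: H2s].
      rewrite (_ : 2 * C / r * C = 2 * C ^+ 2 * r^-1); last by ring.
      by rewrite ler_wpM2l// mulr_ge0// sqr_ge0.
    have t2 : C / r * henergy a' s <= C * (8 * E) * (E * s).
      apply: ler_pM; [by rewrite divr_ge0// ltW|exact: F0| |exact: HE].
      by rewrite ler_wpM2l.
    apply: (le_trans (lerD t1 t2)); rewrite /CA le_eqVlt; apply/orP; left; apply/eqP.
    by ring.
  move=> hA; rewrite -[A ^+ 2]sqr_normr.
  rewrite (_ : CA ^+ 2 * _ = (CA * (s * E ^+ 2)) ^+ 2); last by ring.
  by rewrite ler_sqr ?nnegrE// mulr_ge0// mulr_ge0 ?exprn_ge0 ?ltW.
have D0 : 0 <= diss s u := diss_ge0 s0 u1.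
have X2 : X ^+ 2 <= CD * (E / s * diss s u).
  apply: (le_trans HT).
  have Hh : henergy a' (2 * h) <= 2 ^+ n * (2 * (E * s)).
    have h20 : 0 < 2 * h by rewrite mulr_gt0.
    have hs2 : 2 * h <= 2 * s by rewrite ler_pM2l.
    apply: (le_trans (henergy_widen ua' h20 hs2)).
    apply: ler_pM => //; [by rewrite exprn_ge0// divr_ge0 ?mulr_ge0 ?ltW|exact: henergy_ge0|].
    have s2h : s <= 2 * h by rewrite /h mulrA ler_pdivlMr// mulrC ler_pM2r.
    rewrite lerXn2r ?nnegrE//; first by apply: divr_ge0; apply: mulr_ge0; rewrite ?ltW.
    by rewrite ler_pdivrMr// ler_pM2l.
  rewrite /CD /kappa.
  rewrite (_ : 2 * CT ^+ 2 * _ * _ =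
    2 * (CT / s) ^+ 2 * (2 ^+ n * (2 * (E * s))) * diss s u); last by field; rewrite gt_eqF.
  by rewrite ler_wpM2r// ler_wpM2l// mulr_ge0// sqr_ge0.
have AX : (A + X) ^+ 2 <= 2 * (A ^+ 2 + X ^+ 2).
  move: A X {HA HT EL key A2 X2} => A X; have := sqr_ge0 (A - X); clear; nra.
have c2 := sqr_lower_bound c00 Hc key.
rewrite mulrAC ler_pdivlMr ?exprn_gt0//.
apply: (le_trans c2); apply: (le_trans AX).
have P1 : 0 <= s ^+ 2 * E ^+ 4 by rewrite mulr_ge0 ?sqr_ge0// exprn_ge0 ?ltW.
have P2 : 0 <= E / s * diss s u by rewrite mulr_ge0// divr_ge0 ?ltW.
rewrite -[leRHS]mulrA; apply: ler_wpM2l => //.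
have : CA ^+ 2 * (s ^+ 2 * E ^+ 4) <= (CA ^+ 2 + CD + 1) * (s ^+ 2 * E ^+ 4).
  by rewrite ler_wpM2r// -addrA lerDl addr_ge0.
have : CD * (E / s * diss s u) <= (CA ^+ 2 + CD + 1) * (E / s * diss s u).
  by rewrite ler_wpM2r// addrAC lerDr addr_ge0 ?sqr_ge0.
move=> X2' A2'; rewrite mulrDr; apply: lerD; first exact: le_trans A2 A2'.
exact: le_trans X2 X2'.
Qed.

End step_estimate.

(** * Initial energy and total variation *)

Section lipschitz_approximation.
Context {R : realType} {n : nat}.
Notation V := 'rV[R]_n.
Notation mu := (@borel_lebesgue_rV R n).
Implicit Types (a p q u f g : V -> R) (x y z v : V) (i j : 'I_n) (r s t b : R).

Let L1b_gauss2 : L1b (gauss 2 : V -> R). Proof. exact: L1b_gauss. Qed.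

Definition lipschitz1 g := exists2 L : R, 0 <= L & forall x z, `|g (x - z) - g x| <= L * norm1 z.

(** Density of Lipschitz functions, stated with a Gaussian weight. The weighted measure is finite,
    so the property passes to complements and countable unions without any restriction on the
    measure of [A]. *)
Definition lip_approx (A : set V) := measurable A /\ forall e : R, 0 < e ->
  exists g, [/\ measurable_fun setT g, forall x, 0 <= g x <= 1, lipschitz1 g &
    \int[mu]_x (gauss 2 x * `|\1_A x - g x|) <= e].

Lemma bmf_indic (A : set V) : measurable A -> bmf (\1_A : V -> R).
Proof.
move=> mA; split; first exact: measurable_indic.
by exists 1 => x; rewrite indicE; case: (_ \in _); rewrite ?normr1 ?normr0.
Qed.

Lemma bmf_unit g : measurable_fun setT g -> (forall x, 0 <= g x <= 1) -> bmf g.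
Proof.
by move=> mg g01; split => //; exists 1 => x; have /andP[g0 g1] := g01 x; rewrite ger0_norm.
Qed.

Lemma integ_gauss2 f : bmf f -> integ mu (fun x => gauss 2 x * `|f x|).
Proof. by move=> bf; apply: L1b_integ; apply: L1bMr => //; exact: bmf_norm. Qed.

Lemma lip_approx0 : lip_approx set0.
Proof.
split => // e e0; exists (cst 0); split => //.
- by move=> x; rewrite lexx ler01.
- by exists 0 => // x z; rewrite subrr normr0 mul0r.
- rewrite (Rint_eq mu (g := cst 0)) ?Rintegral_cst ?mul0r ?ltW// => x.
  by rewrite indic0 subrr normr0 mulr0.
Qed.

Lemma lip_approxC A : lip_approx A -> lip_approx (~` A).
Proof.
move=> [mA H]; split; first exact: measurableC.
move=> e e0; have [g [mg g01 [L L0 gL] ge]] := H e e0.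
exists (fun x => 1 - g x); split.
- exact: measurable_funB.
- by move=> x; have /andP[g0 g1] := g01 x; apply/andP; split; lra.
- exists L => // x z; rewrite (_ : _ - _ = - (g (x - z) - g x)); last by ring.
  by rewrite normrN.
- apply: le_trans ge; rewrite le_eqVlt; apply/orP; left; apply/eqP; apply: Rint_eq => x.
  congr (_ * _); rewrite (_ : _ - _ = - (\1_A x - g x)) ?normrN//.
  by rewrite !indicE in_setC; case: (x \in A) => /=; rewrite ?mulr1n ?mulr0n; ring.
Qed.

Lemma lip_approxU A B : lip_approx A -> lip_approx B -> lip_approx (A `|` B).
Proof.
move=> [mA HA] [mB HB]; split; first exact: measurableU.
move=> e e0; have e20 : 0 < e / 2 by rewrite divr_gt0.
have [g [mg g01 [L L0 gL] ge]] := HA _ e20.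
have [h [mh h01 [K K0 hK] he]] := HB _ e20.
exists (fun x => 1 - (1 - g x) * (1 - h x)); split.
- apply: measurable_funB => //; apply: measurable_funM; exact: measurable_funB.
- move=> x; have /andP[g0 g1] := g01 x; have /andP[h0 h1] := h01 x.
  by apply/andP; split; nra.
- exists (L + K); first exact: addr_ge0.
  move=> x z; have /andP[g0 g1] := g01 x; have /andP[h0 h1] := h01 (x - z).
  rewrite (_ : _ - _ = (g (x - z) - g x) * (1 - h (x - z)) + (1 - g x) * (h (x - z) - h x)); last by ring.
  rewrite (le_trans (ler_normD _ _))// [leRHS]mulrDl !normrM lerD//.
    rewrite -[leRHS]mulr1 ler_pM// ger0_norm; lra.
  rewrite -[leRHS]mul1r ler_pM// ger0_norm; lra.
- have bA := bmfB (bmf_indic mA) (bmf_unit mg g01).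
  have bB := bmfB (bmf_indic mB) (bmf_unit mh h01).
  have iA := integ_gauss2 bA; have iB := integ_gauss2 bB.
  apply: (@le_trans _ _ (\int[mu]_x (gauss 2 x * `|\1_A x - g x| + gauss 2 x * `|\1_B x - h x|))); last first.
    by rewrite RintegralD//; lra.
  apply: le_Rintegral => //.
  + apply: integ_gauss2; apply: bmfB; first exact: bmf_indic (measurableU _ _ mA mB).
    apply: bmfB; first exact: bmf_cst.
    by apply: bmfM; apply: bmfB; [exact: bmf_cst|exact: bmf_unit|exact: bmf_cst|exact: bmf_unit].
  + exact: integD.
  move=> x _; rewrite -mulrDr ler_wpM2l ?gauss_ge0//.
  have /andP[g0 g1] := g01 x; have /andP[h0 h1] := h01 x.
  have -> : \1_(A `|` B) x = 1 - (1 - \1_A x) * (1 - \1_B x) :> R.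
    rewrite !indicE in_setU; case: (x \in A); case: (x \in B) => /=;
      rewrite ?mulr1n ?mulr0n; ring.
  have i01 (C : set V) : 0 <= (\1_C x : R) <= 1.
    by rewrite indicE; case: (_ \in _); rewrite ?lexx ?ler01.
  have /andP[a0 a1] := i01 A; have /andP[b0 b1] := i01 B.
  rewrite (_ : _ - _ = (\1_A x - g x) * (1 - \1_B x) + (1 - g x) * (\1_B x - h x)); last by ring.
  rewrite (le_trans (ler_normD _ _))// !normrM lerD//.
    rewrite -[leRHS]mulr1 ler_wpM2l// ger0_norm; lra.
  rewrite -[leRHS]mul1r ler_wpM2r// ger0_norm; lra.
Qed.

Lemma lip_approx_le A : measurable A ->
  (forall e : R, 0 < e -> exists B, lip_approx B /\
    \int[mu]_x (gauss 2 x * `|\1_A x - \1_B x|) <= e) -> lip_approx A.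
Proof.
move=> mA H; split => // e e0; have e20 : 0 < e / 2 by rewrite divr_gt0.
have [B [[mB HB] AB]] := H _ e20; have [g [mg g01 gL ge]] := HB _ e20.
exists g; split => //.
have i1 := integ_gauss2 (bmfB (bmf_indic mA) (bmf_indic mB)).
have i2 := integ_gauss2 (bmfB (bmf_indic mB) (bmf_unit mg g01)).
apply: (@le_trans _ _ (\int[mu]_x (gauss 2 x * `|\1_A x - \1_B x| + gauss 2 x * `|\1_B x - g x|))); last first.
  by rewrite RintegralD//; lra.
apply: le_Rintegral => //.
- exact: integ_gauss2 (bmfB (bmf_indic mA) (bmf_unit mg g01)).
- exact: integD.
move=> x _; rewrite -mulrDr ler_wpM2l ?gauss_ge0//.
by rewrite (le_trans _ (ler_normD _ _))//; rewrite addrA subrK.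
Qed.

Lemma Rint_dominated_cvg0 (F : nat -> V -> R) : (forall k, measurable_fun setT (F k)) ->
  (forall k x, `|F k x| <= 1) -> (forall x, F k x @[k --> \oo] --> (0 : R)) ->
  forall e : R, 0 < e -> exists k, \int[mu]_x (gauss 2 x * `|F k x|) <= e.
Proof.
move=> mF F1 F0 e e0.
have iG : mu.-integrable setT (EFin \o (gauss 2 : V -> R)) by exact: integ_gauss.
have [||||_ _ H] := @dominated_convergence _ _ _ mu setT measurableT
    (fun k x => (gauss 2 x * `|F k x|)%:E) (cst 0%E) (EFin \o gauss 2) _ _ _ iG.
- move=> k; apply/measurable_EFinP; apply: measurable_funM; first exact: measurable_gauss.
  exact: measurableT_comp.
- exact: measurable_cst.
- apply: aeW => x _; apply: cvg_EFin; first exact: nearW.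
  rewrite -(mulr0 (gauss 2 x)); apply: cvgMr.
  by rewrite -(normr0 R); apply: cvg_norm; exact: F0.
- apply: aeW => x k _; rewrite /= lee_fin normrM normr_id (ger0_norm (gauss_ge0 _ _)).
  by rewrite ler_piMr ?gauss_ge0.
rewrite integral0 in H.
have /fine_cvgP[_ /cvgrPdist_le /(_ _ e0)[k _ /(_ k (leqnn k))]] := H.
rewrite sub0r normrN => h; exists k.
by rewrite (le_trans (ler_norm _)).
Qed.

Lemma lip_approx_bigcup (A : nat -> set V) : (forall k, lip_approx (A k)) ->
  lip_approx (\bigcup_k A k).
Proof.
move=> HA; have mA k : measurable (A k) by case: (HA k).
have mU : measurable (\bigcup_k A k) by exact: bigcup_measurable.
pose B m := \big[setU/set0]_(k < m) A k.
have HB m : lip_approx (B m).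
  rewrite /B; elim: m => [|m IH]; first by rewrite big_ord0; exact: lip_approx0.
  by rewrite big_ord_recr; exact: lip_approxU.
have mB m : measurable (B m) by case: (HB m).
apply: lip_approx_le => // e e0.
have [||| k hk] := @Rint_dominated_cvg0 (fun m x => \1_(\bigcup_k A k) x - \1_(B m) x) _ _ _ e e0.
- by move=> k; apply: measurable_funB; exact: measurable_indic.
- move=> k x; rewrite !indicE; case: (_ \in _); case: (_ \in _);
    by rewrite ?subrr ?subr0 ?sub0r ?normrN ?normr1 ?normr0 ?ler01.
- move=> x; have [xU|xU] := boolP (x \in \bigcup_k A k).
  + have := xU; rewrite inE => -[k _ xk].
    apply: (@cvg_trans _ ((fun=> 0) @ \oo)); last exact: cvg_cst.
    apply: near_eq_cvg; near=> m.
    rewrite !indicE xU [x \in B m]mem_set ?subrr//.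
    have km : (k < m)%N by near: m; exact: nbhs_infty_gt.
    by rewrite /B -bigcup_mkord; exists k.
  + apply: (@cvg_trans _ ((fun=> 0) @ \oo)); last exact: cvg_cst.
    apply: near_eq_cvg; near=> m; rewrite !indicE (negbTE xU).
    rewrite [x \in B m]memNset ?subrr// /B -bigcup_mkord => -[k _ xk].
    by move/negP: xU; apply; rewrite inE; exists k.
by exists (B k); split.
Unshelve. all: end_near. Qed.

Lemma lip_approx_ray i (c : R) : lip_approx [set x : V | c < x ord0 i].
Proof.
have mA : measurable [set x : V | c < x ord0 i].
  have := @measurable_coord_rV R n i measurableT `]c, +oo[%classic (measurable_itv _).
  rewrite setTI; congr (measurable _); apply/seteqP; split => x /=; rewrite in_itv/= ?andbT//.
split => // e e0.
(* A ramp of slope [k] starting at the boundary of the half-space: at each point it is eventually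
   equal to the indicator. *)
pose g k x : R := Num.min 1 (Num.max 0 (k%:R * (x ord0 i - c))).
have mg k : measurable_fun setT (g k).
  apply: measurable_minr => //; apply: measurable_maxr => //.
  apply: measurable_funM => //; apply: measurable_funB => //; exact: measurable_coord_rV.
have g01 k x : 0 <= g k x <= 1.
  by rewrite /g le_min ler01 le_max lexx ge_min lexx.
have [||| k hk] := @Rint_dominated_cvg0 (fun k x => \1_[set x : V | c < x ord0 i] x - g k x) _ _ _ e e0.
- by move=> k; apply: measurable_funB => //; exact: measurable_indic.
- move=> k x; have /andP[g0 g1] := g01 k x.
  by rewrite indicE; case: (_ \in _); rewrite ler_norml /= ?mulr1n ?mulr0n; apply/andP; split; lra.
- move=> x; apply: (@cvg_trans _ ((fun=> 0) @ \oo)); last exact: cvg_cst.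
  apply: near_eq_cvg; near=> k; rewrite indicE.
  have [cx|xc] := ltP c (x ord0 i).
  + rewrite mem_set//= /g.
    have h : 1 <= k%:R * (x ord0 i - c).
      rewrite -ler_pdivrMr ?subr_gt0// mul1r.
      near: k; exact: nbhs_infty_ger.
    by rewrite max_r ?(le_trans ler01)// min_l ?subrr.
  + rewrite memNset/=; last by apply/negP; rewrite -leNgt.
    by rewrite /g max_l ?min_r ?ler01 ?subr0// mulr_ge0_le0// subr_le0.
exists (g k); split => //.
exists k%:R => // x z.
have m1 (u v : R) : `|Num.min 1 (Num.max 0 u) - Num.min 1 (Num.max 0 v)| <= `|u - v|.
  rewrite /Num.min /Num.max; do !case: ifPn; rewrite -?leNgt => *;
  rewrite ler_norml; apply/andP; split; have := ler_norm (u - v); have := ler_norm (v - u);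
  rewrite (distrC v u); lra.
rewrite (le_trans (m1 _ _))// (_ : _ - _ = - (k%:R * z ord0 i)); last by rewrite !mxE; ring.
by rewrite normrN normrM ger0_norm// ler_wpM2l// ler_norm1.
Unshelve. all: end_near. Qed.

(* The sets approximable in this sense form a sigma-algebra. *)
Lemma lip_approx_measurable (A : set V) : measurable A -> lip_approx A.
Proof.
have sa : sigma_algebra setT lip_approx.
  split; [exact: lip_approx0| |exact: lip_approx_bigcup].
  by move=> B HB; rewrite setTD; exact: lip_approxC.
apply: smallest_sub => //; rewrite -bigcup_seq => B [i _] [Y mY <-].
rewrite setTI; move: Y mY; rewrite RGenOInfty.measurableE.
apply: smallest_sub.
  split => /=.
  - by rewrite preimage_set0; exact: lip_approx0.
  - by move=> Y HY; rewrite setTD preimage_setC; exact: lip_approxC.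
  - by move=> F HF; rewrite preimage_bigcup; exact: lip_approx_bigcup.
move=> _ [c ->] /=.
rewrite (_ : _ @^-1` _ = [set x : V | c < x ord0 i]); first exact: lip_approx_ray.
by apply/seteqP; split => x /=; rewrite in_itv/= andbT.
Qed.

End lipschitz_approximation.

(** * Vanishing of the energy at small scales *)

Section short_time.
Context {R : realType} {n : nat}.
Notation V := 'rV[R]_n.
Notation mu := (@borel_lebesgue_rV R n).
Implicit Types (a p q u f g : V -> R) (x y z v : V) (i j : 'I_n) (r s t b : R).

Lemma gauss_shift_bound : exists2 C : R, 0 <= C & forall x z, norm1 z <= 1 ->
  gauss 1 (x + z) <= C * gauss 2 x.
Proof.
have [C C0 hC] := @gdom_le_gauss2 R n (0 * (n%:R + 1) + (n%:R + 1)).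
exists C => // x z z1; apply: le_trans (hC x).
have -> : gauss 1 (x + z) = gdom 0 (x + z) by rewrite /gdom mul0r expR0 mulr1.
apply: (@gdom_shift _ _ 0 x z 1) => //; first by rewrite ler01 lexx.
by move=> i; exact: le_trans (ler_norm1 z i) z1.
Qed.

Lemma unit_ind_indic a : unit_ind a -> a = \1_[set x | a x = 1].
Proof.
move=> [_ ai _]; apply/funext => x; rewrite indicE.
have [ax|ax] := ai x.
- by rewrite ax memNset//= ax => /eqP; rewrite eq_sym oner_eq0.
- by rewrite mem_set.
Qed.

Lemma unit_ind_measurable a : unit_ind a -> measurable [set x | a x = 1].
Proof.
move=> [a1 _ _]; have := (L1b_bmf a1).1 measurableT [set 1] (measurable_set1 1).
by rewrite setTI.
Qed.

Lemma gauss1_lower (M : R) : exists2 K : R, 0 < K &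
  forall x, (forall j, `|x ord0 j| <= M) -> 1 <= K * gauss 1 x.
Proof.
pose P : R := (Num.sqrt (4 * pi * 1 ^+ 2))^-1 ^+ n.
have P0 : 0 < P by rewrite exprn_gt0// gauss_peak_gt0.
exists (expR (n%:R * M ^+ 2 / 4) / P); first by rewrite divr_gt0// expR_gt0.
move=> x xM; rewrite gauss1E -/P mulrA divfK ?gt_eqF// -expRD.
rewrite -[leLHS]expR0 ler_expR -mulrBl divr_ge0// subr_ge0 /sqnorm.
have -> : n%:R * M ^+ 2 = \sum_(i < n) M ^+ 2 by rewrite sumr_const card_ord mulr_natl.
apply: ler_sum => i _; rewrite -sqr_normr lerXn2r ?nnegrE//.
exact: le_trans (xM i).
Qed.

(** Continuity of translations in [L^1], by approximation with a Lipschitz function. As the set is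
    bounded, a multiple of the Gaussian exceeds 1 on it, so that the weighted approximation controls
    an unweighted integral. *)
Lemma escape_small a (M : R) : unit_ind a ->
  (forall x, a x = 1 -> forall j, `|x ord0 j| <= M) ->
  forall e : R, 0 < e -> exists2 d, 0 < d & forall z, norm1 z <= d -> escape a z <= e.
Proof.
move=> ua aM e e0; have a1 : L1b a by case: ua.
have ba := L1b_bmf a1.
have [C C0 hC] := gauss_shift_bound.
have [K K0 hK] := gauss1_lower M.
have [_ HA] := lip_approx_measurable (unit_ind_measurable ua).
have C1 : 0 < C + 1 by rewrite ltr_wpDl.
(* Three terms arise: the approximation error at [x], the one at [x - z], and the Lipschitz term.
   This [e1] and the [d] below make each at most [e / 4]; [d <= 1] is required for shifting the
   weight. *)
pose e1 := e / (4 * K * (C + 1)).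
have e10 : 0 < e1 by rewrite divr_gt0// !mulr_gt0.
have [g [mg g01 [L L0 gL] ge]] := HA e1 e10.
rewrite -unit_ind_indic// in ge.
have bg := bmf_unit mg g01.
have L1 : 0 < L + 1 by rewrite ltr_wpDl.
pose d := Num.min 1 (e / (4 * K * (L + 1))).
have d0 : 0 < d by rewrite lt_min ltr01 divr_gt0// !mulr_gt0.
exists d => // z zd.
have z1 : norm1 z <= 1 by apply: (le_trans zd); rewrite ge_min lexx.
have ze : norm1 z <= e / (4 * K * (L + 1)).
  by apply: (le_trans zd); rewrite ge_min lexx orbT.
have ag := bmfB ba bg.
have g1 := L1b_gauss (n := n) (ltr01 : 0 < 1 :> R).
pose T x : R := gauss 1 x * `|a (x - z) - g (x - z)|.
have iT : integ mu T.
  by apply: L1b_integ; apply: L1bMr => //; apply: bmf_norm; exact: (bmf_shift (- z) ag).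
have iS : integ mu (fun x => gauss 2 x * `|a x - g x|) by exact: integ_gauss2.
have TE : \int[mu]_x T x <= C * e1.
  rewrite -(Rint_shift z iT) (le_trans _ (ler_wpM2l C0 ge))//.
  rewrite -(RintegralZl C measurableT iS).
  apply: le_Rintegral => //; [exact: integ_shift|exact: integZ|].
  by move=> x _; rewrite /T addrK mulrA ler_wpM2r// hC.
pose S x : R := K * (C * (gauss 2 x * `|a x - g x|) + (L * norm1 z) * gauss 1 x + T x).
have iS1 : integ mu (fun x => C * (gauss 2 x * `|a x - g x|)) by exact: integZ.
have iS2 : integ mu (fun x => (L * norm1 z) * gauss 1 x) by apply: integZ; exact: g1.1.
have iS3 := integD (integD iS1 iS2) iT.
have SE : \int[mu]_x S x <= e.
  rewrite /S (RintegralZl K measurableT iS3) (RintegralD measurableT (integD iS1 iS2) iT).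
  rewrite (RintegralD measurableT iS1 iS2) (RintegralZl C measurableT iS).
  rewrite (RintegralZl (L * norm1 z) measurableT g1.1) Rint_gauss// mulr1.
  have t1 : C * \int[mu]_x (gauss 2 x * `|a x - g x|) <= C * e1 by rewrite ler_wpM2l.
  have t2 : C * e1 <= e / (4 * K).
    rewrite /e1 (_ : e / (4 * K) = (C + 1) * (e / (4 * K * (C + 1)))); last first.
      by field; rewrite !gt_eqF.
    by rewrite ler_wpM2r ?lerDl// ltW.
  have t3 : L * norm1 z <= e / (4 * K).
    rewrite (_ : e / (4 * K) = (L + 1) * (e / (4 * K * (L + 1)))); last first.
      by field; rewrite !gt_eqF.
    by apply: ler_pM => //; [exact: norm1_ge0|rewrite lerDl].
  have t4 : K * (e / (4 * K)) = e / 4 by field; rewrite gt_eqF.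
  apply: (@le_trans _ _ (K * (e / (4 * K) + e / (4 * K) + e / (4 * K)))).
    rewrite ler_wpM2l ?(ltW K0)// lerD// ?(le_trans TE)// lerD//.
    exact: le_trans t2.
  rewrite !mulrDr t4; clear -e0; lra.
apply: le_trans SE; apply: le_Rintegral => //.
- exact: integ_escape.
- exact: integZ.
move=> x _; rewrite /S /=.
have a01 y : a y = 0 \/ a y = 1 by case: (ua) => _ + _.
have [ax|ax] := a01 x.
  rewrite ax mul0r mulr_ge0 ?(ltW K0)// addr_ge0 ?mulr_ge0 ?gauss_ge0//.
  by rewrite addr_ge0 ?mulr_ge0 ?gauss_ge0 ?norm1_ge0.
rewrite ax mul1r.
have h : 1 - a (x - z) <= `|a x - g x| + L * norm1 z + `|a (x - z) - g (x - z)|.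
  have h1 := ler_norm (a x - g x); have h2 := ler_norm (g (x - z) - a (x - z)).
  rewrite distrC in h2.
  have h3 := le_trans (ler_norm (g x - g (x - z))) (eq_ind _ (fun w => w <= _) (gL x z) _ (distrC _ _)).
  rewrite ax in h1 *; clear -h1 h2 h3; lra.
have nn : 0 <= `|a x - g x| + L * norm1 z + `|a (x - z) - g (x - z)|.
  by rewrite !addr_ge0// mulr_ge0// norm1_ge0.
apply: (le_trans h); apply: (@le_trans _ _ (K * gauss 1 x * (`|a x - g x| + L * norm1 z + `|a (x - z) - g (x - z)|))).
  by rewrite ler_peMl//; apply: hK; exact: aM.
rewrite -mulrA ler_wpM2l ?(ltW K0)// !mulrDr /T lerD// lerD//.
- rewrite (mulrA C) ax ler_wpM2r//; have := hC x 0; rewrite addr0; apply.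
  by rewrite /norm1 big1// => i _; rewrite mxE normr0.
- by rewrite mulrC.
Qed.

Lemma norm1_gauss_bound : exists2 C : R, 0 <= C & forall s z, 0 < s ->
  norm1 z * gauss s z <= C * s * gauss (2 * s) z.
Proof.
have [C C0 H] : exists2 C : R, 0 <= C & forall i s z, 0 < s ->
    `|kscale s (fun z => z ord0 i * gauss 1 z) z| <= C * gauss (2 * s) z.
  apply: (@uniform_const R n (fun i c => forall s z, 0 < s ->
    `|kscale s (fun z => z ord0 i * gauss 1 z) z| <= c * gauss (2 * s) z)).
  - move=> i c c' cc H s z s0; apply: (le_trans (H s z s0)).
    by rewrite ler_wpM2r// gauss_ge0.
  - by move=> i; apply: kscale_bound; apply: kernel_dom_coord; exact: kernel_dom_gauss.
exists (n%:R * C) => [|s z s0]; first by rewrite mulr_ge0.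
rewrite /norm1 mulr_suml.
have -> : n%:R * C * s * gauss (2 * s) z = \sum_(i < n) (s * (C * gauss (2 * s) z)).
  by rewrite sumr_const card_ord -[RHS]mulr_natl; ring.
apply: ler_sum => i _; have := H i s z s0.
rewrite /kscale mxE => h; rewrite -ler_pdivrMl// mulrC; apply: le_trans h.
rewrite (gauss_kscale z s0) /kscale normrM (@ger0_norm _ (s^-1 ^+ n)) ?exprn_ge0 ?invr_ge0 ?(ltW s0)//.
rewrite normrM normrM (@gtr0_norm _ s^-1) ?invr_gt0// (@ger0_norm _ (gauss _ _)) ?gauss_ge0//.
by rewrite le_eqVlt; apply/orP; left; apply/eqP; ring.
Qed.

(** Displacements below [d] contribute little by [escape_small]; longer ones carry little Gaussian
    mass, by the first moment of order [s]. This gives the initial value from which the scale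
    derivative is integrated. *)
Lemma henergy_small a (M : R) : unit_ind a ->
  (forall x, a x = 1 -> forall j, `|x ord0 j| <= M) ->
  forall e : R, 0 < e -> exists2 d, 0 < d & forall s, 0 < s -> s <= d -> henergy a s <= e.
Proof.
move=> ua aM e e0; have e20 : 0 < e / 2 by rewrite divr_gt0.
have [d d0 hd] := escape_small ua aM e20.
have [C C0 hC] := norm1_gauss_bound.
have C1 : 0 < C + 1 by rewrite ltr_wpDl.
exists (e / 2 * d / (C + 1)) => [|s s0 sd]; first by rewrite divr_gt0// mulr_gt0.
have s20 : 0 < 2 * s by rewrite mulr_gt0.
rewrite henergy_escape//.
have ig := integ_gauss n s0; have ig2 := integ_gauss n s20.
apply: (@le_trans _ _ (\int[mu]_z (e / 2 * gauss s z + C * s / d * gauss (2 * s) z))); last first.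
  rewrite RintegralD//; [|exact: integZ|exact: integZ].
  rewrite (RintegralZl (e / 2) measurableT ig) (RintegralZl (C * s / d) measurableT ig2).
  rewrite !Rint_gauss// !mulr1.
  have : C * s / d <= e / 2.
    rewrite ler_pdivrMr//; apply: (@le_trans _ _ ((C + 1) * s)).
      by rewrite ler_wpM2r ?lerDl// ltW.
    by rewrite mulrC -ler_pdivlMr.
  by clear; lra.
apply: le_Rintegral => //.
- exact: integ_gauss_escape.
- by apply: integD; exact: integZ.
move=> z _; have g0 := gauss_ge0 s z; have g20 := gauss_ge0 (2 * s) z.
have Csd : 0 <= C * s / d by rewrite divr_ge0 ?mulr_ge0// ltW.
have [zd|dz] := leP (norm1 z) d.
  rewrite ler_wpDr//; first by rewrite mulr_ge0.
  by rewrite mulrC ler_wpM2r// hd.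
rewrite ler_wpDl//; first by rewrite mulr_ge0// ltW.
apply: (@le_trans _ _ (gauss s z * (norm1 z / d))).
  rewrite ler_wpM2l// (@le_trans _ _ 1)//; last by rewrite ler_pdivlMr// mul1r ltW.
  have := escape_ge0 ua z; rewrite /escape.
  case: (ua) => a1 _ aE _; rewrite -[leRHS]aE; apply: le_Rintegral => //; [exact: integ_escape|exact: L1b_integ|].
  by move=> x _; rewrite ler_piMr ?(unit_ind_ge0 _ ua)// gerBl (unit_ind_ge0 _ ua).
rewrite mulrA ler_pdivrMr//; rewrite mulrC (le_trans (hC s z s0))//.
by rewrite [leRHS]mulrAC divfK// gt_eqF.
Qed.

End short_time.

Section quadratic_remainder.
Context {R : realType}.

(** The bridge from quadratic remainders to the derivatives that occur in [C1] and [divergence]. *)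
Lemma is_derive_quadratic (V W : normedModType R) (F : V -> W) x v d (M e : R) :
  0 < e -> (forall t, `|t| <= e -> `|F (x + t *: v) - F x - t *: d| <= t ^+ 2 * M) ->
  is_derive x v F d.
Proof.
move=> e0 H.
have cv : (fun t : R => t^-1 *: ((F \o shift x) (t *: v) - F x)) @ 0^' --> d.
  apply/cvgrPdist_le => /= b b0.
  have M1 : 0 < `|M| + 1 by rewrite ltr_wpDl.
  have bM : 0 < b / (`|M| + 1) by rewrite divr_gt0.
  near=> t.
  have t0 : t != 0 by near: t; exact: nbhs_dnbhs_neq.
  have te : `|t| <= e by near: t; exact: dnbhs0_le.
  have tb : `|t| <= b / (`|M| + 1) by near: t; exact: dnbhs0_le.
  have -> : d - t^-1 *: ((F \o shift x) (t *: v) - F x) =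
      - (t^-1 *: (F (x + t *: v) - F x - t *: d)).
    by rewrite /= (addrC (t *: v)) [in RHS]scalerBr scalerA mulVf// scale1r opprB.
  rewrite normrN normrZ normfV ler_pdivrMl ?normr_gt0//.
  apply: (le_trans (H t te)); rewrite -sqr_normr expr2 -mulrA ler_wpM2l//.
  apply: (@le_trans _ _ (`|t| * (`|M| + 1))).
    by rewrite ler_wpM2l// (le_trans (ler_norm M))// lerDl.
  by rewrite -ler_pdivlMr.
by apply: DeriveDef; [apply/cvg_ex; exists d|exact: cvg_lim].
Unshelve. all: by end_near. Qed.

(** A [C^1] function vanishing on a half-line with an explicit quadratic remainder; cutoffs are
    composed from it. *)
Definition sqpos (t : R) : R := Num.max t 0 ^+ 2.

Lemma sqpos_quadratic t u : `|sqpos (t + u) - sqpos t - 2 * Num.max t 0 * u| <= u ^+ 2.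
Proof.
rewrite /sqpos ler_norml; apply/andP.
have [t0|t0] := leP t 0; have [tu0|tu0] := leP (t + u) 0; split; nra.
Qed.

End quadratic_remainder.

(** * Pointwise partial derivatives of products and compositions *)

Section partial_derivatives.
Context {R : realType} {n : nat}.
Notation V := 'rV[R]_n.
Implicit Types (f g : V -> R) (x y z v : V) (i j : 'I_n) (r s t b c M e : R).

(** The relation [wdiff] at a single point: the constants may depend on [x], as happens when [sqpos]
    is composed with the unbounded function [sqnorm]. *)
Definition pdiff i f x (f' : R) := exists M, 0 <= M /\ exists2 e, 0 < e &
  forall t, `|t| <= e -> `|f (x + t *: basis_vec i) - f x - t * f'| <= t ^+ 2 * M.

Lemma wdiff_pdiff i f f' x : wdiff i f f' -> pdiff i f x (f' x).
Proof. by move=> [M [M0 [e e0 H]]]; exists M; split => //; exists e => // t /H. Qed.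

Lemma pdiff_sqnorm i x : pdiff i sqnorm x (2 * x ord0 i).
Proof.
exists 1; split => //; exists 1 => // t _.
have -> : sqnorm (x + t *: basis_vec i) - sqnorm x - t * (2 * x ord0 i) = t ^+ 2.
  have D z : sqnorm z = z ord0 i ^+ 2 + \sum_(j < n | j != i) z ord0 j ^+ 2.
    by rewrite /sqnorm (bigD1 i).
  have S j : (x + t *: basis_vec i) ord0 j = x ord0 j + t * (j == i)%:R.
    by rewrite 2!mxE basis_vec_coord.
  rewrite !D (eq_bigr (fun j => x ord0 j ^+ 2)); last first.
    by move=> j ji; rewrite S (negbTE ji) mulr0 addr0.
  by rewrite S eqxx mulr1; ring.
by rewrite mulr1 ger0_norm// sqr_ge0.
Qed.

Lemma pdiff_affine i f x (f' : R) c r : pdiff i f x f' ->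
  pdiff i (fun x => c + r * f x) x (r * f').
Proof.
move=> [M [M0 [e e0 H]]]; exists (`|r| * M); split; first by rewrite mulr_ge0.
exists e => // t te.
rewrite (_ : _ - _ - _ = r * (f (x + t *: basis_vec i) - f x - t * f')); last by ring.
by rewrite normrM mulrCA ler_wpM2l// H.
Qed.

Lemma pdiff_increment i f x (f' : R) : pdiff i f x f' -> exists2 K, 0 <= K & exists2 e, 0 < e &
  forall t, `|t| <= e -> `|f (x + t *: basis_vec i) - f x| <= `|t| * K.
Proof.
move=> [M [M0 [e e0 H]]]; exists (e * M + `|f'|).
  by rewrite addr_ge0// mulr_ge0// ltW.
exists e => // t te.
rewrite (_ : _ - _ = (f (x + t *: basis_vec i) - f x - t * f') + t * f'); last by ring.
rewrite (le_trans (ler_normD _ _))// mulrDr normrM lerD// (le_trans (H t te))//.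
by rewrite -sqr_normr expr2 -mulrA ler_wpM2l// ler_wpM2r.
Qed.

Lemma pdiff_sqpos i f x (f' : R) : pdiff i f x f' ->
  pdiff i (fun x => sqpos (f x)) x (2 * Num.max (f x) 0 * f').
Proof.
move=> df; have [K K0 [e1 e10 H1]] := pdiff_increment df.
move: df => [M [M0 [e e0 H]]]; set m := Num.max (f x) 0.
have m0 : 0 <= m by rewrite le_max lexx orbT.
exists (K ^+ 2 + 2 * m * M); split; first by rewrite addr_ge0 ?sqr_ge0// !mulr_ge0.
exists (Num.min e e1); first by rewrite lt_min e0.
move=> t; rewrite le_min => /andP[/H h /H1 h1].
set u := f (x + t *: basis_vec i) - f x in h h1.
have := sqpos_quadratic (f x) u; rewrite -/m => hs.
have fu : f x + u = f (x + t *: basis_vec i) by rewrite /u addrC subrK.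
rewrite fu in hs.
rewrite (_ : _ - _ - _ = (sqpos (f (x + t *: basis_vec i)) - sqpos (f x) - 2 * m * u)
  + 2 * m * (u - t * f')); last by ring.
rewrite (le_trans (ler_normD _ _))// [leRHS]mulrDr lerD//.
  by rewrite (le_trans hs)// -sqr_normr -(sqr_normr t) -exprMn lerXn2r// nnegrE// mulr_ge0.
by rewrite normrM ger0_norm ?mulr_ge0// mulrCA ler_wpM2l// mulr_ge0.
Qed.

Lemma pdiffM i f g x (f' g' : R) : pdiff i f x f' -> pdiff i g x g' ->
  pdiff i (fun x => f x * g x) x (f' * g x + f x * g').
Proof.
move=> df dg; have [K K0 [e1 e10 H1]] := pdiff_increment df.
have [K' K'0 [e2 e20 H2]] := pdiff_increment dg.
move: df dg => [M [M0 [e e0 H]]] [M' [M'0 [e' e'0 H']]].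
exists (`|g x| * M + `|f x| * M' + K * K'); split.
  by rewrite !addr_ge0// mulr_ge0.
exists (Num.min (Num.min e e') (Num.min e1 e2)); first by rewrite !lt_min e0 e'0 e10.
move=> t; rewrite !le_min => /andP[/andP[/H h /H' h'] /andP[/H1 h1 /H2 h2]].
set fx := f (x + _) in h h1 *; set gx := g (x + _) in h' h2 *.
rewrite (_ : _ - _ - _ = g x * (fx - f x - t * f') + f x * (gx - g x - t * g')
  + (fx - f x) * (gx - g x)); last by ring.
rewrite (le_trans (ler_normD _ _))// [leRHS]mulrDr lerD//.
  rewrite (le_trans (ler_normD _ _))// [leRHS]mulrDr lerD// normrM mulrCA ler_wpM2l//.
by rewrite normrM -sqr_normr expr2 mulrACA ler_pM.
Qed.

Lemma norm_coord_le z j : `|z ord0 j| <= `|z|.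
Proof.
rewrite [leRHS]/Num.norm /= mx_normrE.
by apply/bigmax_geP; right => /=; exists (ord0, j).
Qed.

Lemma norm1_le_norm z : norm1 z <= n%:R * `|z|.
Proof.
rewrite /norm1; have -> : n%:R * `|z| = \sum_(j < n) `|z|.
  by rewrite sumr_const card_ord mulr_natl.
by apply: ler_sum => j _; exact: norm_coord_le.
Qed.

Lemma norm1_lipschitz_continuous f c :
  (forall x y, `|f x - f y| <= c * norm1 (x - y)) -> continuous f.
Proof.
move=> H x; apply/(@cvgrPdist_le R R^o V (nbhs x)) => e e0.
have c1 : 0 < `|c| * n%:R + 1 by rewrite ltr_wpDl// mulr_ge0.
near=> y; apply: (le_trans (H x y)).
have xy : `|x - y| <= e / (`|c| * n%:R + 1).
  by near: y; apply: cvgr_dist_le; rewrite ?divr_gt0.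
apply: (@le_trans _ _ ((`|c| * n%:R + 1) * `|x - y|)); last first.
  by rewrite mulrC -ler_pdivlMr.
apply: (@le_trans _ _ (`|c| * norm1 (x - y))).
  by rewrite ler_wpM2r ?norm1_ge0// ler_norm.
by rewrite mulrDl -mulrA (@le_trans _ _ (`|c| * (n%:R * `|x - y|)))// ?ler_wpM2l ?norm1_le_norm// lerDl mul1r.
Unshelve. all: by end_near. Qed.

Lemma continuous_sqnorm : continuous (sqnorm : V -> R).
Proof.
apply: continuous_big => [|i _]; first exact: add_continuous.
by move=> x; apply: (@continuous_comp V R R (fun z => z ord0 i) (fun u => u ^+ 2)); [exact: coord_continuous|exact: exprn_continuous].
Qed.

Lemma continuous_sqpos : continuous (sqpos : R -> R).
Proof.
move=> t; apply: (@continuous_comp R R R (fun u => Num.max u 0) (fun u => u ^+ 2)); last exact: exprn_continuous.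
by apply: continuous_max; [exact: cvg_id|exact: cvg_cst].
Qed.

End partial_derivatives.

(** * Compactly supported test fields *)

Section test_field.
Context {R : realType} {n : nat}.
Notation V := 'rV[R]_n.
Notation mu := (@borel_lebesgue_rV R n).
Implicit Types (a f g : V -> R) (x y z v : V) (i j : 'I_n) (r s t b c M e : R).

(** The inner [sqpos] vanishes for [sqnorm x <= c] and is at least 1 for [sqnorm x >= c + 1], so the
    value passes from 1 to 0 in between. *)
Definition cutoff c x : R := sqpos (1 - sqpos (sqnorm x - c)).

Definition dcutoff c i x : R :=
  - (2 * Num.max (1 - sqpos (sqnorm x - c)) 0 * (2 * Num.max (sqnorm x - c) 0 * (2 * x ord0 i))).

Lemma sqpos_ge0 t : 0 <= sqpos t. Proof. exact: sqr_ge0. Qed.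

Lemma sqpos_eq0 t : t <= 0 -> sqpos t = 0.
Proof. by move=> t0; rewrite /sqpos max_r// expr0n. Qed.

Lemma pdiff_cutoff c i x : pdiff i (cutoff c) x (dcutoff c i x).
Proof.
have -> : cutoff c = (fun x => sqpos (1 + -1 * sqpos (- c + 1 * sqnorm x))).
  by apply/funext => y; rewrite /cutoff mulN1r mul1r (addrC (- c)).
have -> : dcutoff c i x = 2 * Num.max (1 + -1 * sqpos (- c + 1 * sqnorm x)) 0 *
    (-1 * (2 * Num.max (- c + 1 * sqnorm x) 0 * (1 * (2 * x ord0 i)))).
  by rewrite /dcutoff mulN1r !mul1r (addrC (- c)) mulN1r mulrN.
by do 2 (apply: pdiff_sqpos; apply: pdiff_affine); exact: pdiff_sqnorm.
Qed.

Lemma cutoff_le1 c x : 0 <= cutoff c x <= 1.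
Proof.
rewrite sqpos_ge0 /= /cutoff /sqpos; have := sqpos_ge0 (sqnorm x - c).
rewrite -/(sqpos (sqnorm x - c)); move: (sqpos _) => u u0.
by rewrite exprn_ile1// ?le_max ?lexx ?orbT// ge_max ler01 gerBl u0.
Qed.

Lemma cutoff1 c x : sqnorm x <= c -> cutoff c x = 1.
Proof. by move=> xc; rewrite /cutoff (@sqpos_eq0 (sqnorm x - c)) ?subr_le0// subr0 /sqpos max_l// expr1n. Qed.

Lemma dcutoff0 c i x : sqnorm x <= c -> dcutoff c i x = 0.
Proof. by move=> xc; rewrite /dcutoff [X in 2 * X * (2 * _)]max_r ?subr_le0// mulr0 mul0r mulr0 oppr0. Qed.

Lemma cutoff_support c x : cutoff c x != 0 -> sqnorm x <= c + 1.
Proof.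
apply: contraNT; rewrite -ltNge => xc; apply/eqP/sqpos_eq0.
have h : 1 <= sqnorm x - c by rewrite lerBrDr addrC ltW.
by rewrite subr_le0 /sqpos max_l ?(le_trans ler01)// exprn_ege1.
Qed.

Lemma continuous_sqnormB c : continuous (fun x : V => sqnorm x - c).
Proof.
move=> x; apply: (@continuousB R R^o V (@sqnorm R n) (cst c)); last exact: cst_continuous.
exact: continuous_sqnorm.
Qed.

Lemma continuous_1Bsqpos c : continuous (fun x : V => 1 - sqpos (sqnorm x - c)).
Proof.
move=> x; apply: (@continuousB R R^o V (cst 1) (fun x => sqpos (sqnorm x - c))).
  exact: cst_continuous.
apply: (@continuous_comp V R R (fun x => sqnorm x - c) sqpos); last exact: continuous_sqpos.
exact: continuous_sqnormB.
Qed.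

Lemma continuous_cutoff c : continuous (cutoff c).
Proof.
move=> x; apply: (@continuous_comp V R R (fun x => 1 - sqpos (sqnorm x - c)) sqpos).
  exact: continuous_1Bsqpos.
exact: continuous_sqpos.
Qed.

Lemma continuous_max0 f : continuous f -> continuous (fun x => 2 * Num.max (f x) 0).
Proof.
move=> cf x; apply: (@continuousM R V (cst 2) (fun x => Num.max (f x) 0)); first exact: cst_continuous.
by apply: (@continuous_max R V f (cst 0)); [exact: cf|exact: cst_continuous].
Qed.

Lemma continuous_dcutoff c i : continuous (dcutoff c i).
Proof.
move=> x; apply: (@continuousN R R^o V); apply: (@continuousM R V).
  by apply: continuous_max0; exact: continuous_1Bsqpos.
apply: (@continuousM R V).
  by apply: continuous_max0; exact: continuous_sqnormB.
apply: (@continuousM R V (cst 2)); first exact: cst_continuous.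
exact: coord_continuous.
Qed.

Lemma is_derive_field i j (F : V -> R) x (F' : R) : pdiff j F x F' ->
  is_derive x (basis_vec j) (fun x => F x *: basis_vec i : V) (F' *: basis_vec i).
Proof.
move=> [M [M0 [e e0 H]]].
apply: (@is_derive_quadratic _ _ _ _ _ _ _ (M * `|basis_vec i : V|) e) => // t te.
by rewrite scalerA -!scalerBl normrZ mulrA ler_wpM2r// H.
Qed.

Lemma enorm_field i (u : R) : enorm (u *: basis_vec i : V) = `|u|.
Proof.
rewrite /enorm -sqrtr_sqr (bigD1 i)//= big1 => [|j ji].
  by rewrite addr0 mxE basis_vec_coord eqxx mulr1.
by rewrite mxE basis_vec_coord (negbTE ji) mulr0 expr0n.
Qed.

Lemma kconvZ c q f x : L1b q -> bmf f -> kconv (fun z => c * q z) f x = c * kconv q f x.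
Proof.
move=> q1 bf; rewrite /kconv -RintegralZl//; last exact: L1b_integ (L1b_conv_integrand x q1 bf).
by apply: Rint_eq => y; rewrite mulrA.
Qed.

(** The mollified field does not have compact support, hence the cutoff; it is constant near no
    boundary point in general, but equals 1 with zero gradient on a ball containing the set, where
    alone the divergence is tested. Division by [C + 1] makes the field admissible. *)
Lemma test_field a (M C : R) i r : unit_ind a ->
  (forall x, a x = 1 -> forall j, `|x ord0 j| <= M) ->
  0 <= C -> kernel_bounds i C -> 0 < r ->
  exists xi : V -> V, [/\ C1 xi, compact_support xi, forall x, enorm (xi x) <= 1 &
    forall x, a x * divergence xi x = a x * ((C + 1)^-1 * kconv (divKx i r) a x)].
Proof.
move=> ua aM C0 Kb r0; have a1 : L1b a by case: ua.
have ba := L1b_bmf a1.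
have C1' : 0 < C + 1 by rewrite ltr_wpDl.
pose c := n%:R * M ^+ 2.
pose eta := kconv (kscale r (Kx i)) a.
pose eta' j := kconv (fun z => r^-1 * kscale r (Kxx i j) z) a.
pose k : R := (C + 1)^-1.
have k0 : 0 < k by rewrite invr_gt0.
(* The summand 0 gives [F] the shape that [pdiff_affine] expects. *)
pose F x : R := 0 + k * (cutoff c x * eta x).
pose F' j x : R := k * (dcutoff c j x * eta x + cutoff c x * eta' j x).
have L1xx j : L1b (kscale r (Kxx i j)).
  by apply: kscale_L1b => //; [exact: measurable_Kxx|exact: kernel_dom_Kxx].
have dF j x : pdiff j F x (F' j x).
  apply: pdiff_affine; apply: pdiffM; first exact: pdiff_cutoff.
  apply: wdiff_pdiff; apply: L1diff_conv => //; last by apply: L1bZ.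
    by apply: kscale_L1diff => //; exact: kernel_diff_Kx.
  exact: L1b_Kx.
have ceta : continuous eta.
  have [L L0 H] := kconv_kscale_lipP ua r0 (measurable_Kx i) (kernel_dom_Kx i) (kernel_lip_Kx i).
  exact: norm1_lipschitz_continuous H.
have ceta' j : continuous (eta' j).
  have [L L0 H] := kconv_kscale_lipP ua r0 (measurable_Kxx i j) (kernel_dom_Kxx i j) (kernel_lip_Kxx i j).
  apply: (@norm1_lipschitz_continuous _ _ _ (r^-1 * L)) => x y.
  rewrite /eta' (kconvZ _ x (L1xx j) ba) (kconvZ _ y (L1xx j) ba) -mulrBr normrM (@gtr0_norm _ r^-1) ?invr_gt0//.
  by rewrite -mulrA ler_wpM2l// invr_ge0 ltW.
have etaC x : `|eta x| <= C.
  have r20 : 0 < 2 * r by rewrite mulr_gt0.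
  apply: (@kconv_norm_le _ _ C (kscale r (Kx i)) (gauss (2 * r))) => //.
  - by apply: measurable_kscale; exact: measurable_Kx.
  - by move=> z; case: (Kb r z r0).
  - exact: integ_gauss.
  - exact: Rint_gauss.
  - by case: ba.
  - by move=> y; exact: unit_ind_norm.
have F1 x : `|F x| <= 1.
  have /andP[cut0 cut1] := cutoff_le1 c x.
  rewrite /F add0r normrM (gtr0_norm k0) normrM (ger0_norm cut0) /k.
  rewrite ler_pdivrMl// mulr1 (@le_trans _ _ (1 * C))//; first exact: ler_pM.
  by rewrite mul1r lerDl.
have dxi j x := @is_derive_field i j F x _ (dF j x).
have DE j : 'D_(basis_vec j) (fun x => F x *: basis_vec i : V) = (fun x => F' j x *: basis_vec i).
  by apply/funext => x; have := dxi j x => D; rewrite derive_val.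
have DEx j x : 'D_(basis_vec j) (fun x => F x *: basis_vec i : V) x = F' j x *: basis_vec i.
  by have := dxi j x => D; rewrite derive_val.
have cF' j : continuous (F' j).
  move=> x; apply: (@continuousM R V (cst k) (fun x => dcutoff c j x * eta x + cutoff c x * eta' j x)).
    exact: cst_continuous.
  apply: (@continuousD R R^o V (fun x => dcutoff c j x * eta x) (fun x => cutoff c x * eta' j x)).
  + by apply: (@continuousM R V); [exact: continuous_dcutoff|exact: ceta].
  + by apply: (@continuousM R V); [exact: continuous_cutoff|exact: ceta'].
exists (fun x => F x *: basis_vec i); split.
- split => [j x|j]; first by have := dxi j x => D; exact: ex_derive.
  rewrite DE => x; apply: (@cvgZr_tmp R V V (nbhs x)); exact: cF'.
- have clZ : closed [set x : V | sqnorm x <= c + 1].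
    by apply: (@closed_comp V R (@sqnorm R n) [set u | u <= c + 1]) => [x _|];
      [exact: continuous_sqnorm|exact: closed_le].
  have sub : closure [set x : V | F x *: basis_vec i != 0] `<=` [set x | sqnorm x <= c + 1].
    rewrite [X in _ `<=` X](closure_id _).1//; apply: closure_subset => x /= Fx.
    apply: cutoff_support; apply: contra_neq Fx => cx.
    by rewrite /F cx mul0r mulr0 add0r scale0r.
  have c10 : 0 <= c + 1 by rewrite addr_ge0// mulr_ge0// sqr_ge0.
  apply: (@subclosed_compact _ _ [set v : V | forall j, v ord0 j \in `[- (c + 1 + 1), c + 1 + 1]]).
  (* The enclosing cube has half-width [c + 2], since [u ^+ 2 <= c + 1] implies [u <= c + 2] for
     nonnegative [u]. *)
  + exact: closed_closure.
  + apply: (@rV_compact _ _ (fun=> `[- (c + 1 + 1), c + 1 + 1]%classic)) => _.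
    exact: segment_compact.
  + move=> x /sub /= xc j; rewrite in_itv /= -ler_norml.
    have : `|x ord0 j| ^+ 2 <= c + 1.
      apply: le_trans xc; rewrite sqr_normr /sqnorm (bigD1 j)//= lerDl.
      by apply: sumr_ge0 => l _; exact: sqr_ge0.
    move: (`|_|) (normr_ge0 (x ord0 j)) => u u0; clear -c10 u0; nra.
- by move=> x; rewrite enorm_field.
- move=> x; rewrite /divergence (bigD1 i)//= big1 ?addr0 => [|j ji]; last first.
    by rewrite DEx mxE basis_vec_coord (negbTE ji) mulr0.
  rewrite DEx mxE basis_vec_coord eqxx mulr1 /F'.
  have [_ a01 _] := ua.
  have [->|ax] := a01 x; first by rewrite !mul0r.
  have xc : sqnorm x <= c.
    rewrite /c (_ : n%:R * M ^+ 2 = \sum_(j < n) M ^+ 2); last first.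
      by rewrite sumr_const card_ord mulr_natl.
    apply: ler_sum => j _; rewrite -sqr_normr lerXn2r ?nnegrE//; last exact: aM.
    exact: le_trans (aM x ax j).
  by rewrite cutoff1// dcutoff0// mul0r add0r mul1r ax !mul1r.
Qed.

End test_field.

(** * The energy bounded by the total variation *)

Section energy_le_variation.
Context {R : realType} {n : nat}.
Notation V := 'rV[R]_n.
Notation mu := (@borel_lebesgue_rV R n).
Implicit Types (a : V -> R) (xi : V -> V).

(** The variation enters only as a number [TV], and the divergence only through a Borel function [g]
    agreeing with it on the set. In this form the hypothesis can be checked for a Borel version of a
    Lebesgue measurable datum. *)
Lemma henergy_le_variation : exists2 K : R, 0 < K & forall a (M TV : R),
  unit_ind a -> (forall x, a x = 1 -> forall j, `|x ord0 j| <= M) -> 0 <= TV ->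
  (forall xi g, C1 xi -> compact_support xi -> (forall x, enorm (xi x) <= 1) ->
    measurable_fun setT g -> (forall x, a x * divergence xi x = a x * g x) ->
    \int[mu]_x (a x * g x) <= TV) ->
  forall s, 0 < s -> henergy a s <= K * TV * s.
Proof.
have [C C0 Kb] := @kernel_bounds_uniform R n.
have C1' : 0 < C + 1 by rewrite ltr_wpDl.
pose K : R := 2 * (n%:R * (C + 1)).
have K0 : 0 <= K by rewrite !mulr_ge0// ltW.
exists (K + 1) => [|a M TV ua aM TV0 H s s0]; first by rewrite ltr_wpDl.
have a1 : L1b a by case: ua.
have D r : 0 < r -> - (K * TV) <= doverlap a r.
  move=> r0; rewrite doverlapE// mulNr lerN2 /K -!mulrA ler_wpM2l//.
  rewrite mulr_natl -[X in _ *+ X](card_ord n) -sumr_const; apply: ler_sum => i _.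
  have [xi [xi1 xi2 xi3 xiE]] := test_field ua aM C0 (Kb i) r0.
  have L1k : L1b (kconv (divKx i r) a) by apply: L1b_conv => //; exact: L1b_divKx.
  have mk := (bmfZ (C + 1)^-1 (L1b_bmf L1k)).1.
  have := H xi _ xi1 xi2 xi3 mk xiE; under eq_Rintegral do rewrite mulrCA.
  rewrite RintegralZl//; last by apply: L1b_integ; apply: L1bMr => //; exact: L1b_bmf.
  by rewrite ler_pdivrMl.
apply: (@le_trans _ _ (K * TV * s)); last first.
  by rewrite ler_wpM2r ?(ltW s0)// ler_wpM2r// lerDl.
apply/ler_addgt0Pr => e e0.
have [d d0 hd] := henergy_small ua aM e0.
(* The overlap is differentiable only at positive scales, so the mean value theorem is applied on
   []r, s[] with [henergy a r] at most [e], and [e] is arbitrary. *)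
pose r := Num.min d (s / 2).
have r0 : 0 < r by rewrite lt_min d0 divr_gt0.
have rs : r < s by rewrite gt_min ltr_pdivrMr// ltr_pMr// ltrDl ltr01 orbT.
have hr : henergy a r <= e by apply: hd => //; rewrite ge_min lexx.
have [c /andP[rc _]] := overlap_mvt ua r0 rs.
rewrite !overlapE// => E.
have := D c (lt_trans r0 rc); move: (doverlap a c) E => X E hX.
have KTV : 0 <= K * TV by rewrite mulr_ge0.
have : - (K * TV) * (s - r) <= X * (s - r) by rewrite ler_wpM2r// subr_ge0 ltW.
have : K * TV * (s - r) <= K * TV * s by rewrite ler_wpM2l// gerBl ltW.
rewrite -E mulNr; move: hr; clear.
by move: (henergy a s) (henergy a r) (K * TV * (s - r)) (K * TV * s) => u w p q; lra.
Qed.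

End energy_le_variation.

(** * Energy dissipation *)

Section energy_dissipation.
Context {R : realType} {n : nat}.
Notation V := 'rV[R]_n.
Notation mu := (@borel_lebesgue_rV R n).
Implicit Types (a : V -> R) (lambda s E : R).

(** Pointwise [(a' - a) * (kconv (gauss s) a - lambda) >= 0], because [a'] is the superlevel set.
    Both sets have mass one, so [lambda] disappears on integration; the rest is the expansion of the
    quadratic form. *)
Lemma diss_le_energy_drop a a' lambda s : unit_ind a -> unit_ind a' -> 0 < s ->
  a' = \1_[set x | lambda < kconv (gauss s) a x] ->
  diss s (fun x => a x - a' x) <= henergy a s - henergy a' s.
Proof.
move=> ua ua' s0 a'E; have a1 : L1b a by case: ua.
have a1' : L1b a' by case: ua'.
have g1 := L1b_gauss (n := n) s0.
have ba := L1b_bmf a1; have ba' := L1b_bmf a1'.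
have I (p q : V -> R) : L1b p -> L1b q -> integ mu (fun x => p x * kconv (gauss s) q x).
  by move=> p1 q1; apply: L1b_integ; apply: L1bMr => //; exact: L1b_bmf (L1b_conv g1 q1).
have OE p : L1b p -> \int[mu]_x (p x * kconv (gauss s) p x) = overlap p s.
  by move=> p1; rewrite /overlap dint_conv//; exact: L1b_bmf.
have S : \int[mu]_x (a x * kconv (gauss s) a' x) = \int[mu]_x (a' x * kconv (gauss s) a x).
  exact: kconv_gauss_selfadjoint.
have P : 0 <= \int[mu]_x ((a' x - a x) * (kconv (gauss s) a x - lambda)).
  apply: Rintegral_ge0 => x _; rewrite a'E indicE.
  have [xl|xl] := boolP (x \in _).
    have {}xl : lambda < kconv (gauss s) a x by move: xl; rewrite inE.
    by apply: mulr_ge0; rewrite subr_ge0; [exact: unit_ind_le1|exact: ltW].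
  have {}xl : kconv (gauss s) a x <= lambda.
    by rewrite leNgt; apply/negP => xl'; move: xl; rewrite mem_set.
  by rewrite sub0r mulNr -mulrN opprB; apply: mulr_ge0; [exact: unit_ind_ge0|rewrite subr_ge0].
have {P} : 0 <= \int[mu]_x (a' x * kconv (gauss s) a x) - overlap a s.
  move: P; rewrite -(OE a a1) -(RintegralB measurableT (I _ _ a1' a1) (I _ _ a1 a1)).
  congr (_ <= _).
  transitivity (\int[mu]_x ((a' x * kconv (gauss s) a x - a x * kconv (gauss s) a x)
    - lambda * (a' x - a x))); first by apply: Rint_eq => x; ring.
  have i1 : integ mu (fun x => a' x - a x) by exact: integB (L1b_integ a1') (L1b_integ a1).
  have i2 := integB (I _ _ a1' a1) (I _ _ a1 a1).
  rewrite (RintegralB measurableT i2 (integZ lambda i1)) (RintegralZl lambda measurableT i1).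
  rewrite (RintegralB measurableT (L1b_integ a1') (L1b_integ a1)).
  by case: ua => _ _ ->; case: ua' => _ _ ->; rewrite subrr mulr0 subr0.
have -> : diss s (fun x => a x - a' x) = overlap a s + overlap a' s
    - 2 * \int[mu]_x (a' x * kconv (gauss s) a x).
  rewrite -(OE a a1) -(OE a' a1') mulr_natl mulr2n -{1}S.
  rewrite /diss (Rint_eq mu (g := fun x => (a x * kconv (gauss s) a x + a' x * kconv (gauss s) a' x)
    - (a x * kconv (gauss s) a' x + a' x * kconv (gauss s) a x))); last first.
    by move=> x; rewrite convB//; ring.
  rewrite (RintegralB measurableT (integD (I _ _ a1 a1) (I _ _ a1' a1'))
    (integD (I _ _ a1 a1') (I _ _ a1' a1))).
  by rewrite (RintegralD measurableT (I _ _ a1 a1) (I _ _ a1' a1'))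
    (RintegralD measurableT (I _ _ a1 a1') (I _ _ a1' a1)).
rewrite !overlapE//.
move: (henergy a s) (henergy a' s) (\int[mu]_x _) => u w p; clear; lra.
Qed.

Lemma threshold_sum_bound : (0 < n)%N -> exists2 C : R, 0 < C &
  forall (a : nat -> V -> R) (lambda : nat -> R) N s E, 0 < s -> 0 < E -> 8 * s * E <= 1 ->
    henergy (a 0%N) s <= E * s ->
    (forall k, (k <= N)%N -> unit_ind (a k)) ->
    (forall k, (k < N)%N -> a k.+1 = \1_[set x | lambda k.+1 < kconv (gauss s) (a k) x]) ->
    \sum_(k < N) (lambda k.+1 - 2^-1) ^+ 2 <= C * (N%:R * (s ^+ 2 * E ^+ 4) + E ^+ 2).
Proof.
move=> n0; have [C C0 H] := @step_estimate R n n0.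
exists C => // a lambda N s E s0 E0 sE h0 ua aE.
have D k : (k < N)%N -> diss s (fun x => a k x - a k.+1 x) <= henergy (a k) s - henergy (a k.+1) s.
  by move=> kN; apply: (@diss_le_energy_drop _ _ (lambda k.+1)) => //; [exact/ua/ltnW|exact: ua|exact: aE].
have D0 k : (k < N)%N -> 0 <= diss s (fun x => a k x - a k.+1 x).
  move=> kN; apply: diss_ge0 => //; have [h1 _ _] := ua _ (ltnW kN); have [h2 _ _] := ua _ kN.
  exact: L1bB.
(* The dissipation is nonnegative, so the energy decreases along the scheme and the initial bound
   holds at each step, as [step_estimate] requires. *)
have hE k : (k <= N)%N -> henergy (a k) s <= E * s.
  elim: k => // k IH kN; have := D k kN; have := D0 k kN; have := IH (ltnW kN).
  by move: (diss _ _) (henergy _ _) (henergy _ _) (E * s) => u w p q; clear; lra.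
apply: (@le_trans _ _ (\sum_(k < N) C * (s ^+ 2 * E ^+ 4 +
    E / s * (henergy (a k) s - henergy (a k.+1) s)))).
  apply: ler_sum => k _; have kN := ltn_ord k.
  apply: (le_trans (H (a k) (a k.+1) _ s E (ua _ (ltnW kN)) (ua _ kN) s0 E0 (aE k kN) (hE _ kN) sE)).
  by rewrite ler_wpM2l ?(ltW C0)// lerD2l ler_wpM2l ?divr_ge0 ?(ltW E0) ?(ltW s0)// D.
rewrite -mulr_sumr ler_wpM2l ?(ltW C0)// big_split/= sumr_const card_ord -[X in X + _]mulr_natl lerD2l.
rewrite -mulr_sumr -(big_mkord xpredT (fun k => henergy (a k) s - henergy (a k.+1) s)).
rewrite (_ : \sum_(0 <= k < N) _ = henergy (a 0%N) s - henergy (a N) s); last first.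
  rewrite -[RHS]opprB -(telescope_sumr (fun k => henergy (a k) s) (leq0n N)) -sumrN; apply: eq_bigr => k _.
  by rewrite opprB.
rewrite (_ : E ^+ 2 = E / s * (E * s)); last by field; rewrite gt_eqF.
rewrite ler_wpM2l ?divr_ge0 ?(ltW E0) ?(ltW s0)// (le_trans _ h0)// gerBl.
by apply: henergy_ge0; exact: ua.
Qed.

End energy_dissipation.

(** * From Lebesgue measurable to Borel functions *)

Section lebesgue_completion.
Context {R : realType} {n : nat}.
Notation V := 'rV[R]_n.
Notation mu := (@borel_lebesgue_rV R n).
Notation lam := (lebesgue_rV R n).
Implicit Types (A B : set V) (f g a : V -> R) (h s : R).

Lemma lebesgue_rVE A : measurable A -> lam A = mu A.
Proof. by move=> mA; exact: measurable_mu_extE. Qed.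

Lemma measurable_lebesgue A : measurable A -> measurable (A : set (lebesgue_space R n)).
Proof. exact: caratheodory_measurable_mu_ext. Qed.

Lemma measurable_fun_lebesgue d (T : measurableType d) (f : V -> T) :
  measurable_fun setT f -> measurable_fun [set: lebesgue_space R n] f.
Proof.
by move=> mf _ Y mY; apply: measurable_lebesgue; exact: mf.
Qed.

(** The identity is measurable from the completed sigma-algebra to the Borel one, and the
    pushforward of [lam] under it is [mu]. *)
Lemma ge0_integral_lebesgue (f : V -> \bar R) : measurable_fun setT f ->
  (forall x, 0 <= f x)%E -> (\int[lam]_x f x = \int[mu]_x f x)%E.
Proof.
move=> mf f0; have mid : measurable_fun [set: lebesgue_space R n] (@id V).
  by apply: measurable_fun_lebesgue; exact: measurable_id.
rewrite -(@ge0_integral_pushm _ _ _ V R lam (@id V) mid f mf f0).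
apply: eq_measure_integral => A mA _ /=.
by rewrite /pushforward preimage_id lebesgue_rVE.
Qed.

Lemma integral_lebesgue (f : V -> \bar R) : measurable_fun setT f ->
  (\int[lam]_x f x = \int[mu]_x f x)%E.
Proof.
move=> mf; rewrite integralE [RHS]integralE !ge0_integral_lebesgue//.
- exact: measurable_funeneg.
- exact: measurable_funepos.
Qed.

(** The completed measure is an infimum over Borel covers; the intersection of covers of excess at
    most [1 / (k + 1)] has no excess. *)
Lemma borel_hull (A : set (lebesgue_space R n)) : measurable A -> lam A = 1%E ->
  exists B : set V, [/\ measurable B, A `<=` B & mu B = 1%E].
Proof.
move=> mA A1.
have H k : exists F : set V, [/\ measurable F, A `<=` F & (mu F <= 1 + (k.+1%:R^-1)%:E)%E].
  have : (ereal_inf [set (\sum_(k <oo) mu (F k))%E | F in measurable_cover (A : set V)])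
      \is a fin_num by move: A1; rewrite /= /completed_measure_extension /mu_ext => ->.
  move=> /(@lb_ereal_inf_adherent _ _ (k.+1%:R^-1 : R)) => /(_ _)[|_ [F [mF AF] <-] FE].
    by rewrite invr_gt0.
  exists (\bigcup_k F k); split => //; first exact: bigcup_measurable.
  apply: (@le_trans _ _ (\sum_(k <oo) mu (F k))%E).
    by apply: measure_sigma_subadditive => //; exact: bigcup_measurable.
  by apply: ltW; move: FE A1; rewrite /= /completed_measure_extension /mu_ext => + <-.
pose F k := sval (cid (H k)).
have FP k : [/\ measurable (F k), A `<=` F k & (mu (F k) <= 1 + (k.+1%:R^-1)%:E)%E].
  by rewrite /F; case: cid.
have mB : measurable (\bigcap_k F k) by apply: bigcap_measurable => // k _; case: (FP k).
exists (\bigcap_k F k); split => //; first by move=> x Ax k _; case: (FP k) => _ + _; apply.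
apply/eqP; rewrite eq_le; apply/andP; split.
  apply/lee_addgt0Pr => e e0.
  have [k ke] : exists k, k.+1%:R^-1 < e.
    by have := near_infty_natSinv_lt (PosNum e0) => -[k _ ke]; exists k; exact: (ke k (leqnn k)).
  have [mF AF FE] := FP k; apply: (le_trans (y := mu (F k))).
    by apply: le_measure; rewrite ?inE//; exact: bigcap_inf.
  by apply: (le_trans FE); rewrite leeD2l// lee_fin ltW.
rewrite -A1 -lebesgue_rVE//; apply: le_measure; rewrite ?inE//.
  exact: measurable_lebesgue.
by move=> x Ax k _; case: (FP k) => _ + _; apply.
Qed.

(* Convolutions and test integrals see [f] only through these integrals. *)
Definition borel_version f a := forall g, measurable_fun setT g ->
  (\int[lam]_x (g x * f x)%:E = \int[mu]_x (g x * a x)%:E)%E.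

Lemma borel_version_refl a : measurable_fun setT a -> borel_version a a.
Proof.
move=> ma g mg; rewrite integral_lebesgue//.
by apply/measurable_EFinP; exact: measurable_funM.
Qed.

(** The set [B] minus [A] is null, as the measures are equal and finite, so the two integrands agree
    almost everywhere. *)
Lemma borel_version_hull (A : set (lebesgue_space R n)) B : measurable A ->
  lam A = 1%E -> measurable B -> A `<=` B -> mu B = 1%E ->
  borel_version (\1_A : V -> R) \1_B.
Proof.
move=> mA A1 mB AB B1 g mg.
have mg' := measurable_fun_lebesgue mg.
rewrite -integral_lebesgue; last first.
  by apply/measurable_EFinP; exact: measurable_funM.
have mBl := measurable_lebesgue mB.
have mf (C : set (lebesgue_space R n)) : measurable C -> measurable_fun
    [set: lebesgue_space R n] (fun x => (g x * \1_C x)%:E).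
  by move=> mC; apply/measurable_EFinP; apply: measurable_funM => //; exact: measurable_indic.
apply: (@ae_eq_integral _ (lebesgue_space R n) R lam setT (fun x => (g x * \1_B x)%:E)
  (fun x => (g x * \1_A x)%:E) measurableT (mf _ mA) (mf _ mBl)).
exists (B `\` A); split.
- exact: measurableD.
- have lB : lam B = 1%E by rewrite lebesgue_rVE.
  have E : lam B = (lam (B `\` A) + lam (B `&` A))%E := measureDI lam mBl mA.
  move: E; rewrite lB setIC (setIidl AB) A1.
  case: (lam (B `\` A)) => //= r; rewrite -EFinD => -[] h.
  by congr EFin; apply: (addIr 1); rewrite add0r -h.
move=> x /= xAB; apply: contrapT => BA; apply: xAB => _.
congr ((_ * _)%:E); rewrite !indicE.
have [xA|xA] := boolP (x \in A); first by rewrite mem_set//; apply: AB; rewrite inE in xA.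
rewrite memNset// => xB; apply: BA; split => //.
by move=> xA'; move: xA; rewrite mem_set.
Qed.

Lemma convolution_heat_kernel h (Om : set V) a : 0 < h -> borel_version \1_Om a ->
  convolution (heat_kernel h) \1_Om = kconv (gauss (Num.sqrt h)) a.
Proof.
move=> h0 H; apply/funext => x; rewrite /convolution /kconv /Rintegral; congr fine.
under eq_integral do rewrite heat_kernelE//.
apply: H; have := @measurable_gauss R n (Num.sqrt h).
move=> mgs; apply: (measurableT_comp mgs).
by have := @measurable_affine_rV R n (-1) x; congr measurable_fun; apply/funext => y; rewrite scaleN1r addrC.
Qed.

Lemma unit_ind_set B : measurable B -> mu B = 1%E -> unit_ind (\1_B : V -> R).
Proof.
move=> mB B1; have E : (\int[mu]_x (\1_B x : R)%:E = 1)%E by rewrite integral_indic// setIT.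
split; last by rewrite /Rintegral E.
- split; last by exists 1 => x; rewrite indicE; case: (_ \in _); rewrite /= ?normr1 ?normr0.
  apply/integrableP; split; first by apply/measurable_EFinP; exact: measurable_indic.
  rewrite (eq_integral (fun x => (\1_B x : R)%:E)) ?E ?ltry// => x _ /=.
  by rewrite ger0_norm// indicE.
- by move=> x; rewrite indicE; case: (_ \in _); [right|left].
Qed.

End lebesgue_completion.

(** The closed interval contains the endpoint [N * h], where the interpolation takes the value
    [lambda N.+1], about which nothing is known. Hence the sum over [N.+1] cells in the proof, the
    last of which meets the interval in a single point. *)
Lemma integral_lambda_interp (R : realType) (h : R) (N : nat) (lambda : nat -> R) : 0 < h ->
  (\int[@lebesgue_measure R]_(t in `[0%R, (N%:R * h)%R])
      ((lambda_interp h lambda t - 2^-1) ^+ 2)%:E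
    <= (h * \sum_(k < N) (lambda k.+1 - 2^-1) ^+ 2)%:E)%E.
Proof.
move=> h0; pose c k := (lambda k.+1 - 2^-1) ^+ 2.
have c0 k : 0 <= c k by exact: sqr_ge0.
pose I k : set (measurableTypeR R) := `[k%:R * h, k.+1%:R * h[%classic.
have mI k : measurable (I k) by exact: measurable_itv.
pose D : set (measurableTypeR R) := `[0, N%:R * h]%classic.
have mD : measurable D by exact: measurable_itv.
have m1 k : measurable_fun D (EFin \o (\1_(I k) : measurableTypeR R -> R)).
  by apply/measurable_EFinP; exact: measurable_indic.
have E t : t \in D -> ((lambda_interp h lambda t - 2^-1) ^+ 2)%:E =
    (\sum_(k < N.+1) (c k)%:E * (\1_(I k) t)%:E)%E.
  rewrite inE /D /= in_itv /= => /andP[t0 tN].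
  have th : 0 <= t / h by rewrite divr_ge0// ltW.
  have /andP[k1 k2] := truncn_itv th; rewrite /lambda_interp.
  set k := Num.truncn _ in k1 k2 *.
  have kN : (k < N.+1)%N.
    by rewrite ltnS -(@ler_nat R) (le_trans k1)// ler_pdivrMr.
  rewrite (bigD1 (Ordinal kN))//= big1 ?adde0 => [|j jk].
    rewrite indicE mem_set ?mule1// /I /= in_itv /=.
    by rewrite -ler_pdivlMr// k1 -ltr_pdivrMr.
  rewrite indicE memNset ?mule0// /I /= in_itv /= -ler_pdivlMr// -ltr_pdivrMr// => jt.
  by move/eqP: jk; apply; apply: val_inj; rewrite /= /k (truncn_def jt).
rewrite (eq_integral _ _ E) ge0_integral_sum//; last first.
- by move=> k t _; rewrite mule_ge0 ?lee_fin// indicE.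
- by move=> k; apply: measurable_funeM; exact: m1.
have Z k : (\int[@lebesgue_measure R]_(t in D) ((c k)%:E * (\1_(I k) t)%:E) =
    (c k)%:E * lebesgue_measure (I k `&` D))%E.
  have nn t : D t -> (0 <= (EFin \o (\1_(I k) : measurableTypeR R -> R)) t)%E.
    by move=> _; rewrite /= lee_fin indicE.
  by rewrite (ge0_integralZl_EFin _ mD nn (m1 k) (c0 k)) integral_indic.
under eq_bigr do rewrite Z.
rewrite big_ord_recr /= (_ : lebesgue_measure (I N `&` D) = 0%E); last first.
  apply/eqP; rewrite eq_le measure_ge0 andbT -(lebesgue_measure_set1 (N%:R * h)).
  apply: le_measure; rewrite ?inE//; first exact: measurableI.
  move=> t []; rewrite /I /D /= !in_itv /= => /andP[t1 _] /andP[_ t2].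
  by apply/eqP; rewrite eq_le t1 t2.
rewrite mule0 adde0 (mulrC h) mulr_suml -sumEFin; apply: lee_sum => k _.
rewrite -/(c k) (EFinM (c k)); apply: lee_wpmul2l; first by rewrite lee_fin.
rewrite (_ : h%:E = lebesgue_measure (I k)); last first.
  rewrite lebesgue_measure_itv /= lte_fin ltr_pM2r// ltr_nat ltnS leqnn -EFinB -mulrBl.
  by rewrite -natrB// subSnn mul1r.
by apply: le_measure; rewrite ?inE//; first exact: measurableI.
Qed.

(** * The initial datum *)

Section initial_datum.
Context {R : realType} {d : nat}.
Notation V := 'rV[R]_d.
Notation mu := (@borel_lebesgue_rV R d).
Notation lam := (lebesgue_rV R d).
Implicit Types (chi : V -> R) (h s E : R).

Lemma variation_of_energy chi E : energy chi = E%:E ->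
  total_variation_rV chi = (Num.sqrt pi * E)%:E.
Proof.
have p0 : 0 < (Num.sqrt pi : R)^-1 by rewrite invr_gt0 sqrtr_gt0 pi_gt0.
rewrite /energy; case: (total_variation_rV chi) => [r| |].
- rewrite -EFinM => -[<-]; congr EFin; rewrite mulrA divff ?mul1r// gt_eqF//.
  by rewrite -invr_gt0.
- by rewrite gt0_muley// lte_fin.
- by rewrite gt0_muleNy// lte_fin.
Qed.

Lemma total_variation_rV_ge0 chi : (0 <= total_variation_rV chi)%E.
Proof.
apply: ereal_sup_ubound; exists (cst 0).
  split; first split.
  - by move=> i x; exact: derivable_cst.
  - move=> i; rewrite (_ : 'D_(basis_vec i) (cst 0) = cst 0); first exact: cst_continuous.
    by apply/funext => x; exact: derive_cst.
  - rewrite /compact_support (_ : [set x | _] = set0) ?closure0; first exact: compact0.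
    by apply/seteqP; split => x //=; rewrite eqxx.
  - by move=> x; rewrite /enorm big1 ?sqrtr0// => i _; rewrite mxE expr0n.
rewrite integral0_eq// => x _.
by rewrite /divergence big1 ?mulr0// => i _; rewrite derive_cst mxE.
Qed.

Lemma compact_closure_bounded (A : set V) : compact (closure A) ->
  exists M : R, forall x, A x -> forall j, `|x ord0 j| <= M.
Proof.
move=> /compact_bounded[M [_ HM]]; exists (M + 1) => x Ax j.
by rewrite (le_trans (norm_coord_le x j))// HM ?ltrDl//; exact: subset_closure.
Qed.

Lemma measurable_cube (M : R) : measurable [set x : V | forall j, `|x ord0 j| <= M].
Proof.
rewrite (_ : [set x | _] = \bigcap_(j in [set: 'I_d]) [set x : V | `|x ord0 j| <= M]).
  apply: fin_bigcap_measurable => // j _; rewrite -[X in measurable X]setTI.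
  have := (measurableT_comp (@normr_measurable R setT) (@measurable_coord_rV R d j)).
  move=> /(_ measurableT `]-oo, M]%classic (measurable_itv _)).
  by congr measurable; apply/seteqP; split => x /=; rewrite in_itv.
by apply/seteqP; split => x /= H j; [move=> _|]; exact: H.
Qed.

Lemma initial_borel_version chi : measurable_fun [set: lebesgue_space R d] chi ->
  (forall x, chi x = 0 \/ chi x = 1) -> (\int[lam]_x (chi x)%:E = 1)%E ->
  compact (closure [set x | chi x = 1]) ->
  exists (a : V -> R) (M : R), [/\ unit_ind a, forall x, a x = 1 -> forall j, `|x ord0 j| <= M,
    borel_version \1_[set x | chi x = 1] a & forall x, chi x = 1 -> a x = 1].
Proof.
move=> mchi chi01 chi1 /compact_closure_bounded[M HM].
set A := [set x | chi x = 1] in HM *.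
have chiE : chi = \1_A.
  apply/funext => x; rewrite indicE; have [cx|cx] := chi01 x.
    by rewrite memNset//= /A /= cx => /eqP; rewrite eq_sym oner_eq0.
  by rewrite mem_set.
have mA : measurable (A : set (lebesgue_space R d)).
  by have := mchi measurableT [set 1] (measurable_set1 1); rewrite setTI.
have A1 : lam A = 1%E.
  by move: chi1; rewrite chiE integral_indic// setIT.
have [B [mB AB B1]] := borel_hull mA A1.
(* A Borel hull may be unbounded; cutting it by a cube containing [A] restores boundedness without
   changing its measure. *)
pose B' := B `&` [set x : V | forall j, `|x ord0 j| <= M].
have mB' : measurable B' by apply: measurableI => //; exact: measurable_cube.
have AB' : A `<=` B' by move=> x Ax; split; [exact: AB|exact: HM].
have B'1 : mu B' = 1%E.
  apply/eqP; rewrite eq_le; apply/andP; split.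
    by rewrite -B1; apply: le_measure; rewrite ?inE//; exact: subIsetl.
  rewrite -A1 -lebesgue_rVE//; apply: le_measure; rewrite ?inE//.
  exact: measurable_lebesgue.
exists \1_B', M; split.
- exact: unit_ind_set.
- move=> x; rewrite indicE; have [xB _ j|_ /= /eqP] := boolP (x \in B'); last by rewrite eq_sym oner_eq0.
  by move: xB; rewrite inE => -[_]; apply.
- exact: borel_version_hull.
- by move=> x Ax; rewrite indicE mem_set//; exact: AB'.
Qed.

End initial_datum.

Theorem proposition1p12 (R : realType) (d : nat) (hd : (0 < d)%N) :
  exists C : R, 0 < C /\
  forall (T : R) (chi0 : 'rV[R]_d -> R) (E0 : R),
    measurable_fun [set: lebesgue_space R d] chi0 ->
    (forall x, chi0 x = 0 \/ chi0 x = 1) ->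
    (\int[lebesgue_rV R d]_x (chi0 x)%:E = 1)%E ->
    compact (closure [set x | chi0 x = 1]) ->
    energy chi0 = E0%:E ->
    forall (h : R) (N : nat) (Omega : nat -> set 'rV[R]_d) (lambda : nat -> R),
      0 < h -> h < (C * E0 ^+ 2)^-1 -> T = N%:R * h ->
      vp_thresholding chi0 h N Omega lambda ->
      (\int[@lebesgue_measure R]_(t in `[0%R, T])
          ((lambda_interp h lambda t - 2^-1) ^+ 2)%:E
        <= (C * (1 + T) * (1 + E0 ^+ 4) * h)%:E)%E.
Proof.
have [K K0 HK] := @henergy_le_variation R d.
have [C1 C10 HC] := @threshold_sum_bound R d hd.
pose P : R := Num.sqrt pi; pose B := K * P.
have P0 : 0 < P by rewrite sqrtr_gt0 pi_gt0.
have B0 : 0 < B by rewrite mulr_gt0.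
have b2 : 0 < B ^+ 2 by rewrite exprn_gt0.
have b4 : 0 < B ^+ 4 by rewrite exprn_gt0.
pose C2 := C1 * (B ^+ 4 + B ^+ 2).
have C20 : 0 < C2 by rewrite mulr_gt0// addr_gt0.
(* The first summand turns the condition on [h] into [(8 * s * E) ^+ 2 <= 1] with [E = B * E0]; the
   second is the constant of the final estimate. *)
exists (64 * B ^+ 2 + C2); split; first by rewrite addr_gt0// mulr_gt0.
move=> T chi0 E0 mchi chi01 chi1 cchi Echi h N Om lambda h0 hC TE [Om0 step].
have TV := variation_of_energy Echi.
have PE0 : 0 <= P * E0 by have := total_variation_rV_ge0 chi0; rewrite TV lee_fin.
(* For [E0 = 0] the bound on [h] reads [h < 0^-1], and [0^-1 = 0] contradicts [0 < h]. *)
have E00 : 0 < E0.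
  have : 0 <= E0 by rewrite -(pmulr_rge0 _ P0).
  rewrite le_eqVlt => /predU1P[E00|//].
  by move: hC; rewrite -E00 expr0n mulr0 invr0 => /(lt_trans h0); rewrite ltxx.
pose s := Num.sqrt h; have s0 : 0 < s by rewrite sqrtr_gt0.
have s2 : s ^+ 2 = h by rewrite sqr_sqrtr// ltW.
pose E := K * (P * E0).
have E0' : E = B * E0 by rewrite /E mulrA.
have Ep : 0 < E by rewrite E0' mulr_gt0.
have sE : 8 * s * E <= 1.
  have sE0 : 0 <= 8 * s * E by rewrite !mulr_ge0// ltW.
  rewrite -(@expr_le1 _ 2)//.
  have E2 : 0 < E0 ^+ 2 by rewrite exprn_gt0.
  have CE : 0 < (64 * B ^+ 2 + C2) * E0 ^+ 2 by rewrite mulr_gt0// addr_gt0// mulr_gt0.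
  have : h * ((64 * B ^+ 2 + C2) * E0 ^+ 2) <= 1 by rewrite -ler_pdivlMr// mul1r ltW.
  apply: le_trans; rewrite (_ : (8 * s * E) ^+ 2 = h * (64 * B ^+ 2 * E0 ^+ 2)).
    by rewrite ler_wpM2l ?(ltW h0)// ler_wpM2r ?(ltW E2)// lerDl ltW.
  by rewrite E0' -s2; ring.
have [a0 [M [ua0 a0M a0v a01]]] := initial_borel_version mchi chi01 chi1 cchi.
(* Only the initial set needs a Borel version: the later ones are superlevel sets of Borel
   functions. *)
pose a k : 'rV[R]_d -> R := if k is 0%N then a0 else \1_(Om k).
have A k : (k <= N)%N -> unit_ind (a k) /\ borel_version \1_(Om k) (a k).
  elim: k => [_|k IH kN]; first by rewrite Om0.
  have [uk vk] := IH (ltnW kN); have [l1 OmE] := step k kN.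
  have mO : measurable (Om k.+1).
    rewrite OmE (convolution_heat_kernel h0 vk).
    have ak : L1b (a k) by case: uk.
    have mk := (L1b_bmf (L1b_conv (L1b_gauss (n := d) s0) ak)).1.
    have := mk measurableT `]lambda k.+1, +oo[%classic (measurable_itv _).
    by rewrite setTI; congr measurable; apply/seteqP; split => x /=; rewrite in_itv/= andbT.
  split; last by apply: borel_version_refl; exact: measurable_indic.
  by apply: unit_ind_set => //; rewrite -lebesgue_rVE// [in LHS]OmE.
have aE k : (k < N)%N -> a k.+1 = \1_[set x | lambda k.+1 < kconv (gauss s) (a k) x].
  move=> kN; have [_ OmE] := step k kN; have [_ vk] := A k (ltnW kN).
  by rewrite /= OmE (convolution_heat_kernel h0 vk).
have H0 : henergy (a 0%N) s <= E * s.
  apply: (HK a0 M (P * E0)) => // xi g xi1 xi2 xi3 mg xig.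
  have : (\int[lebesgue_rV R d]_x (chi0 x * divergence xi x)%:E <= (P * E0)%:E)%E.
    by rewrite -TV; apply: ereal_sup_ubound; exists xi.
  (* Where [chi0] equals 1 so does [a0], and there [g] is the divergence. After this replacement the
     integrand has the form that [borel_version] covers. *)
  rewrite (_ : (\int[lebesgue_rV R d]_x _ = \int[lebesgue_rV R d]_x
      (g x * \1_[set x | chi0 x = 1] x)%:E)%E); last first.
    apply: eq_integral => x _; congr EFin; rewrite indicE.
    have [cx|cx] := chi01 x.
      by rewrite cx mul0r memNset ?mulr0//= cx => /eqP; rewrite eq_sym oner_eq0.
    by have := xig x; rewrite cx mem_set// (a01 x cx) mulr1 !mul1r.
  rewrite (a0v g mg) /Rintegral.
  under [X in fine X]eq_integral do rewrite mulrC.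
  (* An integral equal to plus infinity contradicts the bound; for minus infinity [fine] returns 0,
     which is below [P * E0] by [PE0]. *)
  by case: (integral _ _ _) => [r| |] //=.
have S := HC a lambda N s E s0 Ep sE H0 (fun k kN => (A k kN).1) aE.
have N0 : 0 <= T by rewrite TE mulr_ge0// ltW.
rewrite TE; apply: (le_trans (integral_lambda_interp N lambda h0)).
rewrite lee_fin -TE mulrC ler_wpM2r ?(ltW h0)//; apply: (le_trans S).
rewrite s2 mulrA -TE E0'.
have e4 : 0 <= E0 ^+ 4 by rewrite exprn_ge0// ltW.
have e2 : E0 ^+ 2 <= 1 + E0 ^+ 4.
  rewrite (_ : E0 ^+ 4 = (E0 ^+ 2) ^+ 2); last by rewrite -exprM.
  by move: (E0 ^+ 2) => u; clear; nra.
apply: (@le_trans _ _ (C2 * (1 + T) * (1 + E0 ^+ 4))); last first.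
  by rewrite !ler_wpM2r ?addr_ge0// lerDr mulr_ge0// ltW.
rewrite (_ : C2 * (1 + T) * (1 + E0 ^+ 4) = C1 * (B ^+ 4 * ((1 + T) * (1 + E0 ^+ 4))
  + B ^+ 2 * ((1 + T) * (1 + E0 ^+ 4)))); last by rewrite /C2; ring.
rewrite (_ : T * (B * E0) ^+ 4 = B ^+ 4 * (T * E0 ^+ 4)); last by ring.
rewrite (_ : (B * E0) ^+ 2 = B ^+ 2 * E0 ^+ 2); last by ring.
rewrite ler_wpM2l ?(ltW C10)// lerD// ler_wpM2l ?(ltW b4) ?(ltW b2)//.
  by apply: ler_pM => //; rewrite lerDr.
by rewrite (le_trans e2)// ler_peMl ?addr_ge0// lerDl.
Qed.
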